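(* Let $\Lambda=kQ/I$ be a bound quiver algebra over a field $k$. Then $$e(\Lambda)=\dim_k\mathrm{Hom}_{kQ-kQ}(I/I^2,\Lambda)-\dim_k\mathrm{HH}^2(\Lambda).$$
   Context: $k$ is a field. ''Algebra'' means finite dimensional associative unital $k$-algebra; modules over it are finitely generated. For an algebra $\Lambda$, $\Lambda^e=\Lambda\otimes_k\Lambda^{op}$, and $\Lambda$-bimodules are identified with left $\Lambda^e$-modules; $\mathrm{Hom}_{\Lambda-\Lambda}$, $\mathrm{Ext}_{\Lambda-\Lambda}$ denote Hom and Ext over $\Lambda^e$. $\mathrm{HH}^n(\Lambda)=\mathrm{Ext}^n_{\Lambda-\Lambda}(\Lambda,\Lambda)$ is Hochschild cohomology. Auslander-Reiten translation: $\mathsf D=\mathrm{Hom}_k(-,k)$. For an algebra $A$ and a left $A$-module $M$ with minimal projective presentation $P_1\xrightarrow{d_1}P_0\to M\to 0$, $\mathrm{Tr}\,M$ is the cokernel of $d_1^*:\mathrm{Hom}_A(P_0,A)\to\mathrm{Hom}_A(P_1,A)$ and $\tau M=\mathsf D\,\mathrm{Tr}\,M$. Here $\tau\Lambda$ is computed with $A=\Lambda^e$ and $M=\Lambda$. The first $\tau$-Hochschild cohomology is $\mathrm{HH}^1_\tau(\Lambda)=\mathsf D\,\mathrm{Hom}_{\Lambda-\Lambda}(\Lambda,\tau\Lambda)$. The excess is $e(\Lambda)=\dim_k\mathrm{HH}^1_\tau(\Lambda)-\dim_k\mathrm{HH}^1(\Lambda)$. A quiver $Q$ is a finite oriented graph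 with vertices $Q_0$, arrows $Q_1$. $kQ$ is the path algebra with basis all oriented paths (including the vertices, the paths of length $0$). $F=\langle Q_1\rangle$ is the ideal generated by the arrows. A two-sided ideal $I$ of $kQ$ is admissible if $F^n\subset I\subset F^2$ for some $n\ge 2$; then $kQ/I$ is called a bound quiver algebra. $\mathrm{Hom}_{kQ-kQ}$ denotes morphisms of $kQ$-bimodules; $I/I^2$ and $\Lambda=kQ/I$ are $kQ$-bimodules in the natural way. *)

(* Defs.v *)
From HB Require Import structures.
From mathcomp Require Import all_boot all_order all_algebra.
From mathcomp Require Import finmap.
From mathcomp.multinomials Require Import monalg.
From mathcomp Require Import boolp.

Set Implicit Arguments.
Unset Strict Implicit.
Unset Printing Implicit Defensive.

Import GRing.Theory.
Local Open Scope quotient_scope.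
Local Open Scope ring_scope.

(* Associative unital k-algebras.  The library's algType and falgType require
   1 != 0 and cannot be weakened from outside; here the zero algebra is allowed,
   so that the quiver without vertices is not excluded. *)
HB.mixin Record isAlgebra (k : fieldType) A of GRing.Lmodule k A := {
  amul : A -> A -> A;
  aone : A;
  amulA : associative amul;
  amul1x : left_id aone amul;
  amulx1 : right_id aone amul;
  amul_linl : forall (c : k) (x y z : A),
    amul (c *: x + y) z = c *: amul x z + amul y z;
  amul_linr : forall (c : k) (x y z : A),
    amul x (c *: y + z) = c *: amul x y + amul x z
}.

#[short(type="algebraType")]
HB.structure Definition AssocAlgebra (k : fieldType) :=
  { A of GRing.Lmodule k A & isAlgebra k A }.

#[short(type="fdAlgebraType")]
HB.structure Definition FdAssocAlgebra (k : fieldType) :=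
  { A of AssocAlgebra k A & Vector k A }.

Arguments aone {k s}.
Notation "x *a y" := (amul x y) (at level 40, left associativity) : ring_scope.

Section AlgebraTheory.
Variables (k : fieldType) (A : algebraType k).

HB.instance Definition _ (x : A) := GRing.isLinear.Build k A A *:%R (amul x)
  (fun c y z => amul_linr c x y z).

Definition amulr (y x : A) : A := x *a y.
HB.instance Definition _ (y : A) := GRing.isLinear.Build k A A *:%R (amulr y)
  (fun c x z => amul_linl c x z y).

Lemma amul0x (y : A) : 0 *a y = 0. Proof. exact: (linear0 (amulr y)). Qed.
Lemma amulx0 (x : A) : x *a 0 = 0. Proof. exact: linear0. Qed.
Lemma amulDx (x y z : A) : (x + y) *a z = x *a z + y *a z.
Proof. exact: (linearD (amulr z)). Qed.
Lemma amulxD (x y z : A) : x *a (y + z) = x *a y + x *a z.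
Proof. exact: linearD. Qed.
Lemma amulBx (x y z : A) : (x - y) *a z = x *a z - y *a z.
Proof. exact: (linearB (amulr z)). Qed.
Lemma amulxB (x y z : A) : x *a (y - z) = x *a y - x *a z.
Proof. exact: linearB. Qed.
Lemma amulZx c (x y : A) : (c *: x) *a y = c *: (x *a y).
Proof. exact: (linearZ_LR (amulr y)). Qed.
Lemma amulxZ c (x y : A) : x *a (c *: y) = c *: (x *a y).
Proof. exact: linearZ_LR. Qed.
Lemma amul_suml I (r : seq I) (P : pred I) (F : I -> A) y :
  (\sum_(i <- r | P i) F i) *a y = \sum_(i <- r | P i) F i *a y.
Proof. exact: (linear_sum (amulr y)). Qed.
Lemma amul_sumr I (r : seq I) (P : pred I) (F : I -> A) x :
  x *a (\sum_(i <- r | P i) F i) = \sum_(i <- r | P i) x *a F i.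
Proof. exact: linear_sum. Qed.
End AlgebraTheory.

Record subspace (k : fieldType) (V : lmodType k) := Subspace {
  smem :> V -> Prop;
  smem0 : smem 0;
  smemD : forall x y, smem x -> smem y -> smem (x + y);
  smemZ : forall (c : k) x, smem x -> smem (c *: x)
}.

Definition finite_codim (k : fieldType) (V : lmodType k) (S : subspace V) : Prop :=
  exists (J : finType) (e : J -> V),
    forall v, exists c : J -> k, S (v - \sum_j c j *: e j).

Section SubspaceQuotient.
Variables (k : fieldType) (V : lmodType k) (S : subspace V).

Definition smem_pred : {pred V} := fun x => `[< S x >].

Lemma smem_predE x : (x \in smem_pred) = `[< S x >]. Proof. by []. Qed.

Fact smem_pred_zmod : zmod_closed smem_pred.
Proof.
split; first by apply/asboolP; exact: smem0.
move=> x y /asboolP Sx /asboolP Sy; apply/asboolP; apply: smemD => //.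
by rewrite -scaleN1r; apply: smemZ.
Qed.
HB.instance Definition _ := GRing.isZmodClosed.Build V smem_pred smem_pred_zmod.

Definition quot : Type := Quotient.quot smem_pred.
HB.instance Definition _ := GRing.Zmodule.on quot.

Definition qpi (x : V) : quot := \pi_(Quotient.quot smem_pred) x.
Definition qrepr (u : quot) : V := @generic_quotient.repr V (Quotient.quot smem_pred) u.

Lemma qreprK u : qpi (qrepr u) = u.
Proof. exact: (@generic_quotient.reprK V (Quotient.quot smem_pred)). Qed.

Lemma qpi_zmod : zmod_morphism qpi.
Proof. by move=> x y; rewrite /qpi raddfB. Qed.
HB.instance Definition _ := GRing.isZmodMorphism.Build V quot qpi qpi_zmod.

Lemma qpi_eqP x y : qpi x = qpi y <-> S (x - y).
Proof.
split=> [/eqP|Sxy]; last apply/eqP.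
- by rewrite -(Quotient.idealrBE smem_pred) => /asboolP.
- by rewrite -(Quotient.idealrBE smem_pred); apply/asboolP.
Qed.

Lemma qpi_eq0 x : qpi x = 0 <-> S x.
Proof. by rewrite -[0](raddf0 qpi) qpi_eqP subr0. Qed.

Lemma qreprB x : S (qrepr (qpi x) - x).
Proof. by apply/qpi_eqP; rewrite qreprK. Qed.

Definition qscale (c : k) (u : quot) : quot := qpi (c *: qrepr u).

Lemma qscale_pi c x : qscale c (qpi x) = qpi (c *: x).
Proof. by apply/qpi_eqP; rewrite -scalerBr; apply/smemZ/qreprB. Qed.

Fact qscaleA a b u : qscale a (qscale b u) = qscale (a * b) u.
Proof. by rewrite -[u]qreprK !qscale_pi scalerA. Qed.
Fact qscale1 : left_id 1 qscale.
Proof. by move=> u; rewrite -[u]qreprK qscale_pi scale1r. Qed.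
Fact qscaleDr : right_distributive qscale +%R.
Proof.
by move=> a u v; rewrite -[u]qreprK -[v]qreprK -raddfD !qscale_pi scalerDr raddfD.
Qed.
Fact qscaleDl u : {morph qscale^~ u : a b / a + b}.
Proof. by move=> a b; rewrite -[u]qreprK !qscale_pi scalerDl raddfD. Qed.
HB.instance Definition _ := GRing.Zmodule_isLmodule.Build k quot
  qscaleA qscale1 qscaleDr qscaleDl.

Lemma qpi_scalable : scalable qpi.
Proof. by move=> c x; rewrite -qscale_pi. Qed.
HB.instance Definition _ := GRing.isScalable.Build k V quot *:%R qpi qpi_scalable.

End SubspaceQuotient.

Lemma fd_vector_axiom (k : fieldType) (V : lmodType k) (J : finType) (e : J -> V) :
  (forall v, exists c : J -> k, v = \sum_j c j *: e j) ->
  exists (n : nat) (f : V -> 'rV[k]_n), linear f /\ bijective f.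
Proof.
move=> Pe.
pose spans n := `[< exists s : 'I_n -> V,
   forall v, exists c : 'rV[k]_n, v = \sum_i c 0 i *: s i >].
have ex : exists n, spans n.
  exists #|J|; apply/asboolP; exists (e \o enum_val) => v.
  have [c ->] := Pe v; exists (\row_i c (enum_val i)).
  rewrite (reindex (@enum_val J J)) /=; last first.
    by apply: onW_bij; exact: enum_val_bij.
  by apply: eq_bigr => i _; rewrite mxE.
case: (ex_minnP ex) => n /asboolP[s Ps] nmin; exists n.
pose phi (c : 'rV[k]_n) := \sum_i c 0 i *: s i.
have phiP a c d : phi (a *: c + d) = a *: phi c + phi d.
  rewrite /phi scaler_sumr -big_split; apply: eq_bigr => i _ /=.
  by rewrite !mxE scalerDl scalerA.
have phi_inj0 c : phi c = 0 -> c = 0.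
  move=> c0; apply/rowP => i; rewrite mxE; apply/eqP; apply: contraT => ci.
  case: n s Ps nmin @phi phiP c i c0 ci => [|n] s Ps nmin phi phiP c i c0 ci.
    by case: i {ci}.
  suff /nmin : spans n by rewrite ltnn.
  apply/asboolP; exists (s \o lift i) => v.
  have [d ->] := Ps v.
  exists (\row_j (d 0 (lift i j) - d 0 i / c 0 i * c 0 (lift i j))).
  have si : s i = \sum_j (- (c 0 (lift i j) / c 0 i)) *: s (lift i j).
    move: c0; rewrite /phi (bigD1_ord i) //= => /eqP; rewrite addr_eq0 => /eqP c0.
    apply: (scalerI ci); rewrite c0 scaler_sumr -sumrN; apply: eq_bigr => j _.
    by rewrite scalerA mulrN mulrCA divff // mulr1 scaleNr.
  rewrite (bigD1_ord i) //= si scaler_sumr -big_split; apply: eq_bigr => j _ /=.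
  rewrite !mxE scalerA -scalerDl; congr (_ *: _).
  by rewrite mulrN addrC mulrA mulrAC.
have phi_inj : injective phi.
  move=> c d cd; apply/eqP; rewrite -subr_eq0; apply/eqP/phi_inj0.
  by rewrite -[c - d]addrC -scaleN1r phiP cd scaleN1r addNr.
have [g gP] := choice Ps.
have gK : cancel g phi by move=> v; rewrite [RHS]gP.
have phiK : cancel phi g by move=> c; apply: phi_inj; rewrite gK.
exists g; split; last by exists phi.
by move=> a u v; apply: phi_inj; rewrite phiP !gK.
Qed.

Section FiniteQuotient.
Variables (k : fieldType) (V : lmodType k) (S : subspace V) (fcS : finite_codim S).

(* The proof argument only serves to attach the vectType structure. *)
Definition fquot of finite_codim S : Type := quot S.
Local Notation Q := (fquot fcS).
HB.instance Definition _ := GRing.Lmodule.on Q.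

Fact fquot_ex_iso :
  exists (n : nat) (f : quot S -> 'rV[k]_n), linear f /\ bijective f.
Proof.
have [J [e Pe]] := fcS.
apply: (@fd_vector_axiom _ _ J (qpi S \o e)) => u.
have [c /qpi_eqP uc] := Pe (qrepr u); exists c.
by rewrite -[LHS]qreprK uc raddf_sum; apply: eq_bigr => j _ /=; rewrite linearZ.
Qed.

Fact fquot_vect_iso : Vector.axiom (projT1 (cid fquot_ex_iso)) Q.
Proof.
case: (cid fquot_ex_iso) => n /= /cid[f [lf bf]].
by exists f.
Qed.
HB.instance Definition _ := Lmodule_hasFinDim.Build k Q fquot_vect_iso.

Definition fpi : V -> Q := qpi S.
HB.instance Definition _ := GRing.Linear.on fpi.
End FiniteQuotient.

Section Spans.
Variables (k : fieldType) (V : vectType k).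

Lemma vspan_exists (P : V -> Prop) : exists s : seq V,
  (forall v, v \in s -> P v) /\ (forall v, P v -> v \in span s).
Proof.
pose dims n := `[< exists s : seq V,
  (forall v, v \in s -> P v) /\ \dim (span s) = n >].
have ex : exists n, dims n by exists (\dim (span (Nil V))); apply/asboolP; exists [::].
have ub n : dims n -> (n <= \dim {:V})%N.
  by move=> /asboolP[s [_ <-]]; rewrite dimvS ?subvf.
case: (ex_maxnP ex ub) => n /asboolP[s [sP dims_n]] nmax; exists s.
split=> // v Pv.
have /nmax : dims (\dim (span (v :: s))).
  by apply/asboolP; exists (v :: s); split=> // w; rewrite inE => /predU1P[->//|/sP].
rewrite -dims_n => le; have sub : (span s <= span (v :: s))%VS.
  by apply: sub_span => w; rewrite inE => ws; rewrite ws orbT.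
have /eqP -> : span s == span (v :: s) by rewrite eqEdim sub.
by rewrite memv_span ?mem_head.
Qed.

Definition vspan (P : V -> Prop) : {vspace V} := span (projT1 (cid (vspan_exists P))).

Lemma mem_vspan (P : V -> Prop) v : P v -> v \in vspan P.
Proof. by rewrite /vspan; case: cid => U /= [_]; apply. Qed.

Lemma vspan_min (P : V -> Prop) (W : {vspace V}) :
  (forall v, P v -> v \in W) -> (vspan P <= W)%VS.
Proof.
rewrite /vspan; case: cid => s /= [sP _] PW.
by apply/span_subvP => v /sP /PW.
Qed.

Lemma mem_vspan_sub (S : subspace V) v : v \in vspan S <-> S v.
Proof.
split=> [|]; last exact: mem_vspan.
rewrite /vspan; case: cid => s /= [sS _].
move/(coord_span (X := in_tuple s)) => ->.
apply: big_ind => [||i _]; [exact: smem0 | exact: smemD |].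
by apply/smemZ/sS; rewrite mem_nth.
Qed.

Definition vsub (U : {vspace V}) : subspace V :=
  @Subspace _ _ (fun v => v \in U) (mem0v U)
    (fun x y Ux Uy => memvD Ux Uy) (fun c x Ux => memvZ c Ux).

Lemma fin_codim_vect (S : subspace V) : finite_codim S.
Proof.
exists 'I_(\dim {:V}), (fun i : 'I__ => (vbasis {:V})`_i) => v.
exists (fun i => coord (vbasis {:V}) i v).
by rewrite -coord_vbasis ?memvf // subrr; apply: smem0.
Qed.

Definition vquot (U : {vspace V}) := fquot (fin_codim_vect (vsub U)).
HB.instance Definition _ U := Vector.on (vquot U).
Definition vpi (U : {vspace V}) : V -> vquot U := fpi (fin_codim_vect (vsub U)).
HB.instance Definition _ U := GRing.Linear.on (vpi U).

End Spans.

(* U / (U :&: W) *)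
Definition subquot (k : fieldType) (V : vectType k) (U W : {vspace V}) :=
  vquot ((linfun (vsval : subvs_of U -> V)) @^-1: W)%VS.
HB.instance Definition _ (k : fieldType) (V : vectType k) (U W : {vspace V}) :=
  Vector.on (subquot U W).

Section InducedMaps.
Variables (k : fieldType) (V W : vectType k).

Definition sub_map (U : {vspace V}) (U' : {vspace W}) (f : 'Hom(V, W)) :
  'Hom(subvs_of U, subvs_of U') :=
  linfun (vsproj U' \o f \o (vsval : subvs_of U -> V)).

Lemma sub_mapE (U : {vspace V}) (U' : {vspace W}) (f : 'Hom(V, W)) u :
  f (vsval u) \in U' -> vsval (sub_map U U' f u) = f (vsval u).
Proof. by move=> fu; rewrite lfunE /= vsprojK. Qed.
End InducedMaps.

Section QuotMap.
Variables (k : fieldType) (V W : vectType k) (U : {vspace V}) (U' : {vspace W}).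
Variables (f : 'Hom(V, W)) (fU : (f @: U <= U')%VS).

Definition quot_fun of (f @: U <= U')%VS : vquot U -> vquot U' :=
  fun u => vpi U' (f (@qrepr _ _ (vsub U) u)).
Local Notation qf := (quot_fun fU).

Lemma quot_funE v : qf (vpi U v) = vpi U' (f v).
Proof.
apply/(qpi_eqP (vsub U')) => /=; rewrite -linearB.
by apply: (subvP fU); apply: memv_img; apply: (qreprB (vsub U)).
Qed.

Fact quot_fun_lin : linear qf.
Proof.
move=> c u v; rewrite -[u]qreprK -[v]qreprK.
have E x : qf (qpi (vsub U) x) = vpi U' (f x) by exact: quot_funE.
by rewrite -linearP !E !linearP.
Qed.
HB.instance Definition _ := GRing.isLinear.Build k _ _ _ qf quot_fun_lin.

Definition quot_map : 'Hom(vquot U, vquot U') := linfun qf.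

Lemma quot_mapE v : quot_map (vpi U v) = vpi U' (f v).
Proof. by rewrite lfunE /= quot_funE. Qed.

End QuotMap.

(* Finitely generated modules over a finite dimensional algebra A are exactly
   the finite dimensional ones, i.e. the finite dimensional representations. *)
Record lmodule (k : fieldType) (A : algebraType k) := LModule {
  lcar :> vectType k;
  lact : A -> 'End(lcar);
  lact_lin : linear lact;
  lact1 : lact aone = \1%VF;
  lactM : forall a b, lact (a *a b) = (lact a \o lact b)%VF
}.

Record rmodule (k : fieldType) (A : algebraType k) := RModule {
  rcar :> vectType k;
  ract : A -> 'End(rcar);
  ract_lin : linear ract;
  ract1 : ract aone = \1%VF;
  ractM : forall a b, ract (a *a b) = (ract b \o ract a)%VF
}.

Section LModules.
Variables (k : fieldType) (A : algebraType k).
Implicit Types M N P : lmodule A.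

Lemma lact1E M x : lact M aone x = x.
Proof. by rewrite lact1 id_lfunE. Qed.
Lemma lactME M a b x : lact M (a *a b) x = lact M a (lact M b x).
Proof. by rewrite lactM comp_lfunE. Qed.
Lemma lactP M c a b x :
  lact M (c *: a + b) x = c *: lact M a x + lact M b x.
Proof. by rewrite lact_lin add_lfunE scale_lfunE. Qed.

Lemma lact0 M x : lact M 0 x = 0.
Proof.
have := lactP 1 0 0 x; rewrite !scale1r addr0 => /eqP.
by rewrite -subr_eq0 opprD addrA subrr sub0r oppr_eq0 => /eqP.
Qed.
Lemma lactZ M c a x : lact M (c *: a) x = c *: lact M a x.
Proof. by rewrite -[c *: a]addr0 lactP lact0 addr0. Qed.

Definition equivariant M N (f : 'Hom(M, N)) : Prop :=
  forall a x, f (lact M a x) = lact N a (f x).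

Fact equivariant0 M N : equivariant (0 : 'Hom(M, N)).
Proof. by move=> a x; rewrite !zero_lfunE linear0. Qed.
Fact equivariantD M N (f g : 'Hom(M, N)) :
  equivariant f -> equivariant g -> equivariant (f + g).
Proof. by move=> ef eg a x; rewrite !add_lfunE ef eg linearD. Qed.
Fact equivariantZ M N (c : k) (f : 'Hom(M, N)) :
  equivariant f -> equivariant (c *: f).
Proof. by move=> ef a x; rewrite !scale_lfunE ef linearZ. Qed.

Definition equivariant_sub M N : subspace 'Hom(M, N) :=
  Subspace (@equivariant0 M N) (@equivariantD M N) (@equivariantZ M N).

(* Hom_A(M, N) *)
Definition homL M N : {vspace 'Hom(M, N)} := vspan (equivariant_sub M N).

Lemma homLP M N (f : 'Hom(M, N)) : f \in homL M N <-> equivariant f.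
Proof. exact: (mem_vspan_sub (equivariant_sub M N)). Qed.

Definition lhom M N : Type := subvs_of (homL M N).
HB.instance Definition _ M N := Vector.on (lhom M N).

Definition lhom_fun M N : lhom M N -> 'Hom(M, N) := vsval.
HB.instance Definition _ M N := GRing.Linear.on (@lhom_fun M N).
Coercion lhom_fun : lhom >-> hom.

Lemma lhomE M N (f : lhom M N) : equivariant f.
Proof. exact/homLP/subvsP. Qed.

Lemma lhom_inj M N (f g : lhom M N) : f =1 g -> f = g.
Proof. by move=> fg; apply/subvs_inj/lfunP. Qed.

Lemma lhom_linE M N c (f g : lhom M N) x : (c *: f + g : lhom M N) x = c *: f x + g x.
Proof. by rewrite linearP add_lfunE scale_lfunE. Qed.

Definition mk_lhom M N (f : 'Hom(M, N)) : lhom M N := vsproj (homL M N) f.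

Lemma mk_lhomE M N (f : 'Hom(M, N)) : equivariant f -> mk_lhom f = f :> 'Hom(M, N).
Proof. by move/homLP/vsprojK. Qed.

Lemma equivariant_comp M N P (f : lhom N P) (g : lhom M N) : equivariant (f \o g)%VF.
Proof. by move=> a x; rewrite !comp_lfunE !lhomE. Qed.

Definition lhom_comp M N P (f : lhom N P) (g : lhom M N) : lhom M P :=
  mk_lhom (f \o g)%VF.

Lemma lhom_compE M N P (f : lhom N P) (g : lhom M N) x : lhom_comp f g x = f (g x).
Proof. by rewrite /lhom_comp mk_lhomE ?comp_lfunE //; apply: equivariant_comp. Qed.

Definition precomp_fun M N P (g : lhom M N) : lhom N P -> lhom M P :=
  fun f => lhom_comp f g.

Fact precomp_lin M N P (g : lhom M N) : linear (@precomp_fun M N P g).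
Proof.
move=> c f f'; apply: lhom_inj => x.
by rewrite lhom_compE !lhom_linE !lhom_compE.
Qed.
HB.instance Definition _ M N P g :=
  GRing.isLinear.Build k _ _ _ (@precomp_fun M N P g) (@precomp_lin M N P g).

(* Hom_A(g, P) : Hom_A(N, P) -> Hom_A(M, P) *)
Definition precomp M N (g : lhom M N) P : 'Hom(lhom N P, lhom M P) :=
  linfun (@precomp_fun M N P g).

Lemma precompE M N (g : lhom M N) P (f : lhom N P) x : (precomp g P f : lhom M P) x = f (g x).
Proof. by rewrite /precomp lfunE /= lhom_compE. Qed.

Definition submodule M (U : {vspace M}) : Prop :=
  forall a x, x \in U -> lact M a x \in U.

Section SubModule.
Variables (M : lmodule A) (U : {vspace M}) (sU : submodule U).

Let sub_act a : 'End(subvs_of U) := sub_map U U (lact M a).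
Let sub_actE a u : vsval (sub_act a u) = lact M a (vsval u).
Proof. by rewrite sub_mapE ?sU ?subvsP. Qed.

Fact sub_act_lin : linear sub_act.
Proof.
move=> c a b; apply/lfunP => u; apply: subvs_inj.
by rewrite add_lfunE scale_lfunE linearP /= !sub_actE lactP.
Qed.
Fact sub_act1 : sub_act aone = \1%VF.
Proof. by apply/lfunP => u; apply: subvs_inj; rewrite sub_actE lact1 !id_lfunE. Qed.
Fact sub_actM a b : sub_act (a *a b) = (sub_act a \o sub_act b)%VF.
Proof.
by apply/lfunP => u; apply: subvs_inj; rewrite comp_lfunE !sub_actE lactME.
Qed.

Definition lsub : lmodule A := LModule sub_act_lin sub_act1 sub_actM.

Definition lincl : lhom lsub M :=
  @mk_lhom lsub M (linfun (vsval : subvs_of U -> M)).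

Lemma linclE (u : lsub) : lincl u = vsval (u : subvs_of U).
Proof.
rewrite /lincl mk_lhomE ?lfunE //.
move=> a x; rewrite [LHS]lfunE [X in _ = lact _ _ X]lfunE; exact: sub_actE.
Qed.
End SubModule.

Lemma lker_submodule M N (f : lhom M N) : submodule (lker f).
Proof. by move=> a x; rewrite !memv_ker lhomE => /eqP ->; rewrite linear0. Qed.

Lemma limg_submodule M N (f : lhom M N) : submodule (limg f).
Proof.
move=> a _ /memv_imgP[x _ ->]; rewrite -lhomE; exact/memv_img/memvf.
Qed.

Definition projective P : Prop :=
  forall M N (f : lhom P N) (g : lhom M N), limg g = fullv ->
    exists h : lhom P M, forall x, g (h x) = f x.

Record proj_resolution M := ProjResolution {
  pr_mod : nat -> lmodule A;
  pr_diff : forall n, lhom (pr_mod n.+1) (pr_mod n);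
  pr_aug : lhom (pr_mod 0) M;
  pr_proj : forall n, projective (pr_mod n);
  pr_surj : limg pr_aug = fullv;
  pr_exact0 : limg (pr_diff 0) = lker pr_aug;
  pr_exactS : forall n, limg (pr_diff n.+1) = lker (pr_diff n)
}.

Definition cocycles M (R : proj_resolution M) (N : lmodule A) (n : nat) :
  {vspace lhom (pr_mod R n) N} := lker (precomp (pr_diff R n) N).

Definition coboundaries M (R : proj_resolution M) (N : lmodule A) (n : nat) :
    {vspace lhom (pr_mod R n) N} :=
  match n with
  | 0 => 0%VS
  | m.+1 => limg (precomp (pr_diff R m) N)
  end.

(* H^n (Hom_A(R, N)) *)
Definition ext_of M (R : proj_resolution M) (N : lmodule A) (n : nat) :=
  subquot (cocycles R N n) (coboundaries R N n).
HB.instance Definition _ M (R : proj_resolution M) N n := Vector.on (ext_of R N n).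

Definition superfluous M (U : {vspace M}) : Prop :=
  forall W : {vspace M}, submodule W -> (W + U)%VS = fullv -> W = fullv.

(* P1 -> P0 -> M -> 0 exact, with P0 -> M and P1 -> ker (P0 -> M) projective covers. *)
Record min_presentation M := MinPresentation {
  mp_P0 : lmodule A;
  mp_P1 : lmodule A;
  mp_d0 : lhom mp_P0 M;
  mp_d1 : lhom mp_P1 mp_P0;
  mp_proj0 : projective mp_P0;
  mp_proj1 : projective mp_P1;
  mp_surj : limg mp_d0 = fullv;
  mp_exact : limg mp_d1 = lker mp_d0;
  mp_min0 : superfluous (lker mp_d0);
  mp_min1 : superfluous (lker mp_d1)
}.

End LModules.

Arguments lker_submodule {k A M N} f.
Arguments limg_submodule {k A M N} f.

Section Dual.
Variables (k : fieldType) (A : algebraType k) (R : rmodule A).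

Definition dual_fun (a : A) : 'Hom(R, k^o) -> 'Hom(R, k^o) :=
  fun phi => (phi \o ract R a)%VF.
Fact dual_fun_lin a : linear (dual_fun a).
Proof. by move=> c f g; rewrite /dual_fun comp_lfunDl comp_lfunZl. Qed.
HB.instance Definition _ a :=
  GRing.isLinear.Build k _ _ _ (dual_fun a) (dual_fun_lin a).

Let dual_act a : 'End('Hom(R, k^o)) := linfun (dual_fun a).
Let dual_actE a f : dual_act a f = (f \o ract R a)%VF.
Proof. by rewrite /dual_act lfunE. Qed.

Fact dual_act_lin : linear dual_act.
Proof.
move=> c a b; apply/lfunP => f; rewrite add_lfunE scale_lfunE !dual_actE.
by rewrite ract_lin comp_lfunDr comp_lfunZr.
Qed.
Fact dual_act1 : dual_act aone = \1%VF.
Proof. by apply/lfunP => f; rewrite id_lfunE dual_actE ract1 comp_lfun1r. Qed.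
Fact dual_actM a b : dual_act (a *a b) = (dual_act a \o dual_act b)%VF.
Proof.
by apply/lfunP => f; rewrite comp_lfunE !dual_actE ractM comp_lfunA.
Qed.

(* D R = Hom_k(R, k), with (a . phi) x = phi (x . a) *)
Definition dual : lmodule A := LModule dual_act_lin dual_act1 dual_actM.

Lemma dual_lactE a (f : dual) : lact dual a f = ((f : 'Hom(R, k^o)) \o ract R a)%VF.
Proof. exact: dual_actE. Qed.
End Dual.

Section RQuotient.
Variables (k : fieldType) (A : algebraType k) (R : rmodule A) (U : {vspace R}).
Variable sU : forall a, (ract R a @: U <= U)%VS.

Let rq_act a : 'End(vquot U) := quot_map (sU a).

Let rq_ind (f g : 'End(vquot U)) : (forall x, f (vpi U x) = g (vpi U x)) -> f = g.
Proof.
by move=> fg; apply/lfunP => u; rewrite -[u](@qreprK _ _ (vsub U)); apply: fg.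
Qed.

Fact rq_act_lin : linear rq_act.
Proof.
move=> c a b; apply: rq_ind => x.
by rewrite add_lfunE scale_lfunE !quot_mapE ract_lin add_lfunE scale_lfunE linearP.
Qed.
Fact rq_act1 : rq_act aone = \1%VF.
Proof. by apply: rq_ind => x; rewrite quot_mapE ract1 !id_lfunE. Qed.
Fact rq_actM a b : rq_act (a *a b) = (rq_act b \o rq_act a)%VF.
Proof. by apply: rq_ind => x; rewrite comp_lfunE !quot_mapE ractM comp_lfunE. Qed.

Definition rquot : rmodule A := RModule rq_act_lin rq_act1 rq_actM.

Lemma rquot_ractE a x : ract rquot a (vpi U x) = vpi U (ract R a x).
Proof. exact: quot_mapE. Qed.
End RQuotient.

Section Regular.
Variables (k : fieldType) (A : fdAlgebraType k).

Let lreg_act (a : A) : 'End(A) := linfun (amul a).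

Fact lreg_act_lin : linear lreg_act.
Proof.
by move=> c a b; apply/lfunP => x; rewrite add_lfunE scale_lfunE !lfunE /= amul_linl.
Qed.
Fact lreg_act1 : lreg_act aone = \1%VF.
Proof. by apply/lfunP => x; rewrite !lfunE /= amul1x. Qed.
Fact lreg_actM a b : lreg_act (a *a b) = (lreg_act a \o lreg_act b)%VF.
Proof. by apply/lfunP => x; rewrite comp_lfunE !lfunE /= amulA. Qed.

Definition lreg : lmodule A := LModule lreg_act_lin lreg_act1 lreg_actM.

Section Star.
Variable P : lmodule A.

Definition lreg_rmul (a : A) : 'End(lreg) := linfun (amulr a).

Lemma lreg_rmulE a (x : lreg) : lreg_rmul a x = (x : A) *a a.
Proof. by rewrite /lreg_rmul lfunE. Qed.

Lemma lreg_lactE a (x : lreg) : lact lreg a x = a *a (x : A).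
Proof. by rewrite /= lfunE. Qed.

Lemma star_equivariant a (f : lhom P lreg) : equivariant (lreg_rmul a \o f)%VF.
Proof.
by move=> b x; rewrite !comp_lfunE lhomE !(lreg_lactE, lreg_rmulE) amulA.
Qed.

Definition star_fun (a : A) : lhom P lreg -> lhom P lreg :=
  fun f => mk_lhom (lreg_rmul a \o f)%VF.

Lemma star_funE a f x : star_fun a f x = (f x : A) *a a.
Proof.
rewrite /star_fun mk_lhomE; last exact: star_equivariant.
by rewrite comp_lfunE lreg_rmulE.
Qed.

Fact star_fun_lin a : linear (star_fun a).
Proof.
move=> c f g; apply: lhom_inj => x; rewrite lhom_linE !star_funE lhom_linE.
exact: amul_linl.
Qed.
HB.instance Definition _ a :=
  GRing.isLinear.Build k _ _ _ (star_fun a) (star_fun_lin a).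

Let star_act a : 'End(lhom P lreg) := linfun (star_fun a).
Let star_actE a (f : lhom P lreg) x : (star_act a f : lhom P lreg) x = (f x : A) *a a.
Proof. by rewrite [star_act a f]lfunE star_funE. Qed.

Fact star_act_lin : linear star_act.
Proof.
move=> c a b; apply/lfunP => f; apply: lhom_inj => x.
rewrite add_lfunE scale_lfunE lhom_linE !star_actE; exact: amul_linr.
Qed.
Fact star_act1 : star_act aone = \1%VF.
Proof.
apply/lfunP => f; apply: lhom_inj => x.
rewrite id_lfunE star_actE; exact: amulx1.
Qed.
Fact star_actM a b : star_act (a *a b) = (star_act b \o star_act a)%VF.
Proof.
apply/lfunP => f; apply: lhom_inj => x.
rewrite comp_lfunE !star_actE; exact: amulA.
Qed.

(* Hom_A(P, A), with (f . a) x = f x * a *)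
Definition star : rmodule A := RModule star_act_lin star_act1 star_actM.

Lemma star_ractE a (f : star) x :
  (ract star a f : lhom P lreg) x = ((f : lhom P lreg) x : A) *a a.
Proof. exact: star_actE. Qed.
End Star.

Section Tau.
Variables (M : lmodule A) (p : min_presentation M).

Definition star_d1 : 'Hom(star (mp_P0 p), star (mp_P1 p)) := precomp (mp_d1 p) lreg.

Lemma star_d1E (f : star (mp_P0 p)) x :
  (star_d1 f : lhom (mp_P1 p) lreg) x = (f : lhom (mp_P0 p) lreg) (mp_d1 p x).
Proof. exact: precompE. Qed.

Lemma star_d1_stable a : (ract (star (mp_P1 p)) a @: limg star_d1 <= limg star_d1)%VS.
Proof.
apply/subvP => _ /memv_imgP[_ /memv_imgP[f _ ->] ->].
suff -> : ract (star (mp_P1 p)) a (star_d1 f) = star_d1 (ract (star (mp_P0 p)) a f).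
  exact/memv_img/memvf.
by apply: lhom_inj => x; rewrite star_d1E !star_ractE star_d1E.
Qed.

Definition transpose_of : rmodule A := rquot star_d1_stable.
Definition tau_of : lmodule A := dual transpose_of.
End Tau.
End Regular.

Section Existence.
Variables (k : fieldType) (A : fdAlgebraType k).
Implicit Types M N P : lmodule A.

Section FreeModule.
Variable n : nat.
Local Notation F := {ffun 'I_n -> A}.

Definition free_fun (a : A) : F -> F := fun x => [ffun i => a *a x i].
Fact free_fun_lin a : linear (free_fun a).
Proof. by move=> c x y; apply/ffunP => i; rewrite !ffunE amul_linr. Qed.
HB.instance Definition _ a := GRing.isLinear.Build k _ _ _ (free_fun a) (free_fun_lin a).

Let free_act a : 'End(F) := linfun (free_fun a).
Let free_actE a x i : free_act a x i = a *a x i.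
Proof. by rewrite lfunE ffunE. Qed.

Fact free_act_lin : linear free_act.
Proof.
move=> c a b; apply/lfunP => x; apply/ffunP => i.
by rewrite add_lfunE scale_lfunE ![in RHS]ffunE !free_actE amul_linl.
Qed.
Fact free_act1 : free_act aone = \1%VF.
Proof. by apply/lfunP => x; apply/ffunP => i; rewrite free_actE id_lfunE amul1x. Qed.
Fact free_actM a b : free_act (a *a b) = (free_act a \o free_act b)%VF.
Proof.
by apply/lfunP => x; apply/ffunP => i; rewrite comp_lfunE !free_actE amulA.
Qed.

Definition free_module : lmodule A := LModule free_act_lin free_act1 free_actM.

Lemma free_lactE a (x : free_module) i : (lact free_module a x : F) i = a *a (x : F) i.
Proof. exact: free_actE. Qed.

Definition free_lift_fun M (m : 'I_n -> M) : F -> M :=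
  fun x => \sum_i lact M (x i) (m i).
Fact free_lift_lin M (m : 'I_n -> M) : linear (free_lift_fun m).
Proof.
move=> c x y; rewrite /free_lift_fun scaler_sumr -big_split.
by apply: eq_bigr => i _; rewrite !ffunE lactP.
Qed.
HB.instance Definition _ M (m : 'I_n -> M) :=
  GRing.isLinear.Build k _ _ _ (free_lift_fun m) (free_lift_lin m).

Definition free_lift M (m : 'I_n -> M) : lhom free_module M :=
  @mk_lhom _ _ free_module M (linfun (free_lift_fun m)).

Lemma free_liftE M (m : 'I_n -> M) (x : free_module) :
  free_lift m x = \sum_i lact M ((x : F) i) (m i).
Proof.
rewrite /free_lift mk_lhomE ?lfunE // => a y; rewrite lfunE [in RHS]lfunE /=.
rewrite /free_lift_fun linear_sum; apply: eq_bigr => i _.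
by rewrite free_actE lactME.
Qed.

Definition free_gen (i : 'I_n) : F := [ffun j => if i == j then aone else 0].

Lemma free_gen_sum M (h : lhom free_module M) (x : free_module) :
  h x = \sum_i lact M ((x : F) i) (h (free_gen i)).
Proof.
have -> : x = \sum_i lact free_module ((x : F) i) (free_gen i).
  apply/ffunP => j; rewrite sum_ffunE (bigD1 j) //= free_actE ffunE eqxx amulx1.
  rewrite big1 ?addr0 // => i /negPf ij.
  by rewrite free_actE ffunE ij amulx0.
rewrite linear_sum; apply: eq_bigr => i _; rewrite -lhomE.
by congr (h (lact _ _ _)); rewrite sum_ffunE (bigD1 i) //= free_actE ffunE eqxx amulx1
  big1 ?addr0 // => j /negPf ji; rewrite free_actE ffunE ji amulx0.
Qed.

Lemma free_projective : projective free_module.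
Proof.
move=> M N f g gsurj.
have ex i : exists m, g m = f (free_gen i).
  have : f (free_gen i) \in limg g by rewrite gsurj memvf.
  by case/memv_imgP => m _ ->; exists m.
have [m mP] := choice ex; exists (free_lift m) => x.
rewrite free_liftE linear_sum [RHS]free_gen_sum.
by apply: eq_bigr => i _; rewrite /= lhomE mP.
Qed.
End FreeModule.

Definition free_cover_mod M : lmodule A := free_module (\dim {:M}).
Definition free_cover M : lhom (free_cover_mod M) M :=
  free_lift (fun i : 'I_(\dim {:M}) => (vbasis {:M})`_i).

Lemma free_cover_surj M : limg (free_cover M) = fullv.
Proof.
apply/eqP; rewrite eqEsubv subvf; apply/subvP => v _.
apply/memv_imgP.
exists ([ffun i => coord (vbasis {:M}) i v *: aone] : free_cover_mod M); first exact: memvf.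
rewrite free_liftE {1}(coord_vbasis (memvf v)); apply: eq_bigr => i _.
by rewrite ffunE lactZ lact1E.
Qed.

Definition lker_mod M N (f : lhom M N) : lmodule A := lsub (lker_submodule f).
Definition lker_incl M N (f : lhom M N) : lhom (lker_mod f) M := lincl (lker_submodule f).

Lemma limg_lincl M (U : {vspace M}) (sU : submodule U) : limg (lincl sU) = U.
Proof.
apply/vspaceP => v; apply/memv_imgP/idP => [[u _ ->]|Uv].
  by rewrite linclE subvsP.
by exists (Subvs Uv); rewrite ?memvf // linclE.
Qed.

Lemma limg_comp_surj M N P (f : lhom N P) (g : lhom M N) :
  limg g = fullv -> limg (lhom_comp f g) = limg f.
Proof.
move=> gs; apply/vspaceP => v; apply/memv_imgP/memv_imgP => -[x _ ->].
  by exists (g x); rewrite ?memvf ?lhom_compE.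
have : x \in limg g by rewrite gs memvf.
by case/memv_imgP => y _ ->; exists y; rewrite ?memvf ?lhom_compE.
Qed.

Lemma lker_comp_incl M N (U : {vspace N}) (sU : submodule U) (g : lhom M (lsub sU)) :
  lker (lhom_comp (lincl sU) g) = lker g.
Proof.
apply/vspaceP => x; rewrite !memv_ker lhom_compE linclE.
by apply/eqP/eqP => [gx|->]; [apply: subvs_inj | ].
Qed.

Fixpoint syzygy M (n : nat) : lmodule A :=
  match n with
  | 0 => M
  | m.+1 => lker_mod (free_cover (syzygy M m))
  end.

Definition free_res_diff M n :
    lhom (free_cover_mod (syzygy M n.+1)) (free_cover_mod (syzygy M n)) :=
  lhom_comp (lker_incl (free_cover (syzygy M n))) (free_cover (syzygy M n.+1)).

Lemma free_res_exact M n : limg (free_res_diff M n) = lker (free_cover (syzygy M n)).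
Proof. by rewrite limg_comp_surj ?limg_lincl ?free_cover_surj. Qed.

Lemma free_res_exactS M n : limg (free_res_diff M n.+1) = lker (free_res_diff M n).
Proof. by rewrite free_res_exact lker_comp_incl. Qed.

(* The free resolution obtained by iterating P = A^(dim M) ->> M. *)
Definition free_resolution M : proj_resolution M :=
  @ProjResolution _ _ M (fun n => free_cover_mod (syzygy M n)) (free_res_diff M)
    (free_cover M) (fun n => @free_projective _) (free_cover_surj M)
    (free_res_exact M 0)
    (free_res_exactS M).

Lemma proj_cover_exists M : exists P (f : lhom P M),
  [/\ projective P, limg f = fullv & superfluous (lker f)].
Proof.
pose dims n := `[< exists P (f : lhom P M),
  [/\ projective P, limg f = fullv & \dim {:P} = n] >].
have ex : exists n, dims n.
  exists (\dim {: free_cover_mod M}); apply/asboolP.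
  exists (free_cover_mod M), (free_cover M).
  by split; [exact: free_projective | exact: free_cover_surj |].
case: (ex_minnP ex) => n /asboolP[P [f [projP fs dimP]]] nmin.
exists P, f; split=> // W sW WK.
pose i := lincl sW; pose fW := lhom_comp f i.
have iE (u : lsub sW) : i u = vsval (u : subvs_of W) by exact: linclE.
have fWE u : fW u = f (i u) by exact: lhom_compE.
have fWs : limg fW = fullv.
  apply/eqP; rewrite eqEsubv subvf; apply/subvP => y _.
  have /memv_imgP[x _ ->] : y \in limg f by rewrite fs memvf.
  have /memv_addP[w Ww [z Kz ->]] : x \in (W + lker f)%VS by rewrite WK memvf.
  move: Kz; rewrite memv_ker => /eqP Kz; rewrite linearD /= Kz addr0.
  apply/memv_imgP; exists (Subvs Ww); first exact: memvf.
  by rewrite fWE iE.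
have [h hP] := projP _ _ f fW fWs.
pose good (g : lhom P P) := (forall x, f (g x) = f x) /\ (limg g <= W)%VS.
have good1 : good (lhom_comp i h).
  split=> [x|]; first by rewrite -[RHS]hP fWE lhom_compE.
  by apply/subvP => _ /memv_imgP[x _ ->]; rewrite lhom_compE iE subvsP.
pose rks r := `[< exists g, good g /\ \dim (limg g) = r >].
have exr : exists r, rks r by eexists; apply/asboolP; exists (lhom_comp i h).
case: (ex_minnP exr) => r /asboolP[g [[fg gW] rg]] rmin.
have sg2 : (limg (lhom_comp g g) <= limg g)%VS.
  by apply/subvP => _ /memv_imgP[x _ ->]; rewrite lhom_compE memv_img ?memvf.
have g2 : limg (lhom_comp g g) = limg g.
  apply/eqP; rewrite eqEdim sg2 rg rmin //; apply/asboolP; exists (lhom_comp g g).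
  by split=> //; split=> [x|]; [rewrite lhom_compE !fg | exact: subv_trans gW].
pose sG := limg_submodule g; pose j := lincl sG; pose G := lsub sG.
have jE (u : G) : j u = vsval (u : subvs_of (limg g)) by exact: linclE.
(* g corestricted to its image, and its restriction theta : G -> G *)
have [p pP] : exists p : lhom P G, forall x, vsval (p x : subvs_of (limg g)) = g x.
  have E x : vsval (vsproj (limg g) (g x)) = g x by rewrite vsprojK ?memv_img ?memvf.
  pose q : 'Hom(P, G) := linfun (vsproj (limg g) \o g).
  have qE x : vsval (q x : subvs_of (limg g)) = g x by rewrite lfunE /= E.
  exists (mk_lhom q) => x; rewrite mk_lhomE // => a y; apply: subvs_inj.
  by rewrite qE lhomE sub_mapE ?qE // -lhomE memv_img ?memvf.
pose th := lhom_comp p j.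
have thE u : th u = p (j u) by exact: lhom_compE.
have th_surj : limg th = fullv.
  apply/eqP; rewrite eqEsubv subvf; apply/subvP => y _; apply/memv_imgP.
  have : vsval (y : subvs_of (limg g)) \in limg (lhom_comp g g) by rewrite g2 subvsP.
  case/memv_imgP => x _ yx; exists (p x); first exact: memvf.
  by apply: subvs_inj; rewrite thE pP jE pP yx lhom_compE.
have th_inj : lker th == 0%VS.
  rewrite -dimv_eq0 -(eqn_add2r (\dim (limg th))) add0n.
  by rewrite -[lker th]capfv limg_ker_dim th_surj.
have thK := lker0_lfunK th_inj; have thVK := lker0_lfunVK th_inj.
have ti_eq : equivariant (th^-1)%VF.
  by move=> a x; move/lker0P: th_inj; apply; rewrite lhomE !thVK.
pose ti := mk_lhom (th^-1)%VF.
have tiE x : ti x = (th^-1)%VF x by rewrite mk_lhomE.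
have projG : projective G.
  move=> X Y u v vs; have [w wP] := projP _ _ (lhom_comp u (lhom_comp ti p)) v vs.
  exists (lhom_comp w j) => x; rewrite lhom_compE wP !lhom_compE tiE.
  by rewrite -thE thK.
have fGs : limg (lhom_comp f j) = fullv.
  apply/eqP; rewrite eqEsubv subvf; apply/subvP => y _.
  have /memv_imgP[x _ ->] : y \in limg f by rewrite fs memvf.
  apply/memv_imgP; exists (p x); first exact: memvf.
  by rewrite lhom_compE jE pP fg.
have : (n <= \dim {:G})%N.
  apply: nmin; apply/asboolP; exists G, (lhom_comp f j); by split.
have -> : \dim {:G} = \dim (limg g) by rewrite dimvf.
rewrite -dimP => le; apply/eqP; rewrite eqEsubv subvf.
apply: subv_trans gW; rewrite -[X in (X <= _)%VS](_ : limg g = _) //.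
by apply/eqP; rewrite eqEdim subvf.
Qed.

Lemma min_presentation_exists M : exists _ : min_presentation M, True.
Proof.
have [P0 [f0 [proj0 s0 min0]]] := proj_cover_exists M.
have [P1 [f1 [proj1 s1 min1]]] := proj_cover_exists (lker_mod f0).
have ex : limg (lhom_comp (lker_incl f0) f1) = lker f0.
  by rewrite limg_comp_surj ?limg_lincl.
have min1' : superfluous (lker (lhom_comp (lker_incl f0) f1)).
  by rewrite lker_comp_incl.
by exists (MinPresentation proj0 proj1 s0 ex min0 min1').
Qed.

Definition min_presentation_of M : min_presentation M :=
  projT1 (cid (min_presentation_exists M)).

Definition tau M : lmodule A := tau_of (min_presentation_of M).

Definition Ext (n : nat) M N := ext_of (free_resolution M) N n.
HB.instance Definition _ n M N := Vector.on (Ext n M N).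

End Existence.

Section Enveloping.
Variables (k : fieldType) (A : fdAlgebraType k).
Local Notation n := (\dim {:A}).
Local Notation bas i := ((vbasis {:A})`_i).
Local Notation coo i := (coord (vbasis {:A}) i).

(* A^e = A (x)_k A^op: the matrix x stands for the tensor
   \sum_(i, j) x i j *: (b_i (x) b_j), where b is a basis of A. *)
Definition env : Type := 'M[k]_n.
HB.instance Definition _ := Vector.on env.

Definition pure (a b : A) : env := \matrix_(i, j) (coo i a * coo j b).

Definition pure_l (b a : A) : env := pure a b.
Fact pure_l_lin b : linear (pure_l b).
Proof.
by move=> c x y; apply/matrixP => i j; rewrite !mxE linearP /= mulrDl mulrA.
Qed.
HB.instance Definition _ b := GRing.isLinear.Build k A env *:%R (pure_l b) (pure_l_lin b).
Fact pure_lin a : linear (pure a).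
Proof.
by move=> c x y; apply/matrixP => i j; rewrite !mxE linearP /= mulrDr mulrCA.
Qed.
HB.instance Definition _ a := GRing.isLinear.Build k A env *:%R (pure a) (pure_lin a).

Lemma coo_sum a : a = \sum_i coo i a *: bas i.
Proof. by rewrite -coord_vbasis ?memvf. Qed.

Lemma coo_bas (i j : 'I_n) : coo i (bas j) = (i == j)%:R.
Proof. by rewrite eq_sym coord_free ?(basis_free (vbasisP _)). Qed.

Lemma env_sum (x : env) : x = \sum_i \sum_j (x : 'M_n) i j *: pure (bas i) (bas j).
Proof.
apply/matrixP => i j; rewrite summxE (bigD1 i) //= summxE (bigD1 j) //= !mxE.
rewrite !coo_bas !eqxx !mulr1 !big1 ?addr0 // => [i' /negPf ii'|j' /negPf jj'].
- rewrite summxE big1 // => j' _; rewrite !mxE !coo_bas eq_sym ii'.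
  by rewrite mul0r mulr0.
- by rewrite !mxE !coo_bas [j == j']eq_sym jj' !mulr0.
Qed.

(* (a (x) b) (c (x) d) = ac (x) db *)
Definition env_mul (x y : env) : env :=
  \sum_i \sum_j \sum_r \sum_s ((x : 'M_n) i j * (y : 'M_n) r s) *:
    pure (bas i *a bas r) (bas s *a bas j).
Definition env_one : env := pure aone aone.

Fact env_mul_linl c (x y z : env) :
  env_mul (c *: x + y) z = c *: env_mul x z + env_mul y z.
Proof.
rewrite /env_mul scaler_sumr -big_split; apply: eq_bigr => i _ /=.
rewrite scaler_sumr -big_split; apply: eq_bigr => j _ /=.
rewrite scaler_sumr -big_split; apply: eq_bigr => r _ /=.
rewrite scaler_sumr -big_split; apply: eq_bigr => s _ /=.
by rewrite !mxE scalerA -scalerDl mulrDl mulrA.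
Qed.

Fact env_mul_linr c (x y z : env) :
  env_mul x (c *: y + z) = c *: env_mul x y + env_mul x z.
Proof.
rewrite /env_mul scaler_sumr -big_split; apply: eq_bigr => i _ /=.
rewrite scaler_sumr -big_split; apply: eq_bigr => j _ /=.
rewrite scaler_sumr -big_split; apply: eq_bigr => r _ /=.
rewrite scaler_sumr -big_split; apply: eq_bigr => s _ /=.
by rewrite !mxE scalerA -scalerDl mulrDr mulrCA.
Qed.

Lemma pure_suml (F : 'I_n -> A) b : pure (\sum_i F i) b = \sum_i pure (F i) b.
Proof. exact: (linear_sum (pure_l b)). Qed.
Lemma pure_sumr a (F : 'I_n -> A) : pure a (\sum_i F i) = \sum_i pure a (F i).
Proof. exact: (linear_sum (pure a)). Qed.
Lemma pureZl c a b : pure (c *: a) b = c *: pure a b.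
Proof. exact: (linearZ_LR (pure_l b)). Qed.
Lemma pureZr c a b : pure a (c *: b) = c *: pure a b.
Proof. exact: (linearZ_LR (pure a)). Qed.

Lemma env_mul_pure a b c d : env_mul (pure a b) (pure c d) = pure (a *a c) (d *a b).
Proof.
rewrite [in RHS](coo_sum a) amul_suml pure_suml; apply: eq_bigr => i _.
rewrite [in RHS](coo_sum b) amul_sumr pure_sumr; apply: eq_bigr => j _.
rewrite [in RHS](coo_sum c) amul_sumr pure_suml; apply: eq_bigr => r _.
rewrite [in RHS](coo_sum d) amul_suml pure_sumr; apply: eq_bigr => s _.
rewrite !mxE !(amulZx, amulxZ, pureZl, pureZr) !scalerA.
by congr (_ *: _); rewrite mulrA [RHS]mulrAC [X in _ = X * _]mulrAC.
Qed.

Lemma env_ind (P : env -> Prop) :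
  (forall c x y, P x -> P y -> P (c *: x + y)) -> P 0 ->
  (forall a b, P (pure a b)) -> forall x, P x.
Proof.
move=> Plin P0 Pp x; rewrite [x]env_sum.
have PD u v : P u -> P v -> P (u + v) by move=> Pu Pv; rewrite -[u]scale1r; apply: Plin.
do 2![apply: big_ind => // ? _].
by rewrite -[_ *: _]addr0; apply: Plin.
Qed.

Fact env_mulA : associative env_mul.
Proof.
have l0 z : env_mul 0 z = 0.
  by have := env_mul_linl (-1) 0 0 z; rewrite scaler0 addr0 scaleN1r addNr.
have r0 z : env_mul z 0 = 0.
  by have := env_mul_linr (-1) z 0 0; rewrite scaler0 addr0 scaleN1r addNr.
move=> x y z; elim/env_ind: x => [c u v Hu Hv||a b].
- by rewrite !env_mul_linl Hu Hv.
- by rewrite !l0.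
elim/env_ind: y => [c u v Hu Hv||a' b'].
- by rewrite !(env_mul_linl, env_mul_linr) Hu Hv.
- by rewrite !(l0, r0).
elim/env_ind: z => [c u v Hu Hv||a'' b''].
- by rewrite !env_mul_linr Hu Hv.
- by rewrite !r0.
by rewrite !env_mul_pure !amulA.
Qed.

Fact env_mul1x : left_id env_one env_mul.
Proof.
move=> x; elim/env_ind: x => [c u v Hu Hv||a b].
- by rewrite env_mul_linr Hu Hv.
- by have := env_mul_linr (-1) env_one 0 0; rewrite scaler0 addr0 scaleN1r addNr.
by rewrite env_mul_pure amul1x amulx1.
Qed.

Fact env_mulx1 : right_id env_one env_mul.
Proof.
move=> x; elim/env_ind: x => [c u v Hu Hv||a b].
- by rewrite env_mul_linl Hu Hv.
- by have := env_mul_linl (-1) 0 0 env_one; rewrite scaler0 addr0 scaleN1r addNr.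
by rewrite env_mul_pure amul1x amulx1.
Qed.

HB.instance Definition _ := isAlgebra.Build k env
  env_mulA env_mul1x env_mulx1 env_mul_linl env_mul_linr.

Lemma pureM a b c d : pure a b *a pure c d = pure (a *a c) (d *a b).
Proof. exact: env_mul_pure. Qed.

End Enveloping.

(* Finite dimensional bimodules on which k acts centrally. *)
Record bimodule (k : fieldType) (A : algebraType k) := Bimodule {
  bcar :> vectType k;
  blact : A -> 'End(bcar);
  bract : A -> 'End(bcar);
  blact_lin : linear blact;
  blact1 : blact aone = \1%VF;
  blactM : forall a b, blact (a *a b) = (blact a \o blact b)%VF;
  bract_lin : linear bract;
  bract1 : bract aone = \1%VF;
  bractM : forall a b, bract (a *a b) = (bract b \o bract a)%VF;
  blrC : forall a b, (blact a \o bract b)%VF = (bract b \o blact a)%VF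
}.

Section BimoduleHom.
Variables (k : fieldType) (A : algebraType k) (M N : bimodule A).

Definition biequivariant (f : 'Hom(M, N)) : Prop :=
  (forall a x, f (blact M a x) = blact N a (f x)) /\
  (forall a x, f (bract M a x) = bract N a (f x)).

Fact biequivariant0 : biequivariant 0.
Proof. by split=> a x; rewrite !zero_lfunE linear0. Qed.
Fact biequivariantD f g : biequivariant f -> biequivariant g -> biequivariant (f + g).
Proof.
by move=> [fl fr] [gl gr]; split=> a x; rewrite !add_lfunE ?fl ?gl ?fr ?gr linearD.
Qed.
Fact biequivariantZ c f : biequivariant f -> biequivariant (c *: f).
Proof. by move=> [fl fr]; split=> a x; rewrite !scale_lfunE ?fl ?fr linearZ. Qed.

Definition biequivariant_sub : subspace 'Hom(M, N) :=
  Subspace biequivariant0 biequivariantD biequivariantZ.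

(* Hom_{A-A}(M, N) *)
Definition homB : {vspace 'Hom(M, N)} := vspan biequivariant_sub.

Lemma homBP f : f \in homB <-> biequivariant f.
Proof. exact: (mem_vspan_sub biequivariant_sub). Qed.
End BimoduleHom.

Section EnvModule.
Variables (k : fieldType) (A : fdAlgebraType k) (M : bimodule A).
Local Notation n := (\dim {:A}).
Local Notation bas i := ((vbasis {:A})`_i).

Let env_act (x : env A) : 'End(M) :=
  \sum_i \sum_j (x : 'M_n) i j *: (blact M (bas i) \o bract M (bas j))%VF.

Fact env_act_lin : linear env_act.
Proof.
move=> c x y; rewrite /env_act scaler_sumr -big_split; apply: eq_bigr => i _ /=.
rewrite scaler_sumr -big_split; apply: eq_bigr => j _ /=.
by rewrite !mxE scalerDl scalerA.
Qed.

HB.instance Definition _ := GRing.isLinear.Build k A 'End(M) *:%R (@blact _ _ M)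
  (@blact_lin _ _ M).
HB.instance Definition _ := GRing.isLinear.Build k A 'End(M) *:%R (@bract _ _ M)
  (@bract_lin _ _ M).

Let env_act_pure a b : env_act (pure a b) = (blact M a \o bract M b)%VF.
Proof.
have Hl : blact M a = \sum_i coord (vbasis {:A}) i a *: blact M (bas i).
  by rewrite {1}(coo_sum a) linear_sum; apply: eq_bigr => i _; rewrite linearZ.
have Hr : bract M b = \sum_i coord (vbasis {:A}) i b *: bract M (bas i).
  by rewrite {1}(coo_sum b) linear_sum; apply: eq_bigr => i _; rewrite linearZ.
rewrite Hl Hr; apply/lfunP => x; rewrite comp_lfunE !sum_lfunE.
apply: eq_bigr => i _; rewrite scale_lfunE linear_sum scaler_sumr sum_lfunE.
apply: eq_bigr => j _ /=.
by rewrite !scale_lfunE comp_lfunE linearZ scalerA mxE.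
Qed.

Fact env_act1 : env_act aone = \1%VF.
Proof. by rewrite env_act_pure blact1 bract1 comp_lfun1l. Qed.

Fact env_actM x y : env_act (x *a y) = (env_act x \o env_act y)%VF.
Proof.
have env_act0 : env_act 0 = 0.
  by have := env_act_lin (-1) 0 0; rewrite scaler0 addr0 scaleN1r addNr.
elim/env_ind: x => [c u v Hu Hv||a b].
- by rewrite amul_linl !env_act_lin Hu Hv comp_lfunDl comp_lfunZl.
- by rewrite amul0x env_act0 comp_lfun0l.
elim/env_ind: y => [c u v Hu Hv||a' b'].
- by rewrite amul_linr !env_act_lin Hu Hv comp_lfunDr comp_lfunZr.
- by rewrite amulx0 env_act0 comp_lfun0r.
rewrite pureM !env_act_pure blactM bractM -!comp_lfunA; congr (_ \o _)%VF.
by rewrite !comp_lfunA blrC.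
Qed.

(* The left A^e-module of a bimodule: (a (x) b) . m = a m b. *)
Definition env_module : lmodule (env A) := LModule env_act_lin env_act1 env_actM.

Lemma env_module_pure a b x :
  lact env_module (pure a b) x = blact M a (bract M b x).
Proof. by rewrite /= env_act_pure comp_lfunE. Qed.

End EnvModule.

Section RegularBimodule.
Variables (k : fieldType) (A : fdAlgebraType k).

Let rb_l (a : A) : 'End(A) := linfun (amul a).
Let rb_r (a : A) : 'End(A) := linfun (amulr a).

Fact rb_l_lin : linear rb_l.
Proof. by move=> c a b; apply/lfunP => x; rewrite add_lfunE scale_lfunE !lfunE /= amul_linl. Qed.
Fact rb_l1 : rb_l aone = \1%VF.
Proof. by apply/lfunP => x; rewrite !lfunE /= amul1x. Qed.
Fact rb_lM a b : rb_l (a *a b) = (rb_l a \o rb_l b)%VF.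
Proof. by apply/lfunP => x; rewrite comp_lfunE !lfunE /= amulA. Qed.
Fact rb_r_lin : linear rb_r.
Proof. by move=> c a b; apply/lfunP => x; rewrite add_lfunE scale_lfunE !lfunE /= /amulr amul_linr. Qed.
Fact rb_r1 : rb_r aone = \1%VF.
Proof. by apply/lfunP => x; rewrite !lfunE /= /amulr amulx1. Qed.
Fact rb_rM a b : rb_r (a *a b) = (rb_r b \o rb_r a)%VF.
Proof. by apply/lfunP => x; rewrite comp_lfunE !lfunE /= /amulr amulA. Qed.
Fact rb_C a b : (rb_l a \o rb_r b)%VF = (rb_r b \o rb_l a)%VF.
Proof. by apply/lfunP => x; rewrite !comp_lfunE !lfunE /= /amulr amulA. Qed.

Definition reg_bimodule : bimodule A :=
  Bimodule rb_l_lin rb_l1 rb_lM rb_r_lin rb_r1 rb_rM rb_C.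

Lemma reg_blactE a (x : reg_bimodule) : blact reg_bimodule a x = a *a (x : A).
Proof. by rewrite /= lfunE. Qed.
Lemma reg_bractE a (x : reg_bimodule) : bract reg_bimodule a x = (x : A) *a a.
Proof. by rewrite /= lfunE. Qed.
End RegularBimodule.

Section RestrictScalars.
Variables (k : fieldType) (A B : algebraType k) (phi : {linear A -> B}).
Variables (phi1 : phi aone = aone) (phiM : {morph phi : a b / a *a b}).
Variable M : bimodule B.

Fact rs_l_lin : linear (fun a => blact M (phi a)).
Proof. by move=> c a b; rewrite linearP blact_lin. Qed.
Fact rs_l1 : blact M (phi aone) = \1%VF. Proof. by rewrite phi1 blact1. Qed.
Fact rs_lM a b : blact M (phi (a *a b)) = (blact M (phi a) \o blact M (phi b))%VF.
Proof. by rewrite phiM blactM. Qed.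
Fact rs_r_lin : linear (fun a => bract M (phi a)).
Proof. by move=> c a b; rewrite linearP bract_lin. Qed.
Fact rs_r1 : bract M (phi aone) = \1%VF. Proof. by rewrite phi1 bract1. Qed.
Fact rs_rM a b : bract M (phi (a *a b)) = (bract M (phi b) \o bract M (phi a))%VF.
Proof. by rewrite phiM bractM. Qed.
Fact rs_C a b : (blact M (phi a) \o bract M (phi b))%VF =
  (bract M (phi b) \o blact M (phi a))%VF.
Proof. exact: blrC. Qed.

Definition restrict_bimodule : bimodule A :=
  Bimodule rs_l_lin rs_l1 rs_lM rs_r_lin rs_r1 rs_rM rs_C.
End RestrictScalars.

Section SubBimodule.
Variables (k : fieldType) (A : algebraType k) (M : bimodule A) (U : {vspace M}).
Variable sl : forall a x, x \in U -> blact M a x \in U.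
Variable sr : forall a x, x \in U -> bract M a x \in U.

Let sb_l a : 'End(subvs_of U) := sub_map U U (blact M a).
Let sb_r a : 'End(subvs_of U) := sub_map U U (bract M a).
Let sb_lE a u : vsval (sb_l a u) = blact M a (vsval u).
Proof. by rewrite sub_mapE ?sl ?subvsP. Qed.
Let sb_rE a u : vsval (sb_r a u) = bract M a (vsval u).
Proof. by rewrite sub_mapE ?sr ?subvsP. Qed.

Fact sb_l_lin : linear sb_l.
Proof.
move=> c a b; apply/lfunP => u; apply: subvs_inj.
by rewrite add_lfunE scale_lfunE linearP /= !sb_lE blact_lin add_lfunE scale_lfunE.
Qed.
Fact sb_l1 : sb_l aone = \1%VF.
Proof. by apply/lfunP => u; apply: subvs_inj; rewrite sb_lE blact1 !id_lfunE. Qed.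
Fact sb_lM a b : sb_l (a *a b) = (sb_l a \o sb_l b)%VF.
Proof.
by apply/lfunP => u; apply: subvs_inj; rewrite comp_lfunE !sb_lE blactM comp_lfunE.
Qed.
Fact sb_r_lin : linear sb_r.
Proof.
move=> c a b; apply/lfunP => u; apply: subvs_inj.
by rewrite add_lfunE scale_lfunE linearP /= !sb_rE bract_lin add_lfunE scale_lfunE.
Qed.
Fact sb_r1 : sb_r aone = \1%VF.
Proof. by apply/lfunP => u; apply: subvs_inj; rewrite sb_rE bract1 !id_lfunE. Qed.
Fact sb_rM a b : sb_r (a *a b) = (sb_r b \o sb_r a)%VF.
Proof.
by apply/lfunP => u; apply: subvs_inj; rewrite comp_lfunE !sb_rE bractM comp_lfunE.
Qed.
Fact sb_C a b : (sb_l a \o sb_r b)%VF = (sb_r b \o sb_l a)%VF.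
Proof.
apply/lfunP => u; apply: subvs_inj.
by rewrite !comp_lfunE !(sb_lE, sb_rE) -!comp_lfunE blrC.
Qed.

Definition sub_bimodule : bimodule A :=
  Bimodule sb_l_lin sb_l1 sb_lM sb_r_lin sb_r1 sb_rM sb_C.
End SubBimodule.

Section Hochschild.
Variables (k : fieldType) (L : fdAlgebraType k).

Definition reg_env : lmodule (env L) := env_module (reg_bimodule L).

(* HH^n(L) = Ext^n_{L-L}(L, L) *)
Definition HH (n : nat) := Ext n reg_env reg_env.
HB.instance Definition _ n := Vector.on (HH n).

(* HH^1_tau(L) = D Hom_{L-L}(L, tau L) *)
Definition HHtau1 : Type := 'Hom(lhom reg_env (tau reg_env), k^o).
HB.instance Definition _ := Vector.on HHtau1.

Definition excess : int := (\dim {:HHtau1})%:Z - (\dim {:HH 1})%:Z.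

End Hochschild.

Record ideal (k : fieldType) (A : algebraType k) := Ideal {
  ideal_sub :> subspace A;
  idealMl : forall a x, ideal_sub x -> ideal_sub (a *a x);
  idealMr : forall a x, ideal_sub x -> ideal_sub (x *a a)
}.

Section QuotientAlgebra.
Variables (k : fieldType) (A : algebraType k) (J : ideal A).
Variable fcJ : finite_codim J.
Local Notation Q := (fquot fcJ).
Local Notation pi := (fpi fcJ).

Definition quot_mul (u v : Q) : Q := pi (qrepr u *a qrepr v).
Definition quot_one : Q := pi aone.

Lemma quot_mul_pi x y : quot_mul (pi x) (pi y) = pi (x *a y).
Proof.
apply/(qpi_eqP J).
set x' := qrepr _; set y' := qrepr _.
have -> : x' *a y' - x *a y = (x' - x) *a y' + x *a (y' - y).
  by rewrite amulBx amulxB addrA subrK.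
by apply: smemD; [apply: idealMr | apply: idealMl]; apply: (qreprB J).
Qed.

Lemma fpiP (u : Q) : exists x, u = pi x.
Proof. by exists (qrepr u); rewrite /pi qreprK. Qed.

Fact quot_mulA : associative quot_mul.
Proof.
move=> u v w; have [[[x ->] [y ->]] [z ->]] := (fpiP u, fpiP v, fpiP w).
by rewrite !quot_mul_pi amulA.
Qed.
Fact quot_mul1x : left_id quot_one quot_mul.
Proof. by move=> u; have [x ->] := fpiP u; rewrite quot_mul_pi amul1x. Qed.
Fact quot_mulx1 : right_id quot_one quot_mul.
Proof. by move=> u; have [x ->] := fpiP u; rewrite quot_mul_pi amulx1. Qed.
Fact quot_mul_linl c u v w :
  quot_mul (c *: u + v) w = c *: quot_mul u w + quot_mul v w.
Proof.
have [[[x ->] [y ->]] [z ->]] := (fpiP u, fpiP v, fpiP w).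
by rewrite -linearP !quot_mul_pi amul_linl linearP.
Qed.
Fact quot_mul_linr c u v w :
  quot_mul u (c *: v + w) = c *: quot_mul u v + quot_mul u w.
Proof.
have [[[x ->] [y ->]] [z ->]] := (fpiP u, fpiP v, fpiP w).
by rewrite -linearP !quot_mul_pi amul_linr linearP.
Qed.

Definition aquot : Type := Q.
Local Notation AQ := aquot.
HB.instance Definition _ := Vector.on AQ.
HB.instance Definition _ := isAlgebra.Build k AQ
  quot_mulA quot_mul1x quot_mulx1 quot_mul_linl quot_mul_linr.

Definition api : A -> AQ := pi.
HB.instance Definition _ := GRing.Linear.on api.

Lemma api1 : api aone = aone. Proof. by []. Qed.
Lemma apiM : {morph api : a b / a *a b}.
Proof. by move=> a b; exact: (esym (quot_mul_pi a b)). Qed.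
Lemma apiP (u : AQ) : exists x, u = api x. Proof. exact: fpiP. Qed.
Lemma api_eq0 x : api x = 0 <-> J x. Proof. exact: (qpi_eq0 J). Qed.

Definition aquot_bimodule : bimodule A := restrict_bimodule api1 apiM (reg_bimodule AQ).

Lemma aquot_blactE a (x : aquot_bimodule) :
  blact aquot_bimodule a x = api a *a (x : AQ).
Proof. exact: (reg_blactE (api a) (x : reg_bimodule AQ)). Qed.
Lemma aquot_bractE a (x : aquot_bimodule) :
  bract aquot_bimodule a x = (x : AQ) *a api a.
Proof. exact: (reg_bractE (api a) (x : reg_bimodule AQ)). Qed.

Variable K : ideal A.

(* { x + J | x in K }, i.e. (K + J) / J, which is K / J when J is contained in K *)
Definition api_image : AQ -> Prop := fun u => exists2 x, K x & u = api x.

Fact api_image0 : api_image 0.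
Proof. by exists 0; rewrite ?raddf0 //; apply: smem0. Qed.
Fact api_imageD u v : api_image u -> api_image v -> api_image (u + v).
Proof.
by move=> [x Kx ->] [y Ky ->]; exists (x + y); rewrite ?raddfD //; apply: smemD.
Qed.
Fact api_imageZ c u : api_image u -> api_image (c *: u).
Proof. by move=> [x Kx ->]; exists (c *: x); rewrite ?linearZ //; apply: smemZ. Qed.
Definition api_image_sub : subspace AQ := Subspace api_image0 api_imageD api_imageZ.

Lemma mem_api_image u : u \in vspan api_image_sub <-> exists2 x, K x & u = api x.
Proof. exact: mem_vspan_sub. Qed.

Fact api_image_l a (x : aquot_bimodule) : x \in vspan api_image_sub ->
  blact aquot_bimodule a x \in vspan api_image_sub.
Proof.
move=> /mem_api_image[y Ky ->]; apply/mem_api_image.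
by exists (a *a y); [apply: idealMl | rewrite aquot_blactE apiM].
Qed.
Fact api_image_r a (x : aquot_bimodule) : x \in vspan api_image_sub ->
  bract aquot_bimodule a x \in vspan api_image_sub.
Proof.
move=> /mem_api_image[y Ky ->]; apply/mem_api_image.
by exists (y *a a); [apply: idealMr | rewrite aquot_bractE apiM].
Qed.

Definition ideal_quot_bimodule : bimodule A := sub_bimodule api_image_l api_image_r.

End QuotientAlgebra.

Section GeneratedIdeals.
Variables (k : fieldType) (A : algebraType k).

Section Generated.
Variable S : A -> Prop.
Definition gen_ideal_mem (x : A) : Prop :=
  forall J : ideal A, (forall y, S y -> J y) -> J x.

Fact gen_ideal0 : gen_ideal_mem 0.
Proof. by move=> J _; apply: smem0. Qed.
Fact gen_idealD x y : gen_ideal_mem x -> gen_ideal_mem y -> gen_ideal_mem (x + y).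
Proof. by move=> gx gy J SJ; apply: smemD; [apply: gx | apply: gy]. Qed.
Fact gen_idealZ c x : gen_ideal_mem x -> gen_ideal_mem (c *: x).
Proof. by move=> gx J SJ; apply/smemZ/gx. Qed.
Fact gen_idealMl a x : gen_ideal_mem x -> gen_ideal_mem (a *a x).
Proof. by move=> gx J SJ; apply/idealMl/gx. Qed.
Fact gen_idealMr a x : gen_ideal_mem x -> gen_ideal_mem (x *a a).
Proof. by move=> gx J SJ; apply/idealMr/gx. Qed.

Definition gen_ideal : ideal A :=
  @Ideal _ _ (Subspace gen_ideal0 gen_idealD gen_idealZ) gen_idealMl gen_idealMr.

Lemma mem_gen_ideal x : S x -> gen_ideal x.
Proof. by move=> Sx J; apply. Qed.
Lemma gen_ideal_min (J : ideal A) : (forall y, S y -> J y) -> forall x, gen_ideal x -> J x.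
Proof. by move=> SJ x; apply. Qed.
End Generated.

Definition ideal_mul (I J : ideal A) : ideal A :=
  gen_ideal (fun z => exists x y, [/\ I x, J y & z = x *a y]).

Fixpoint ideal_pow (I : ideal A) (n : nat) : ideal A :=
  match n with
  | 0 => gen_ideal (fun=> True)
  | m.+1 => ideal_mul I (ideal_pow I m)
  end.

Lemma mem_ideal_mul (I J : ideal A) x y : I x -> J y -> ideal_mul I J (x *a y).
Proof. by move=> Ix Jy; apply: mem_gen_ideal; exists x, y. Qed.

Lemma ideal_mulS (I I' J J' : ideal A) : (forall x, I x -> I' x) ->
  (forall x, J x -> J' x) -> forall x, ideal_mul I J x -> ideal_mul I' J' x.
Proof.
move=> II JJ; apply: gen_ideal_min => _ [x [y [Ix Jy ->]]].
by apply: mem_ideal_mul; [apply: II | apply: JJ].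
Qed.

Lemma ideal_mul_subr (I J : ideal A) x : ideal_mul I J x -> J x.
Proof. by move: x; apply: gen_ideal_min => _ [x [y [_ Jy ->]]]; apply: idealMl. Qed.

Lemma ideal_mul_assoc (I J K : ideal A) x :
  ideal_mul I (ideal_mul J K) x -> ideal_mul (ideal_mul I J) K x.
Proof.
move: x; apply: gen_ideal_min => _ [x [y [Ix JKy ->]]].
pose P := fun y => forall x, I x -> ideal_mul (ideal_mul I J) K (x *a y).
have P0 : P 0 by move=> u Iu; rewrite amulx0; apply: smem0.
have PD u v : P u -> P v -> P (u + v).
  by move=> Pu Pv z Iz; rewrite amulxD; apply: smemD; [apply: Pu | apply: Pv].
have PZ c u : P u -> P (c *: u).
  by move=> Pu z Iz; rewrite amulxZ; apply/smemZ/Pu.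
have PMl a u : P u -> P (a *a u).
  by move=> Pu z Iz; rewrite amulA; apply: Pu; apply: idealMr.
have PMr a u : P u -> P (u *a a).
  by move=> Pu z Iz; rewrite amulA; apply: idealMr; apply: Pu.
apply: (JKy (@Ideal _ _ (Subspace P0 PD PZ) PMl PMr)) => // _ [u [v [Ju Kv ->]]] z Iz.
by rewrite amulA; apply: mem_ideal_mul => //; apply: mem_ideal_mul.
Qed.

Lemma ideal_pow_mul (I : ideal A) m n x :
  ideal_pow I (m.+1 + n) x -> ideal_mul (ideal_pow I m.+1) (ideal_pow I n) x.
Proof.
elim: m x => [|m IHm] x.
  rewrite add1n; move: x; apply: (@ideal_mulS I _ (ideal_pow I n)) => // y Iy.
  by rewrite -[y]amulx1; apply: mem_ideal_mul => //; apply: mem_gen_ideal.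
rewrite addSn => Ix; apply: ideal_mul_assoc.
by move: x Ix; apply: (@ideal_mulS I I (ideal_pow I (m.+1 + n))) => // y; apply: IHm.
Qed.

End GeneratedIdeals.

Record quiver := Quiver {
  vertex : finType;
  arrow : finType;
  src : arrow -> vertex;
  tgt : arrow -> vertex
}.

Section Paths.
Variable Q : quiver.

Fixpoint chain (x : vertex Q) (s : seq (arrow Q)) : bool :=
  if s is a :: s' then (src a == x) && chain (tgt a) s' else true.

(* A path starts at a vertex and follows a list of consecutive arrows; the
   paths of length 0 are the vertices. *)
Record qpath := QPath { path_rep : vertex Q * seq (arrow Q); _ : chain path_rep.1 path_rep.2 }.
HB.instance Definition _ := [isSub for path_rep].
HB.instance Definition _ := [Countable of qpath by <:].

Definition pstart (p : qpath) : vertex Q := (val p).1.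
Definition parrows (p : qpath) : seq (arrow Q) := (val p).2.
Definition pend (p : qpath) : vertex Q := last (pstart p) (map (@tgt Q) (parrows p)).

Definition path0 (x : vertex Q) : qpath := @QPath (x, [::]) isT.

Fact chain1 (a : arrow Q) : chain (src a) [:: a].
Proof. by rewrite /= eqxx. Qed.
Definition path1 (a : arrow Q) : qpath := @QPath (src a, [:: a]) (chain1 a).

Lemma chain_cat x s t :
  chain x (s ++ t) = chain x s && chain (last x (map (@tgt Q) s)) t.
Proof. by elim: s x => //= a s IHs x; rewrite IHs andbA. Qed.

(* The composite p q, "first q, then p", when q ends where p starts. *)
Definition pcomp (p q : qpath) : option qpath :=
  if pend q == pstart p then insub (pstart q, parrows q ++ parrows p) else None.

Variant pcomp_spec (p q : qpath) : option qpath -> Prop :=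
| PcompSome r of pend q = pstart p & pstart r = pstart q
    & parrows r = parrows q ++ parrows p & pend r = pend p : pcomp_spec p q (Some r)
| PcompNone of pend q != pstart p : pcomp_spec p q None.

Lemma pcompP p q : pcomp_spec p q (pcomp p q).
Proof.
rewrite /pcomp; case: eqVneq => [e|]; last by constructor.
have ch : chain (pstart q) (parrows q ++ parrows p).
  by rewrite chain_cat (valP q) -/(pend q) e (valP p).
rewrite insubT /=; constructor=> //.
rewrite /pend /pstart /parrows /= map_cat last_cat -/(parrows q) -/(pstart q).
by rewrite -/(pend q) e.
Qed.

Lemma qpath_inj p q : pstart p = pstart q -> parrows p = parrows q -> p = q.
Proof.
rewrite /pstart /parrows => e1 e2; apply: val_inj.
by rewrite [LHS]surjective_pairing e1 e2 -surjective_pairing.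
Qed.

Lemma pcompA p q r :
  obind (pcomp p) (pcomp q r) = obind (fun pq => pcomp pq r) (pcomp p q).
Proof.
case: (pcompP q r) => [qr e1 s1 a1 n1|n1]; case: (pcompP p q) => [pq e2 s2 a2 n2|n2] //=.
- case: (pcompP p qr) => [u e3 s3 a3 n3|]; last by rewrite n1 e2 eqxx.
  case: (pcompP pq r) => [v e4 s4 a4 n4|]; last by rewrite s2 e1 eqxx.
  by congr Some; apply: qpath_inj; rewrite ?s3 ?s4 ?s1 // a3 a4 a1 a2 catA.
- by case: (pcompP p qr) => // u; rewrite n1 => e; rewrite e eqxx in n2.
- by case: (pcompP pq r) => // u; rewrite s2 => e; rewrite e eqxx in n1.
Qed.

Lemma pcomp_path0r p x : pcomp p (path0 x) = if x == pstart p then Some p else None.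
Proof.
case: (pcompP p (path0 x)) => [u e s a _|]; rewrite /pend /=; last by move/negPf->.
rewrite -e eqxx; congr Some; apply: qpath_inj => //.
by rewrite s -e.
Qed.

Lemma pcomp_path0l p x : pcomp (path0 x) p = if x == pend p then Some p else None.
Proof.
case: (pcompP (path0 x) p) => [u e s a _|]; rewrite eq_sym; last by move/negPf->.
rewrite e eqxx; congr Some; apply: qpath_inj => //.
by rewrite a cats0.
Qed.

End Paths.

Section PathAlgebra.
Variables (k : fieldType) (Q : quiver).

Definition path_algebra : Type := {malg k[qpath Q]}.
HB.instance Definition _ := GRing.Lmodule.on path_algebra.
Local Notation kQ := path_algebra.

Fact pbasis_key : unit. Proof. exact: tt. Qed.
Definition pbasis : qpath Q -> kQ := locked_with pbasis_key (fun p => mkmalgU p 1).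
Lemma pbasisE p : pbasis p = mkmalgU p 1.
Proof. by rewrite /pbasis unlock. Qed.

Definition coefp (x : kQ) (p : qpath Q) : k := mcoeff p (x : {malg k[qpath Q]}).
Definition suppp (x : kQ) : seq (qpath Q) := msupp (x : {malg k[qpath Q]}).

Section LinearExtension.
Variables (V : lmodType k) (f : qpath Q -> V).
Definition lext (x : kQ) : V := \sum_(p <- suppp x) coefp x p *: f p.

Lemma lextE (d : {fset qpath Q}) (x : kQ) :
  (msupp (x : {malg k[qpath Q]}) `<=` d)%fset ->
  lext x = \sum_(p <- d) coefp x p *: f p.
Proof.
move=> le; rewrite /lext /suppp (big_fset_incl _ le) //= => p _ /mcoeff_outdom e.
by rewrite /coefp e scale0r.
Qed.

Fact lext_lin : linear lext.
Proof.
move=> c x y; pose d : {fset qpath Q} :=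
  (msupp (x : {malg k[qpath Q]}) `|` msupp (y : {malg k[qpath Q]}))%fset.
rewrite (@lextE d (c *: x + y)); last first.
  apply: fsubset_trans (msuppD_le _ _) _; apply: fsetSU; exact: msuppZ_le.
rewrite (@lextE d x) ?fsubsetUl // (@lextE d y) ?fsubsetUr //.
rewrite scaler_sumr -big_split; apply: eq_bigr => p _ /=.
by rewrite /coefp mcoeffD mcoeffZ scalerDl scalerA.
Qed.
HB.instance Definition _ := GRing.isLinear.Build k kQ V *:%R lext lext_lin.

Lemma lext_basis p : lext (pbasis p) = f p.
Proof.
rewrite pbasisE (@lextE [fset p]%fset) ?msuppU_le // big_seq_fset1.
by rewrite /coefp mcoeffUU scale1r.
Qed.
End LinearExtension.

Lemma pbasisZ (c : k) p : c *: pbasis p = mkmalgU p c.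
Proof.
suff E : c *: (mkmalgU p 1 : {malg k[qpath Q]}) = mkmalgU p c by rewrite pbasisE.
apply/malgP => q.
rewrite (mcoeffZ c (mkmalgU p 1) q).
rewrite [RHS]mcoeffU.
have -> : mcoeff q (mkmalgU p (1 : k)) = 1 *+ (p == q) by exact: mcoeffU.
by rewrite mulrnAr mulr1.
Qed.

Lemma pbasis_sum (x : kQ) : x = \sum_(p <- suppp x) coefp x p *: pbasis p.
Proof.
rewrite [LHS](monalgE (x : {malg k[qpath Q]})); apply: eq_bigr => p _.
by rewrite pbasisZ.
Qed.

Lemma pbasis_ind (P : kQ -> Prop) :
  (forall c x y, P x -> P y -> P (c *: x + y)) -> P 0 ->
  (forall p, P (pbasis p)) -> forall x, P x.
Proof.
move=> Plin P0 Pp x; rewrite [x]pbasis_sum.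
have PD u v : P u -> P v -> P (u + v).
  by move=> Pu Pv; rewrite -[u]scale1r; apply: Plin.
by apply: big_ind => // p _; rewrite -[_ *: _]addr0; apply: Plin.
Qed.

Definition obasis (r : option (qpath Q)) : kQ := if r is Some p then pbasis p else 0.

Fact path_mul_key : unit. Proof. exact: tt. Qed.
Definition path_mul : kQ -> kQ -> kQ := locked_with path_mul_key
  (fun x y => lext (fun p => lext (fun q => obasis (pcomp p q)) y) x).
Lemma path_mulE x y :
  path_mul x y = lext (fun p => lext (fun q => obasis (pcomp p q)) y) x.
Proof. by rewrite /path_mul unlock. Qed.
Definition path_one : kQ := \sum_(x : vertex Q) pbasis (path0 x).

Fact path_mul_linl c x y z : path_mul (c *: x + y) z = c *: path_mul x z + path_mul y z.
Proof. by rewrite !path_mulE lext_lin. Qed.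
Fact path_mul_linr c x y z : path_mul x (c *: y + z) = c *: path_mul x y + path_mul x z.
Proof.
rewrite !path_mulE /lext scaler_sumr -big_split; apply: eq_bigr => p _ /=.
by rewrite -!/(lext _ _) lext_lin scalerDr !scalerA mulrC.
Qed.
Lemma path_mul_basis p q : path_mul (pbasis p) (pbasis q) = obasis (pcomp p q).
Proof. by rewrite path_mulE !lext_basis. Qed.
Lemma path_mul0x x : path_mul 0 x = 0.
Proof. by have := path_mul_linl (-1) 0 0 x; rewrite scaler0 addr0 scaleN1r addNr. Qed.
Lemma path_mulx0 x : path_mul x 0 = 0.
Proof. by have := path_mul_linr (-1) x 0 0; rewrite scaler0 addr0 scaleN1r addNr. Qed.

Fact path_mulA : associative path_mul.
Proof.
move=> x y z; elim/pbasis_ind: x => [c u v Hu Hv||p].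
- by rewrite !(path_mul_linl c u v) (path_mul_linl c (path_mul u y)) Hu Hv.
- by rewrite !(path_mul0x y, path_mul0x z, path_mul0x (path_mul y z)).
elim/pbasis_ind: y => [c u v Hu Hv||q].
- rewrite (path_mul_linl c u v z) !(path_mul_linr c (pbasis p)) Hu Hv.
  by rewrite (path_mul_linl c (path_mul (pbasis p) u)).
- by rewrite (path_mul0x z) (path_mulx0 (pbasis p)) (path_mul0x z).
elim/pbasis_ind: z => [c u v Hu Hv||r].
- by rewrite !(path_mul_linr c _ u v) (path_mul_linr c (pbasis p)) Hu Hv.
- by rewrite (path_mulx0 (pbasis q)) (path_mulx0 (pbasis p)) path_mulx0.
rewrite !path_mul_basis.
have El (u : option (qpath Q)) : path_mul (pbasis p) (obasis u) = obasis (obind (pcomp p) u).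
  by case: u => [u|]; rewrite ?path_mul_basis ?path_mulx0.
have Er (u : option (qpath Q)) :
    path_mul (obasis u) (pbasis r) = obasis (obind (fun u => pcomp u r) u).
  by case: u => [u|]; rewrite ?path_mul_basis ?path_mul0x.
by rewrite El Er pcompA.
Qed.

Fact path_mul1x : left_id path_one path_mul.
Proof.
move=> x; elim/pbasis_ind: x => [c u v Hu Hv||p].
- by rewrite (path_mul_linr c path_one u v) Hu Hv.
- exact: path_mulx0.
rewrite /path_one path_mulE linear_sum (bigD1 (pend p)) //= !lext_basis.
rewrite pcomp_path0l eqxx big1 ?addr0 // => x /negPf xp.
by rewrite !lext_basis pcomp_path0l xp.
Qed.

Fact path_mulx1 : right_id path_one path_mul.
Proof.
move=> x; elim/pbasis_ind: x => [c u v Hu Hv||p].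
- by rewrite (path_mul_linl c u v path_one) Hu Hv.
- exact: path_mul0x.
rewrite /path_one path_mulE lext_basis linear_sum (bigD1 (pstart p)) //= !lext_basis.
rewrite pcomp_path0r eqxx big1 ?addr0 // => x /negPf xp.
by rewrite !lext_basis pcomp_path0r xp.
Qed.

HB.instance Definition _ := isAlgebra.Build k path_algebra
  path_mulA path_mul1x path_mulx1 path_mul_linl path_mul_linr.

Lemma pbasisM p q : pbasis p *a pbasis q = obasis (pcomp p q).
Proof. exact: path_mul_basis. Qed.

Definition arrow_ideal : ideal path_algebra :=
  gen_ideal (fun x => exists a : arrow Q, x = pbasis (path1 a)).

Definition admissible (I : ideal path_algebra) : Prop :=
  exists2 n, (2 <= n)%N &
    (forall x, ideal_pow arrow_ideal n x -> I x) /\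
    (forall x, I x -> ideal_pow arrow_ideal 2 x).

Lemma long_path_mem n (p : qpath Q) :
  (n <= size (parrows p))%N -> ideal_pow arrow_ideal n (pbasis p).
Proof.
elim: n p => [|n IHn] p; first by move=> _; apply: mem_gen_ideal.
move=> le_n; have [s [a Ep]] : exists s a, parrows p = rcons s a.
  by case: (parrows p) le_n => // b s _; exists (belast b s), (last b s); rewrite -lastI.
move: le_n; rewrite Ep size_rcons ltnS => le_n.
have := valP p; rewrite -/(parrows p) -/(pstart p) Ep -cats1 chain_cat /= => /andP[ch].
rewrite andbT => /eqP sa.
pose q := @QPath Q (pstart p, s) ch.
have -> : pbasis p = pbasis (path1 a) *a pbasis q.
  rewrite pbasisM; case: (pcompP (path1 a) q) => [r e s' a' _|]; last first.
    by rewrite /pstart /= sa eqxx.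
  by congr pbasis; apply: qpath_inj; rewrite ?s' ?a' // Ep -cats1.
apply: (@mem_ideal_mul _ _ arrow_ideal (ideal_pow arrow_ideal n)).
  by apply: mem_gen_ideal; exists a.
exact: IHn.
Qed.

Lemma finite_codim_pow n (J : ideal path_algebra) :
  (forall x, ideal_pow arrow_ideal n x -> J x) -> finite_codim J.
Proof.
move=> FJ; pose T := (vertex Q * n.-bseq (arrow Q))%type.
pose e (t : T) : kQ := obasis (insub (t.1, t.2 : seq (arrow Q))).
exists T, e; elim/pbasis_ind => [c x y [cx Hx] [cy Hy]||p].
- exists (fun t => c * cx t + cy t).
  have -> : c *: x + y - \sum_t (c * cx t + cy t) *: e t =
      c *: (x - \sum_t cx t *: e t) + (y - \sum_t cy t *: e t).
    rewrite scalerBr addrACA -opprD scaler_sumr -big_split; congr (_ - _).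
    by apply: eq_bigr => t _; rewrite /= scalerDl scalerA.
  exact: (smemD (smemZ c Hx) Hy).
- exists (fun=> 0); rewrite big1 ?subrr; first exact: smem0.
  by move=> t _; rewrite scale0r.
case: (leqP n (size (parrows p))) => [le|lt].
  exists (fun=> 0); rewrite big1 ?subr0; last by move=> t _; rewrite scale0r.
  exact/FJ/long_path_mem.
pose t0 : T := (pstart p, Bseq (ltnW lt)).
exists (fun t => (t == t0)%:R); rewrite (bigD1 t0) //= eqxx scale1r big1; last first.
  by move=> t /negPf ->; rewrite scale0r.
rewrite addr0 /e /= (_ : (pstart p, parrows p) = val p) ?valK ?subrr; last first.
  by rewrite [RHS]surjective_pairing.
exact: smem0.
Qed.

Section BoundQuiverAlgebra.
Variables (I : ideal path_algebra) (admI : admissible I).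

Lemma admissible_fc : finite_codim I.
Proof. by have [n _ [FI _]] := admI; apply: finite_codim_pow FI. Qed.

Lemma admissible_square_fc : finite_codim (ideal_mul I I).
Proof.
have [[//|n] _ [FI _]] := admI.
apply: (@finite_codim_pow (n.+1 + n.+1)) => x /ideal_pow_mul.
exact: ideal_mulS.
Qed.

Definition bound_quiver_algebra : fdAlgebraType k := aquot admissible_fc.

Definition bqa_bimodule : bimodule path_algebra := aquot_bimodule admissible_fc.

(* I / I^2 as a kQ-bimodule, realized inside kQ / I^2 *)
Definition conormal_bimodule : bimodule path_algebra :=
  ideal_quot_bimodule admissible_square_fc I.

End BoundQuiverAlgebra.
End PathAlgebra.

(* Main.v *)
From HB Require Import structures.
Require Import Defs.
From mathcomp Require Import all_boot all_order all_algebra.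
From mathcomp Require Import zify boolp.

Set Implicit Arguments.
Unset Strict Implicit.
Unset Printing Implicit Defensive.

Import GRing.Theory.
Local Open Scope ring_scope.

(** Write h(X) for the dimension of Hom(X, L) over L^e, where L = kQ/I is seen
    as an L^e-module. All the dimensions in the statement reduce to values of h.

    For a projective presentation P1 -> P0 -> L -> 0 the space D Hom(L, tau L)
    is the cokernel of Hom(P0, L) -> Hom(P1, L), since Hom(-, D(P^* )) is dual
    to Hom(P, -) when P is projective. Left exactness of Hom then gives
    dim HH^1_tau = h(P1) - h(P0) + h(L) (dim_hom_tau). For a projective
    resolution R with first and second syzygies O1 and O2, the same exactness
    gives dim HH^1 = h(O1) - h(R0) + h(L) and dim HH^2 = h(O2) - h(R1) + h(O1)
    (dim_ext1, dim_ext2). By the long form of Schanuel's lemma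
    h(O2) - h(R1) + h(R0) is independent of the resolution (long_schanuel), so
    if O2' is the second syzygy of the chosen minimal presentation then
    e(L) = h(O2') - dim HH^2. Here any minimal presentation may be used, because
    minimality determines h(P0) and h(P1) (min_presentation_hdim).

    It remains to exhibit a minimal presentation whose second syzygy is I/I^2.
    It is the start of the bimodule resolution of a bound quiver algebra: with
    E the span of the vertices,
      L (x)_E kQ_1 (x)_E L -> L (x)_E L -> L -> 0,
    the first map sending the generator of an arrow a to a (x) 1 - 1 (x) a. The
    universal E-derivation D : kQ -> L (x)_E kQ_1 (x)_E L, which takes a path to
    the sum of all the ways of marking one of its arrows, restricts to a
    bimodule map on I that vanishes on I^2. Choosing a linear section of
    kQ -> L yields explicit homotopies which show that D maps I onto the kernel
    of the first map (lker_d1_udiff) and that I^2 is the kernel of D on I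
    (udiff_ker). Minimality holds because the kernels lie in the radical; for
    the second one this is where I being contained in the square of the arrow
    ideal is used (lker_d1_rad). *)

(** * Linear algebra and dimensions of Hom spaces *)

Section Combinations.
Variables (k : fieldType) (V : lmodType k).
Implicit Types (c : k) (a b : V).
Lemma scaleBD c a b a' b' : c *: a + b - (c *: a' + b') = c *: (a - a') + (b - b').
Proof. by rewrite opprD addrACA scalerBr. Qed.
Lemma scaleDD c a b a' b' : c *: a + b + (c *: a' + b') = c *: (a + a') + (b + b').
Proof. by rewrite addrACA scalerDr. Qed.
End Combinations.

Section VectorSpaces.
Variable k : fieldType.
Implicit Types U V W : vectType k.

Lemma linear_lfun U V (f : U -> V) : linear f -> exists g : 'Hom(U, V), g =1 f.
Proof.
move=> lf; pose F : {linear U -> V} := HB.pack f (GRing.isLinear.Build k U V *:%R f lf).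
by exists (linfun F) => x; rewrite lfunE.
Qed.

Lemma dim_inj U V (f : U -> V) :
  linear f -> (forall x, f x = 0 -> x = 0) -> (\dim {:U} <= \dim {:V})%N.
Proof.
move=> /linear_lfun[g gE] finj.
have kg : (fullv :&: lker g)%VS = 0%VS.
  apply/eqP; rewrite -subv0; apply/subvP => x /memv_capP[_].
  by rewrite memv_ker gE memv0 => /eqP /finj ->.
by rewrite -(limg_dim_eq kg) dimvS ?subvf.
Qed.

Lemma limg_fullvP U V (f : 'Hom(U, V)) :
  limg f = fullv <-> forall y, exists x, f x = y.
Proof.
split=> [fs y|fs]; first by have /memv_imgP[x _ ->] : y \in limg f; rewrite ?fs ?memvf //; exists x.
apply/eqP; rewrite eqEsubv subvf; apply/subvP => y _.
by have [x <-] := fs y; rewrite memv_img ?memvf.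
Qed.

Lemma lker0_inj U V (f : 'Hom(U, V)) : lker f = 0%VS -> injective f.
Proof. by move=> f0; apply/lker0P; rewrite f0. Qed.

Lemma vpi_eq0 V (U : {vspace V}) x : (vpi U x == 0) = (x \in U).
Proof. by apply/eqP/idP => [/(qpi_eq0 (vsub U))|/(qpi_eq0 (vsub U))]. Qed.

Lemma vpi_ex V (U : {vspace V}) (u : vquot U) : exists x, vpi U x = u.
Proof. by exists (@qrepr _ _ (vsub U) u); exact: (@qreprK _ _ (vsub U)). Qed.

Lemma dim_vquot V (U : {vspace V}) : (\dim {:vquot U} + \dim U = \dim {:V})%N.
Proof.
have E x : linfun (vpi U) x = vpi U x by rewrite lfunE.
have kU : lker (linfun (vpi U)) = U.
  by apply/vspaceP => x; rewrite memv_ker E vpi_eq0.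
have ims : limg (linfun (vpi U)) = fullv.
  by apply/limg_fullvP => u; have [x <-] := vpi_ex u; exists x; rewrite E.
by have := limg_ker_dim (linfun (vpi U)) fullv; rewrite capfv ims kU addnC.
Qed.

Lemma dim_subquot V (U W : {vspace V}) : (W <= U)%VS ->
  (\dim {:subquot U W} + \dim W = \dim U)%N.
Proof.
move=> WU; pose i := linfun (vsval : subvs_of U -> V).
have iE u : i u = vsval u by rewrite lfunE.
have -> : \dim W = \dim (i @^-1: W)%VS.
  have i0 : lker i = 0%VS.
    apply/eqP; rewrite -subv0; apply/subvP => u; rewrite memv_ker iE memv0 => /eqP u0.
    by apply/eqP/subvs_inj.
  rewrite -(@limg_dim_eq _ _ _ i (i @^-1: W)%VS) ?i0 ?capv0 //; congr (\dim _).
  apply/vspaceP => x; apply/idP/memv_imgP => [Wx|[u]]; last first.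
    by rewrite -memv_preim => Wu ->.
  have Ux := subvP WU _ Wx; exists (Subvs Ux); last by rewrite iE.
  by rewrite -memv_preim iE.
by rewrite dim_vquot dimvf.
Qed.

Lemma vquot_lift V W (U : {vspace V}) (f : 'Hom(V, W)) :
  (U <= lker f)%VS -> exists g : 'Hom(vquot U, W), forall x, g (vpi U x) = f x.
Proof.
move=> Uf; pose g (u : vquot U) : W := f (@qrepr _ _ (vsub U) u).
have gE x : g (vpi U x) = f x.
  apply/eqP; rewrite -subr_eq0 -linearB -memv_ker.
  exact/(subvP Uf)/(qreprB (vsub U)).
have glin : linear g.
  move=> c u v; have [[x <-] [y <-]] := (vpi_ex u, vpi_ex v).
  by rewrite -linearP !gE linearP.
by have [h hE] := linear_lfun glin; exists h => x; rewrite hE gE.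
Qed.
End VectorSpaces.

Section Modules.
Variables (k : fieldType) (A : algebraType k).
Implicit Types M N P K X : lmodule A.

Lemma linear_lhom M N (f : M -> N) :
  linear f -> (forall a x, f (lact M a x) = lact N a (f x)) ->
  exists g : lhom M N, g =1 f.
Proof.
move=> /linear_lfun[g gE] fe; exists (mk_lhom g) => x.
by rewrite mk_lhomE // => a y; rewrite !gE fe.
Qed.

Definition lhom_id M : lhom M M := mk_lhom \1%VF.
Lemma lhom_idE M x : lhom_id M x = x.
Proof. by rewrite /lhom_id mk_lhomE ?id_lfunE // => a y; rewrite !id_lfunE. Qed.

Lemma lincl_inj M (U : {vspace M}) (sU : submodule U) : lker (lincl sU) = 0%VS.
Proof.
apply/eqP; rewrite -subv0; apply/subvP => u; rewrite memv_ker linclE memv0 => /eqP u0.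
by apply/eqP/subvs_inj.
Qed.

Lemma lhom_factor M N P (g : lhom M N) (f : lhom M P) :
  limg g = fullv -> (lker g <= lker f)%VS -> exists h : lhom N P, forall x, h (g x) = f x.
Proof.
move=> /limg_fullvP gs gf.
have gi y : g ((g^-1)%VF y) = y by apply: limg_lfunVK; have [x <-] := gs y; rewrite memv_img ?memvf.
have E x y : g x = g y -> f x = f y.
  move=> gxy; apply/eqP; rewrite -subr_eq0 -linearB -memv_ker; apply: (subvP gf).
  by rewrite memv_ker linearB /= gxy subrr.
have [|a y|h hE] := @linear_lhom N P (fun y => f ((g^-1)%VF y)).
- by move=> c x y; rewrite !linearP.
- by rewrite -lhomE; apply: E; rewrite lhomE !gi.
by exists h => x; rewrite hE; apply: E; rewrite gi.
Qed.

Definition hdim M N := \dim {: lhom M N}.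

(** Left exactness of Hom(-, X), in the form in which it computes dimensions. *)
Lemma hdim_coker M N P X (f : lhom M N) (g : lhom N P) :
  limg g = fullv -> limg f = lker g ->
  \dim (lker (precomp f X)) = hdim P X.
Proof.
move=> gs fg; have <- : limg (precomp g X) = lker (precomp f X).
  apply/vspaceP => h; rewrite memv_ker; apply/memv_imgP/eqP => [[u _ ->]|hf].
    apply: lhom_inj => x; rewrite !precompE zero_lfunE.
    by have /eqP -> : g (f x) == 0; rewrite ?linear0 // -memv_ker -fg memv_img ?memvf.
  have [|u uE] := @lhom_factor _ _ _ g h gs.
    rewrite -fg; apply/subvP => _ /memv_imgP[x _ ->]; rewrite memv_ker -precompE hf.
    by rewrite zero_lfunE.
  by exists u; rewrite ?memvf //; apply: lhom_inj => x; rewrite precompE uE.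
apply: limg_dim_eq; apply/eqP; rewrite -subv0; apply/subvP => h /memv_capP[_].
rewrite memv_ker memv0 => /eqP h0; apply/eqP/lhom_inj => y.
have [x <-] := (limg_fullvP _).1 gs y.
by rewrite -precompE h0 !zero_lfunE.
Qed.

Lemma rank_precomp M N P X (f : lhom M N) (g : lhom N P) :
  limg g = fullv -> limg f = lker g ->
  (\dim (limg (precomp f X)) + hdim P X = hdim N X)%N.
Proof.
move=> gs fg; rewrite -(hdim_coker X gs fg) addnC.
by rewrite -[lker _]capfv limg_ker_dim.
Qed.

Lemma hdim_surj M N X (f : lhom M N) : limg f = fullv -> (hdim N X <= hdim M X)%N.
Proof.
move=> fs; apply: (@dim_inj _ _ _ (precomp f X)); first exact: linearP.
move=> h h0; apply: lhom_inj => y; have [x <-] := (limg_fullvP _).1 fs y.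
by rewrite -precompE h0 !zero_lfunE.
Qed.

Lemma proj_section P M (p : lhom M P) : projective P -> limg p = fullv ->
  exists s : lhom P M, forall x, p (s x) = x.
Proof.
by move=> pP /(pP _ _ (lhom_id P))[s sE]; exists s => x; rewrite sE lhom_idE.
Qed.

(** The sequence splits, so restriction to K is surjective: a map on K is
    extended by composing it with the projection x - s (p x) onto K. *)
Lemma hdim_split K X P N (i : lhom K X) (p : lhom X P) :
  lker i = 0%VS -> limg i = lker p -> limg p = fullv -> projective P ->
  hdim X N = (hdim P N + hdim K N)%N.
Proof.
move=> i0 ip ps pP; have [s sE] := proj_section pP ps.
have := rank_precomp N ps ip; rewrite addnC => <-; congr (_ + _)%N.
rewrite (_ : limg (precomp i N) = fullv) //; apply/limg_fullvP => u.
have iK x : i ((i^-1)%VF (x - s (p x))) = x - s (p x).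
  by apply: limg_lfunVK; rewrite ip memv_ker linearB /= sE subrr.
have iI := lker0_inj i0.
have [||h hE] := @linear_lhom X N (fun x => (u : lhom K N) ((i^-1)%VF (x - s (p x)))).
- move=> c x y; rewrite -!linearP; congr ((u : lhom K N) ((i^-1)%VF _)).
  by rewrite !linearP addrACA -scalerDr.
- move=> a x; rewrite -lhomE; congr ((u : lhom K N) _); apply: iI.
  by rewrite iK [RHS]lhomE iK !lhomE linearB.
exists h; apply: lhom_inj => y; rewrite precompE hE; congr ((u : lhom K N) _); apply: iI.
rewrite iK; have /eqP -> : p (i y) == 0 by rewrite -memv_ker -ip memv_img ?memvf.
by rewrite linear0 subr0.
Qed.

End Modules.

(* Instances of the linearity lemmas that leave f in the form of an application
   of lhom, on which rewriting with equivariance depends. *)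
Section LinearityRules.
Variables (k : fieldType) (A : algebraType k) (M N : lmodule A) (f : lhom M N).
Lemma lhomD x y : f (x + y) = f x + f y. Proof. exact: linearD. Qed.
Lemma lhomB x y : f (x - y) = f x - f y. Proof. exact: linearB. Qed.
Lemma lhom0 : f 0 = 0. Proof. exact: linear0. Qed.
Lemma lhomP c x y : f (c *: x + y) = c *: f x + f y. Proof. exact: linearP. Qed.
Lemma lhom_sum I (r : seq I) (P : pred I) (F : I -> M) :
  f (\sum_(i <- r | P i) F i) = \sum_(i <- r | P i) f (F i).
Proof. exact: linear_sum. Qed.
End LinearityRules.

(** * Syzygies and Schanuel's lemma *)

Section Exactness.
Variables (k : fieldType) (A : fdAlgebraType k).
Implicit Types M N P K X : lmodule A.

Lemma lhom_lift M N X (i : lhom N X) (f : lhom M X) :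
  lker i = 0%VS -> (limg f <= limg i)%VS -> exists g : lhom M N, forall x, i (g x) = f x.
Proof.
move=> /lker0_inj iI fi.
have iK x : i ((i^-1)%VF (f x)) = f x.
  by apply/limg_lfunVK/(subvP fi); rewrite memv_img ?memvf.
have [||g gE] := @linear_lhom _ _ M N (fun x => (i^-1)%VF (f x)).
- by move=> c x y; rewrite !linearP.
- by move=> a x; apply: iI; rewrite iK [RHS]lhomE iK lhomE.
by exists g => x; rewrite gE.
Qed.

Lemma hdim_iso M N X (f : lhom M N) :
  lker f = 0%VS -> limg f = fullv -> hdim M X = hdim N X.
Proof.
move=> f0 fs; apply/eqP; rewrite eqn_leq (hdim_surj X fs) andbT.
have [|g gE] := @lhom_lift _ _ _ f (lhom_id N) f0; first by rewrite fs subvf.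
apply: (@hdim_surj _ _ _ _ X g); apply/limg_fullvP => x; exists (f x).
by apply: (lker0_inj f0); rewrite gE lhom_idE.
Qed.

Lemma proj_retract P X (i : lhom X P) (r : lhom P X) :
  (forall x, r (i x) = x) -> projective P -> projective X.
Proof.
move=> ri pP M N f g gs; have [h hE] := pP _ _ (lhom_comp f r) g gs.
by exists (lhom_comp h i) => x; rewrite lhom_compE hE lhom_compE ri.
Qed.

Lemma lker_modP M N (f : lhom M N) (x : lker_mod f) : f (lker_incl f x) = 0.
Proof. by apply/eqP; rewrite -memv_ker linclE subvsP. Qed.

Lemma lker_modK M N (f : lhom M N) x : f x = 0 -> exists y : lker_mod f, lker_incl f y = x.
Proof.
move=> /eqP; rewrite -memv_ker => fx; exists (Subvs fx); exact: linclE.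
Qed.

Lemma lker_incl_inj M N (f : lhom M N) : injective (lker_incl f).
Proof. exact/lker0_inj/lincl_inj. Qed.

Lemma lker_lift M N X (g : lhom N X) (f : lhom M N) :
  (forall x, g (f x) = 0) -> exists e : lhom M (lker_mod g), forall x, lker_incl g (e x) = f x.
Proof.
move=> gf; apply: lhom_lift; first exact: lincl_inj.
rewrite limg_lincl; apply/subvP => _ /memv_imgP[x _ ->].
by rewrite memv_ker gf.
Qed.

Lemma lhom_onto_ker M N X (f : lhom M N) (g : lhom N X) :
  limg f = lker g -> exists e : lhom M (lker_mod g),
    [/\ forall x, lker_incl g (e x) = f x, limg e = fullv & lker e = lker f].
Proof.
move=> fg; have [|e eE] := @lker_lift _ _ _ g f.
  by move=> x; apply/eqP; rewrite -memv_ker -fg memv_img ?memvf.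
exists e; split=> //; last first.
  apply/vspaceP => x; rewrite !memv_ker -eE.
  by apply/eqP/eqP => [->|ex]; [rewrite linear0 | apply: lker_incl_inj; rewrite ex linear0].
apply/limg_fullvP => y.
have /memv_imgP[x _ xy] : lker_incl g y \in limg f by rewrite fg memv_ker lker_modP.
by exists x; apply: lker_incl_inj; rewrite eE.
Qed.

(** Submodules with the same carrier may differ by their stability proofs; this
    transports dimensions between such kernels. *)
Lemma hdim_lker M N N' X (f : lhom M N) (f' : lhom M N') :
  lker f = lker f' -> hdim (lker_mod f) X = hdim (lker_mod f') X.
Proof.
move=> ff'; have [|e [eE es ek]] := @lhom_onto_ker _ _ _ (lker_incl f) f'.
  by rewrite limg_lincl.
by apply: (hdim_iso X (f := e)); rewrite // ek lincl_inj.
Qed.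

Lemma proj_lker P S (p : lhom S P) :
  projective S -> projective P -> limg p = fullv -> projective (lker_mod p).
Proof.
move=> pS pP ps; have [s sE] := proj_section pP ps.
have [||f fE] := @linear_lhom _ _ S S (fun x => x - s (p x)).
- by move=> c x y; rewrite !linearP addrACA -scalerDr.
- by move=> a x; rewrite !lhomE linearB.
have [|r rE] := @lker_lift _ _ _ p f.
  by move=> x; rewrite fE linearB /= sE subrr.
apply: (@proj_retract S _ (lker_incl p) r) => // x; apply: lker_incl_inj.
by rewrite rE fE lker_modP linear0 subr0.
Qed.

End Exactness.

Section DirectSum.
Variables (k : fieldType) (A : fdAlgebraType k) (M N : lmodule A).
Local Notation V := (lcar M * lcar N)%type.

Definition lsum_fun (a : A) (x : V) : V := (lact M a x.1, lact N a x.2).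
Fact lsum_fun_lin a : linear (lsum_fun a).
Proof. by move=> c x y; rewrite /lsum_fun !linearP. Qed.
HB.instance Definition _ a := GRing.isLinear.Build k V V *:%R (lsum_fun a) (lsum_fun_lin a).

Let lsum_act a : 'End(V) := linfun (lsum_fun a).
Fact lsum_act_lin : linear lsum_act.
Proof.
by move=> c a b; apply/lfunP => x; rewrite add_lfunE scale_lfunE !lfunE /= /lsum_fun !lactP.
Qed.
Fact lsum_act1 : lsum_act aone = \1%VF.
Proof. by apply/lfunP => -[x y]; rewrite !lfunE /= /lsum_fun !lact1E. Qed.
Fact lsum_actM a b : lsum_act (a *a b) = (lsum_act a \o lsum_act b)%VF.
Proof. by apply/lfunP => x; rewrite comp_lfunE !lfunE /= /lsum_fun !lactME. Qed.

Definition lsum : lmodule A := LModule lsum_act_lin lsum_act1 lsum_actM.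

Lemma lsum_lactE a (x : lsum) : lact lsum a x = (lact M a (x : V).1, lact N a (x : V).2) :> V.
Proof. by rewrite /= lfunE. Qed.
End DirectSum.

Section Schanuel.
Variables (k : fieldType) (A : fdAlgebraType k).
Implicit Types M N P K X : lmodule A.

(** The pullback X of two surjections onto M is an extension of P' by ker f, and
    of P by ker f'. *)
Lemma pullback_exists P P' M (f : lhom P M) (f' : lhom P' M) :
  limg f = fullv -> limg f' = fullv ->
  exists X (p : lhom X P) (p' : lhom X P') (i : lhom (lker_mod f) X) (i' : lhom (lker_mod f') X),
   [/\ lker i = 0%VS, limg i = lker p' & limg p' = fullv] /\
   [/\ lker i' = 0%VS, limg i' = lker p & limg p = fullv].
Proof.
move=> /limg_fullvP fs /limg_fullvP f's; pose S := lsum P P'.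
have [||d dE] := @linear_lhom _ _ S M (fun x : S => f (x : P * P')%type.1 - f' (x : P * P')%type.2).
- by move=> c x y; rewrite !linearP addrACA -scalerDr.
- by move=> a x; rewrite lsum_lactE /= !lhomE linearB.
have [//||q1 q1E] := @linear_lhom _ _ S P (fun x : S => (x : P * P')%type.1).
  by move=> a x; rewrite lsum_lactE.
have [//||q2 q2E] := @linear_lhom _ _ S P' (fun x : S => (x : P * P')%type.2).
  by move=> a x; rewrite lsum_lactE.
have [||j1 j1E] := @linear_lhom _ _ P S (fun x => (x, 0) : (P * P')%type).
- by move=> c x y; congr pair; rewrite /= scaler0 addr0.
- by move=> a x; rewrite lsum_lactE /= linear0.
have [||j2 j2E] := @linear_lhom _ _ P' S (fun x => (0, x) : (P * P')%type).
- by move=> c x y; congr pair; rewrite /= scaler0 addr0.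
- by move=> a x; rewrite lsum_lactE /= linear0.
have [|i iE] := @lker_lift _ _ _ _ _ d (lhom_comp j1 (lker_incl f)).
  by move=> x; rewrite lhom_compE j1E dE /= linear0 subr0 lker_modP.
have [|i' i'E] := @lker_lift _ _ _ _ _ d (lhom_comp j2 (lker_incl f')).
  by move=> x; rewrite lhom_compE j2E dE /= linear0 sub0r lker_modP oppr0.
have dk (x : lker_mod d) : f (q1 (lker_incl d x)) = f' (q2 (lker_incl d x)).
  by apply/eqP; rewrite -subr_eq0 q1E q2E -dE lker_modP.
have ext x y : q1 x = q1 y -> q2 x = q2 y -> x = y.
  by rewrite !q1E !q2E; case: x y => [a b] [c e] /= -> ->.
exists (lker_mod d), (lhom_comp q1 (lker_incl d)), (lhom_comp q2 (lker_incl d)), i, i'.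
split; split.
- apply/eqP; rewrite -subv0; apply/subvP => x; rewrite memv_ker memv0 => /eqP ix.
  have := iE x; rewrite ix linear0 lhom_compE j1E => -[x0].
  by apply/eqP/lker_incl_inj; rewrite linear0.
- apply/vspaceP => x; rewrite memv_ker lhom_compE.
  apply/memv_imgP/eqP => [[y _ ->]|x0]; first by rewrite iE lhom_compE j1E q2E.
  have [|y yx] := @lker_modK _ _ _ _ f (q1 (lker_incl d x)); first by rewrite dk x0 linear0.
  exists y; rewrite ?memvf //; apply: lker_incl_inj; apply: ext.
    by rewrite iE lhom_compE j1E [RHS]q1E /= yx.
  by rewrite x0 iE lhom_compE j1E q2E.
- apply/limg_fullvP => y; have [x xy] := fs (f' y).
  have [|z zE] := @lker_modK _ _ _ _ d ((x, y) : (P * P')%type).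
    by rewrite dE /= xy subrr.
  by exists z; rewrite lhom_compE zE q2E.
- apply/eqP; rewrite -subv0; apply/subvP => x; rewrite memv_ker memv0 => /eqP ix.
  have := i'E x; rewrite ix linear0 lhom_compE j2E => -[x0].
  by apply/eqP/lker_incl_inj; rewrite linear0.
- apply/vspaceP => x; rewrite memv_ker lhom_compE.
  apply/memv_imgP/eqP => [[y _ ->]|x0]; first by rewrite i'E lhom_compE j2E q1E.
  have [|y yx] := @lker_modK _ _ _ _ f' (q2 (lker_incl d x)); first by rewrite -dk x0 linear0.
  exists y; rewrite ?memvf //; apply: lker_incl_inj; apply: ext.
    by rewrite x0 i'E lhom_compE j2E q1E.
  by rewrite i'E lhom_compE j2E [RHS]q2E /= yx.
- apply/limg_fullvP => x; have [y yx] := f's (f x).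
  have [|z zE] := @lker_modK _ _ _ _ d ((x, y) : (P * P')%type).
    by rewrite dE /= yx subrr.
  by exists z; rewrite lhom_compE zE q1E.
Qed.

(** Both extensions of the pullback split, which gives two expressions for its
    Hom dimension. *)
Lemma schanuel P P' M N (f : lhom P M) (f' : lhom P' M) :
  projective P -> projective P' -> limg f = fullv -> limg f' = fullv ->
  (hdim (lker_mod f) N + hdim P' N = hdim (lker_mod f') N + hdim P N)%N.
Proof.
move=> pP pP' fs f's.
have [X [p [p' [i [i' [[i0 ip ps] [i'0 i'p p's]]]]]]] := pullback_exists fs f's.
have := hdim_split N i0 ip ps pP'; rewrite (hdim_split N i'0 i'p p's pP).
by lia.
Qed.

(** When X is K plus a projective P, their syzygies agree up to projectives. The
    kernel T of S -> X -> P is projective and covers K with the same kernel as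
    that of S -> X, so the case of two covers of K applies. *)
Lemma hdim_syzygy_split K X P R S N (i : lhom K X) (p : lhom X P)
    (f : lhom R K) (g : lhom S X) :
  lker i = 0%VS -> limg i = lker p -> limg p = fullv -> projective P ->
  projective R -> projective S -> limg f = fullv -> limg g = fullv ->
  (hdim (lker_mod f) N + hdim S N = hdim (lker_mod g) N + hdim R N + hdim P N)%N.
Proof.
move=> i0 ip ps pP pR pS fs gs; pose pg := lhom_comp p g.
have pgs : limg pg = fullv by rewrite limg_comp_surj.
have pT := proj_lker pS pP pgs.
have [|q qE] := @lhom_lift _ _ _ _ _ i (lhom_comp g (lker_incl pg)) i0.
  apply/subvP => _ /memv_imgP[x _ ->].
  by rewrite ip memv_ker lhom_compE -lhom_compE lker_modP.
have qs : limg q = fullv.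
  apply/limg_fullvP => y; have [x xy] := (limg_fullvP _).1 gs (i y).
  have [|z zx] := @lker_modK _ _ _ _ pg x.
    by rewrite lhom_compE xy; apply/eqP; rewrite -memv_ker -ip memv_img ?memvf.
  by exists z; apply: (lker0_inj i0); rewrite qE lhom_compE zx.
have -> : hdim (lker_mod g) N = hdim (lker_mod q) N.
  have [|e eE] := @lker_lift _ _ _ _ _ g (lhom_comp (lker_incl pg) (lker_incl q)).
    by move=> x; rewrite lhom_compE -lhom_compE -qE lker_modP linear0.
  apply/esym/(hdim_iso N (f := e)).
    apply/eqP; rewrite -subv0; apply/subvP => x; rewrite memv_ker memv0 => /eqP ex.
    have := eE x; rewrite ex linear0 lhom_compE => x0; apply/eqP.
    by do 2!apply: lker_incl_inj; rewrite -x0 !linear0.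
  apply/limg_fullvP => y.
  have [|z zy] := @lker_modK _ _ _ _ pg (lker_incl g y); first by rewrite lhom_compE lker_modP linear0.
  have [|w wz] := @lker_modK _ _ _ _ q z.
    by apply: (lker0_inj i0); rewrite qE lhom_compE zy lker_modP linear0.
  by exists w; apply: lker_incl_inj; rewrite eE lhom_compE wz.
have := schanuel N pR pT fs qs.
have : hdim S N = (hdim P N + hdim (lker_mod pg) N)%N.
  exact: (hdim_split N (lincl_inj _) (limg_lincl _) pgs pP).
by lia.
Qed.
End Schanuel.

Section LongSchanuel.
Variables (k : fieldType) (A : fdAlgebraType k).
Implicit Types M N P K X : lmodule A.

(** The pullback of the two covers of M is, up to a projective summand, the first
    syzygy of either; both second syzygies are therefore compared to the syzygy
    of one free cover of the pullback. *)
Lemma long_schanuel P0 P1 P0' P1' M N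
    (d0 : lhom P0 M) (d1 : lhom P1 P0) (d0' : lhom P0' M) (d1' : lhom P1' P0') :
  projective P0 -> projective P1 -> limg d0 = fullv -> limg d1 = lker d0 ->
  projective P0' -> projective P1' -> limg d0' = fullv -> limg d1' = lker d0' ->
  (hdim (lker_mod d1) N + hdim P0 N + hdim P1' N =
   hdim (lker_mod d1') N + hdim P0' N + hdim P1 N)%N.
Proof.
move=> pP0 pP1 s0 e0 pP0' pP1' s0' e0'.
have [X [p [p' [i [i' [[i0 ip ps] [i'0 i'p p's]]]]]]] := pullback_exists s0 s0'.
have [e [_ es ek]] := lhom_onto_ker e0; have [e' [_ es' ek']] := lhom_onto_ker e0'.
have pF : projective (free_cover_mod X) by apply: free_projective.
have := hdim_syzygy_split N i0 ip ps pP0' pP1 pF es (free_cover_surj X).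
have := hdim_syzygy_split N i'0 i'p p's pP0 pP1' pF es' (free_cover_surj X).
rewrite (hdim_lker N ek) (hdim_lker N ek'); lia.
Qed.

Lemma dim_ext1 M N (R : proj_resolution M) :
  (\dim {:ext_of R N 1} + hdim (pr_mod R 0) N = hdim (lker_mod (pr_aug R)) N + hdim M N)%N.
Proof.
have [e [eE es ek]] := lhom_onto_ker (pr_exact0 R).
have := hdim_coker N es; rewrite ek => /(_ _ _ (pr_exactS R 0)) <-.
have <- := rank_precomp N (pr_surj R) (pr_exact0 R).
rewrite addnA dim_subquot //.
apply/subvP => _ /memv_imgP[h _ ->]; rewrite memv_ker; apply/eqP/lhom_inj => x.
rewrite !precompE zero_lfunE; have /eqP -> : pr_diff R 0 (pr_diff R 1 x) == 0.
  by rewrite -memv_ker -pr_exactS memv_img ?memvf.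
by rewrite linear0.
Qed.

Lemma dim_ext2 M N (R : proj_resolution M) :
  (\dim {:ext_of R N 2} + hdim (pr_mod R 1) N =
   hdim (lker_mod (pr_diff R 0)) N + hdim (lker_mod (pr_aug R)) N)%N.
Proof.
have [e [eE es ek]] := lhom_onto_ker (pr_exact0 R).
have [e' [e'E es' ek']] := lhom_onto_ker (pr_exactS R 0).
have := hdim_coker N es'; rewrite ek' => /(_ _ _ (pr_exactS R 1)) <-.
have := rank_precomp N es; rewrite ek => /(_ _ _ (pr_exactS R 0)) <-.
rewrite addnA dim_subquot //.
apply/subvP => _ /memv_imgP[h _ ->]; rewrite memv_ker; apply/eqP/lhom_inj => x.
rewrite !precompE zero_lfunE; have /eqP -> : pr_diff R 1 (pr_diff R 2 x) == 0.
  by rewrite -memv_ker -pr_exactS memv_img ?memvf.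
by rewrite linear0.
Qed.

(** Any lift of f through f' is onto modulo the kernel of f', hence onto. *)
Lemma superfluous_cover P P' M (f : lhom P M) (f' : lhom P' M) :
  projective P -> limg f = fullv -> limg f' = fullv -> superfluous (lker f') ->
  exists h : lhom P P', (forall x, f' (h x) = f x) /\ limg h = fullv.
Proof.
move=> pP fs f's sf'; have [h hE] := pP _ _ f f' f's; exists h; split=> //.
apply: sf'; first exact: limg_submodule.
apply/eqP; rewrite eqEsubv subvf; apply/subvP => y _.
have [x xy] := (limg_fullvP _).1 fs (f' y).
rewrite -[y](subrK (h x)) addrC memv_add ?memv_img ?memvf // memv_ker linearB /=.
by rewrite hE xy subrr.
Qed.

(** Two minimal presentations surject onto each other termwise, so Hom out of
    their terms has the same dimension; no isomorphism has to be built. *)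
Lemma min_presentation_le M N (p q : min_presentation M) :
  (hdim (mp_P0 q) N <= hdim (mp_P0 p) N)%N /\ (hdim (mp_P1 q) N <= hdim (mp_P1 p) N)%N.
Proof.
have [f0 [f0E f0s]] := superfluous_cover (@mp_proj0 _ _ _ p) (mp_surj p) (mp_surj q) (@mp_min0 _ _ _ q).
split; first exact: hdim_surj f0s.
have [e [eE es ek]] := lhom_onto_ker (mp_exact p).
have [e' [e'E es' ek']] := lhom_onto_ker (mp_exact q).
have [|g gE] := @lker_lift _ _ _ _ _ (mp_d0 q) (lhom_comp f0 (lker_incl (mp_d0 p))).
  by move=> x; rewrite lhom_compE f0E lker_modP.
have gs : limg g = fullv.
  apply/limg_fullvP => y; have [x xy] := (limg_fullvP _).1 f0s (lker_incl (mp_d0 q) y).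
  have [|z zx] := @lker_modK _ _ _ _ (mp_d0 p) x; first by rewrite -f0E xy lker_modP.
  by exists z; apply: lker_incl_inj; rewrite gE lhom_compE zx.
have [|//||h [_ hs]] := superfluous_cover (f := lhom_comp g e) (f' := e') (@mp_proj1 _ _ _ p).
- by rewrite limg_comp_surj.
- by rewrite ek'; apply: mp_min1.
exact: hdim_surj hs.
Qed.

Lemma min_presentation_hdim M N (p q : min_presentation M) :
  hdim (mp_P0 p) N = hdim (mp_P0 q) N /\ hdim (mp_P1 p) N = hdim (mp_P1 q) N.
Proof.
have [a b] := min_presentation_le N p q; have [c d] := min_presentation_le N q p.
by split; apply/eqP; rewrite eqn_leq ?a ?b ?c ?d.
Qed.
End LongSchanuel.

(** * The Auslander-Reiten formula for D Hom(M, tau M) *)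

Section TauFormula.
Variables (k : fieldType) (A : fdAlgebraType k).
Implicit Types M N P : lmodule A.

(** The dual basis of a projective module replaces the natural isomorphism of
    Hom(P, A) (x) M with Hom(P, M). *)
Lemma dual_basis P : projective P ->
  exists n (f : 'I_n -> lhom P (lreg A)) (x : 'I_n -> P),
    forall y, y = \sum_i lact P (f i y : A) (x i).
Proof.
move=> pP; have [s sE] := proj_section pP (free_cover_surj P).
have ex i : exists f : lhom P (lreg A), forall y, f y = (s y : {ffun _ -> A}) i.
  apply: (@linear_lhom _ _ P (lreg A)).
    by move=> c x y; rewrite linearP !ffunE.
  by move=> a x; rewrite lhomE free_lactE lreg_lactE.
have [f fE] := choice ex; exists _, f, (fun i => (vbasis {:P})`_i) => y.
by rewrite -[LHS]sE free_liftE; apply: eq_bigr => i _; rewrite fE.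
Qed.

Definition orbit_fun M (m : M) : lreg A -> M := fun a => lact M (a : A) m.
Fact orbit_fun_lin M (m : M) : linear (orbit_fun m).
Proof. by move=> c x y; rewrite /orbit_fun lactP. Qed.
HB.instance Definition _ M (m : M) :=
  GRing.isLinear.Build k (lreg A) M *:%R (orbit_fun m) (orbit_fun_lin m).
Definition orbit_map M (m : M) : lhom (lreg A) M := mk_lhom (linfun (orbit_fun m)).

Lemma orbit_mapE M (m : M) a : orbit_map m a = lact M (a : A) m.
Proof.
rewrite /orbit_map mk_lhomE ?lfunE // => b x.
rewrite [LHS]lfunE [X in _ = lact _ _ X]lfunE /= /orbit_fun -lactME.
by rewrite -lreg_lactE.
Qed.

Lemma dim_hom_dual (V : vectType k) : \dim {: 'Hom(V, k^o)} = \dim {:V}.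
Proof. by rewrite !dimvf /dim /= muln1. Qed.

Section Presentation.
Variables (M : lmodule A) (p : min_presentation M).
Local Notation P0 := (mp_P0 p).
Local Notation P1 := (mp_P1 p).
Local Notation U := (limg (star_d1 p)).
Local Notation W := (limg (precomp (mp_d1 p) M)).

Let tval (phi : tau_of p) : 'Hom(vquot U, k^o) := phi.

Let tval_act a phi (f : star P1) :
  tval (lact (tau_of p) a phi) (vpi U f) = tval phi (vpi U (ract (star P1) a f)).
Proof. by rewrite /tval dual_lactE comp_lfunE rquot_ractE. Qed.

(** A functional phi on coker(Hom(P0, M) -> Hom(P1, M)) gives the map
    m |-> (f |-> phi(x |-> f(x) m)) from M to the dual of the transpose of M. It
    determines phi because the maps x |-> f(x) m span Hom(P1, M). *)
Lemma dim_hom_tau_ge : (\dim {: vquot W} <= hdim M (tau_of p))%N.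
Proof.
rewrite -dim_hom_dual.
have ex (phi : 'Hom(vquot W, k^o)) : exists b : lhom M (tau_of p), forall m (f : lhom P1 (lreg A)),
    tval (b m) (vpi U f) = phi (vpi W (lhom_comp (orbit_map m) f)).
  have exm m : exists b : 'Hom(vquot U, k^o), forall f : lhom P1 (lreg A),
      b (vpi U f) = phi (vpi W (lhom_comp (orbit_map m) f)).
    have [|g gE] := @linear_lfun _ (lhom P1 (lreg A)) k^o
        (fun f => phi (vpi W (lhom_comp (orbit_map m) f))).
      move=> c f g; rewrite -linearP -linearP; congr (phi (vpi W _)); apply: lhom_inj => x.
      by rewrite lhom_compE !lhom_linE !lhom_compE linearP.
    have [|b bE] := @vquot_lift _ _ _ U g; last by exists b => f; rewrite bE gE.
    apply/subvP => _ /memv_imgP[f _ ->]; rewrite memv_ker gE.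
    set h := lhom_comp _ _; have -> : h = precomp (mp_d1 p) M (lhom_comp (orbit_map m) f).
      by apply: lhom_inj => x; rewrite precompE !lhom_compE star_d1E.
    set v := precomp _ _ _; have /eqP -> : vpi W v == 0 by rewrite vpi_eq0 memv_img ?memvf.
    by rewrite linear0.
  have [b bE] := choice exm.
  have ext (u v : 'Hom(vquot U, k^o)) : (forall f, u (vpi U f) = v (vpi U f)) -> u = v.
    by move=> uv; apply/lfunP => y; have [x <-] := vpi_ex y.
  have [||B BE] := @linear_lhom _ _ M (tau_of p) b.
  - move=> c x y; apply: ext => f; rewrite add_lfunE scale_lfunE !bE.
    have -> : lhom_comp (orbit_map (c *: x + y)) f =
        c *: lhom_comp (orbit_map x) f + lhom_comp (orbit_map y) f.
      by apply: lhom_inj => z; rewrite lhom_linE !lhom_compE !orbit_mapE linearP.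
    by rewrite !linearP.
  - move=> a x; apply: ext => f; rewrite -[RHS]/(tval _ _) tval_act /tval !bE.
    congr (phi (vpi W _)); apply: lhom_inj => z.
    by rewrite !lhom_compE !orbit_mapE star_ractE lactME.
  by exists B => m f; rewrite BE -bE.
have [Psi PsiE] := choice ex.
apply: (@dim_inj _ _ _ Psi).
  move=> c u v; apply: lhom_inj => m; apply/lfunP => y; have [f <-] := vpi_ex y.
  rewrite lhom_linE -[LHS]/(tval _ _) PsiE !add_lfunE !scale_lfunE.
  by rewrite -[Psi u m]/(tval _) -[Psi v m]/(tval _) !PsiE.
move=> phi phi0; apply/lfunP => y; have [g <-] := vpi_ex y.
have [n [f [x dx]]] := dual_basis (@mp_proj1 _ _ _ p).
have -> : g = \sum_j lhom_comp (orbit_map ((g : lhom P1 M) (x j))) (f j).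
  apply: lhom_inj => z; rewrite (raddf_sum (@lhom_fun _ _ P1 M)) sum_lfunE {1}[z]dx linear_sum.
  by apply: eq_bigr => j _; rewrite lhom_compE orbit_mapE /= lhomE.
rewrite zero_lfunE !linear_sum; apply: big1 => j _ /=.
by rewrite -PsiE phi0 /tval !zero_lfunE.
Qed.

(** Conversely, b : M -> tau M gives the functional
    g |-> sum_j b(g(x_j))(f_j), where (f_j, x_j) is a dual basis of P1. A dual
    basis of P0 shows that it vanishes on the maps that factor through d1. *)
Lemma dim_hom_tau_le : (hdim M (tau_of p) <= \dim {: vquot W})%N.
Proof.
rewrite -dim_hom_dual.
have [n [f [x dx]]] := dual_basis (@mp_proj1 _ _ _ p).
have [n0 [h [z dz]]] := dual_basis (@mp_proj0 _ _ _ p).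
(* Scalars move from the argument in M to the one in Hom(P1, A); with
   reconstruction on the dual basis this makes the functional well defined. *)
have bal (b : lhom M (tau_of p)) a m (g : lhom P1 (lreg A)) :
    tval (b (lact M a m)) (vpi U g) = tval (b m) (vpi U (ract (star P1) a g)).
  by rewrite lhomE tval_act.
have rec (g : lhom P1 (lreg A)) : \sum_j ract (star P1) (g (x j)) (f j) = g.
  apply: lhom_inj => y; rewrite (raddf_sum (@lhom_fun _ _ P1 (lreg A))) sum_lfunE [y in RHS]dx linear_sum.
  apply: eq_bigr => j _; rewrite star_ractE.
  by have := lhomE g (f j y) (x j); rewrite lreg_lactE => <-.
have ex (b : lhom M (tau_of p)) : exists phi : 'Hom(vquot W, k^o), forall g : lhom P1 M,
    phi (vpi W g) = \sum_j tval (b (g (x j))) (vpi U (f j)).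
  have [|phi phiE] := @linear_lfun _ (lhom P1 M) k^o
      (fun g => \sum_j tval (b ((g : lhom P1 M) (x j))) (vpi U (f j))).
    move=> c u v; rewrite scaler_sumr -big_split; apply: eq_bigr => j _ /=.
    by rewrite lhom_linE linearP /= /tval add_lfunE scale_lfunE.
  have [|psi psiE] := @vquot_lift _ _ _ W phi; last by exists psi => g; rewrite psiE phiE.
  apply/subvP => _ /memv_imgP[g _ ->]; rewrite memv_ker phiE.
  have E j : tval (b ((precomp (mp_d1 p) M g : lhom P1 M) (x j))) (vpi U (f j)) =
      \sum_l tval (b ((g : lhom P0 M) (z l)))
        (vpi U (ract (star P1) (h l (mp_d1 p (x j))) (f j))).
    rewrite precompE [in LHS](dz (mp_d1 p (x j))) !linear_sum /tval sum_lfunE.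
    by apply: eq_bigr => l _; rewrite -bal -lhomE.
  rewrite (eq_bigr _ (fun j _ => E j)) exchange_big /=; apply/eqP/big1 => l _.
  rewrite -linear_sum -linear_sum /=.
  have -> : \sum_j ract (star P1) (h l (mp_d1 p (x j))) (f j) = star_d1 p (h l).
    by rewrite -[RHS]rec; apply: eq_bigr => j _; rewrite star_d1E.
  set v := star_d1 p _; have /eqP -> : vpi U v == 0 by rewrite vpi_eq0 memv_img ?memvf.
  by rewrite linear0.
have [Phi PhiE] := choice ex.
apply: (@dim_inj _ _ _ Phi).
  move=> c u v; apply/lfunP => y; have [g <-] := vpi_ex y.
  rewrite PhiE add_lfunE scale_lfunE !PhiE scaler_sumr -big_split; apply: eq_bigr => j _.
  by rewrite lhom_linE /tval add_lfunE scale_lfunE.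
move=> b b0; apply: lhom_inj => m; apply/lfunP => y; have [g <-] := vpi_ex y.
rewrite -[LHS]/(tval _ _) !zero_lfunE -[g]rec !linear_sum.
transitivity (Phi b (vpi W (lhom_comp (orbit_map m) g))); last by rewrite b0 zero_lfunE.
by rewrite PhiE; apply: eq_bigr => j _; rewrite lhom_compE orbit_mapE bal.
Qed.

Lemma dim_hom_tau :
  (hdim M (tau_of p) + hdim P0 M = hdim P1 M + hdim M M)%N.
Proof.
have -> : hdim M (tau_of p) = \dim {: vquot W}.
  by apply/eqP; rewrite eqn_leq dim_hom_tau_ge dim_hom_tau_le.
rewrite -(rank_precomp M (mp_surj p) (mp_exact p)) addnA.
by rewrite dim_vquot.
Qed.
End Presentation.
End TauFormula.

(** * Projective modules with idempotent generators *)

Section IdempotentProjective.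
Variables (k : fieldType) (A : fdAlgebraType k) (J : finType) (eps : J -> A).
Hypothesis idem : forall j, eps j *a eps j = eps j.
Local Notation F := (free_module A #|J|).
Local Notation FA := {ffun 'I_#|J| -> A}.

Definition idem_endo : lhom F F :=
  free_lift (M := F)
    (fun i => [ffun j => if i == j then eps (enum_val i) else 0] : FA).

Lemma idem_endoE (x : F) i : (idem_endo x : FA) i = (x : FA) i *a eps (enum_val i).
Proof.
rewrite /idem_endo free_liftE sum_ffunE (bigD1 i) //= free_lactE ffunE eqxx.
rewrite big1 ?addr0 // => j /negPf ji.
by rewrite free_lactE ffunE ji amulx0.
Qed.

(** The direct sum of the left ideals A eps_j, as the image of the idempotent
    endomorphism of a free module given by right multiplication by eps. *)
Definition idem_mod : lmodule A := lsub (limg_submodule idem_endo).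
Definition idem_incl : lhom idem_mod F := lincl (limg_submodule idem_endo).

Let idem_incl_inj : injective idem_incl.
Proof. exact/lker0_inj/lincl_inj. Qed.

Definition icoord (j : J) (x : idem_mod) : A := (idem_incl x : FA) (enum_rank j).

Fact icoord_lin j : linear (icoord j).
Proof. by move=> c x y; rewrite /icoord linearP !ffunE. Qed.
HB.instance Definition _ j :=
  GRing.isLinear.Build k idem_mod A *:%R (icoord j) (icoord_lin j).

Lemma icoord_lact j a x : icoord j (lact idem_mod a x) = a *a icoord j x.
Proof. by rewrite /icoord lhomE free_lactE. Qed.

Lemma icoord_idem j x : icoord j x *a eps j = icoord j x.
Proof.
have : idem_incl x \in limg idem_endo by rewrite linclE subvsP.
rewrite /icoord => /memv_imgP[y _ ->].
by rewrite idem_endoE enum_rankK -amulA idem.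
Qed.

Lemma icoord_inj x y : (forall j, icoord j x = icoord j y) -> x = y.
Proof.
move=> xy; apply/idem_incl_inj/ffunP => i.
by have := xy (enum_val i); rewrite /icoord enum_valK.
Qed.

Fact idem_proj_exists : exists r : lhom F idem_mod, forall x, idem_incl (r x) = idem_endo x.
Proof. by apply: lhom_lift; [exact: lincl_inj | rewrite limg_lincl]. Qed.

Definition idem_proj : lhom F idem_mod := projT1 (cid idem_proj_exists).
Let idem_projE x : idem_incl (idem_proj x) = idem_endo x.
Proof. by rewrite /idem_proj; case: cid. Qed.

Definition igen (j : J) : idem_mod := idem_proj (free_gen A (enum_rank j)).

Lemma icoord_gen i j : icoord i (igen j) = if j == i then eps i else 0.
Proof.
rewrite /icoord idem_projE idem_endoE ffunE (inj_eq enum_rank_inj) enum_rankK.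
by case: eqP => _; rewrite ?amul1x ?amul0x.
Qed.

Lemma idem_mod_sum x : x = \sum_j lact idem_mod (icoord j x) (igen j).
Proof.
apply: icoord_inj => i; rewrite linear_sum (bigD1 i) //= icoord_lact icoord_gen eqxx.
rewrite icoord_idem big1 ?addr0 // => j /negPf ji.
by rewrite icoord_lact icoord_gen ji amulx0.
Qed.

Lemma igen_idem j : lact idem_mod (eps j) (igen j) = igen j.
Proof.
apply: icoord_inj => i; rewrite icoord_lact icoord_gen.
by case: eqP => [->|_]; rewrite ?idem ?amulx0.
Qed.

Lemma idem_projective : projective idem_mod.
Proof.
apply: (@proj_retract _ _ F _ idem_incl idem_proj); last exact: free_projective.
move=> x; apply: icoord_inj => j.
by rewrite {1}/icoord idem_projE idem_endoE enum_rankK icoord_idem.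
Qed.

Definition ilift_fun (N : lmodule A) (m : J -> N) : idem_mod -> N :=
  fun x => \sum_j lact N (icoord j x) (m j).
Fact ilift_lin (N : lmodule A) (m : J -> N) : linear (ilift_fun m).
Proof.
move=> c x y; rewrite /ilift_fun scaler_sumr -big_split; apply: eq_bigr => j _ /=.
by rewrite linearP lactP.
Qed.
HB.instance Definition _ (N : lmodule A) (m : J -> N) :=
  GRing.isLinear.Build k idem_mod N *:%R (ilift_fun m) (ilift_lin m).
Definition ilift (N : lmodule A) (m : J -> N) : lhom idem_mod N := mk_lhom (linfun (ilift_fun m)).

Lemma iliftE (N : lmodule A) (m : J -> N) x : ilift m x = \sum_j lact N (icoord j x) (m j).
Proof.
rewrite /ilift mk_lhomE ?lfunE // => a y; rewrite [LHS]lfunE [X in _ = lact _ _ X]lfunE.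
rewrite -[LHS]/(ilift_fun m _) -[X in _ = lact _ _ X]/(ilift_fun m y) /ilift_fun linear_sum.
by apply: eq_bigr => j _; rewrite icoord_lact lactME.
Qed.

(** Hom(A eps, N) = eps N: the value at the generator is the component of m j in
    eps_j N. *)
Lemma ilift_gen (N : lmodule A) (m : J -> N) j : ilift m (igen j) = lact N (eps j) (m j).
Proof.
rewrite iliftE (bigD1 j) //= icoord_gen eqxx big1 ?addr0 // => i /negPf ij.
by rewrite icoord_gen eq_sym ij lact0.
Qed.
End IdempotentProjective.

Section Superfluous.
Variables (k : fieldType) (A : fdAlgebraType k) (P : lmodule A).

Definition act_span (S : {vspace A}) : {vspace P} :=
  vspan (fun z => exists a x, a \in S /\ z = lact P a x).

Lemma mem_act_span (S : {vspace A}) a x : a \in S -> lact P a x \in act_span S.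
Proof. by move=> Sa; apply: mem_vspan; exists a, x. Qed.

(** Nakayama's lemma for a nilpotent filtration J of A: from W + J_1 P = P one
    gets J_m P in W + J_(m+1) P for all m, hence P = W. A filtration is easier
    to bound than the powers of a radical. *)
Lemma superfluous_filtered (J : nat -> {vspace A}) n (U : {vspace P}) :
  J 0 = fullv -> J n = 0%VS ->
  (forall m a b, a \in J m -> b \in J 1 -> a *a b \in J m.+1) ->
  (U <= act_span (J 1))%VS -> superfluous U.
Proof.
move=> J0 Jn JM UJ W sW WU.
(* x = w + u with u in J_1 P turns J_m x into W + J_m J_1 P. *)
have step m : (act_span (J m) <= W + act_span (J m.+1))%VS.
  apply: vspan_min => _ [a [x [Ja ->]]].
  have /memv_addP[w Ww [u Uu ->]] : x \in (W + U)%VS by rewrite WU memvf.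
  rewrite linearD memv_add //; first exact: sW.
  suff sub : (act_span (J 1) <= lact P a @^-1: act_span (J m.+1))%VS.
    by rewrite memv_preim (subvP sub) ?(subvP UJ).
  apply: vspan_min => _ [b [y [Jb ->]]].
  by rewrite -memv_preim -lactME mem_act_span ?JM.
have all m : (W + act_span (J m))%VS = fullv.
  elim: m => [|m IHm]; apply/eqP; rewrite eqEsubv subvf.
    apply/subvP => x _; rewrite -[x](lact1E x) (subvP (addvSr _ _)) //.
    by rewrite mem_act_span ?J0 ?memvf.
  by rewrite -IHm subv_add addvSl step.
apply/eqP; rewrite -(all n) eqEsubv addvSl subv_add subvv /=.
by apply: vspan_min => _ [a [x [Ja ->]]]; move: Ja; rewrite Jn memv0 => /eqP ->; rewrite lact0 mem0v.
Qed.
End Superfluous.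

Section EnvBilinear.
Variables (k : fieldType) (L : fdAlgebraType k) (V : lmodType k).
Variable beta : L -> L -> V.
Hypothesis betal : forall b, linear (beta ^~ b).
Hypothesis betar : forall a, linear (beta a).
Local Notation n := (\dim {:L}).
Local Notation bas i := ((vbasis {:L})`_i).

Definition env_bilin (x : env L) : V :=
  \sum_(i < n) \sum_(j < n) (x : 'M[k]_n) i j *: beta (bas i) (bas j).

Fact env_bilin_lin : linear env_bilin.
Proof.
move=> c x y; rewrite /env_bilin scaler_sumr -big_split; apply: eq_bigr => i _ /=.
rewrite scaler_sumr -big_split; apply: eq_bigr => j _ /=.
by rewrite !mxE scalerDl scalerA.
Qed.
HB.instance Definition _ := GRing.isLinear.Build k (env L) V *:%R env_bilin env_bilin_lin.

Lemma env_bilin_pure a b : env_bilin (pure a b) = beta a b.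
Proof.
pose bl b : {linear L -> V} := HB.pack (beta ^~ b) (GRing.isLinear.Build k L V *:%R (beta ^~ b) (betal b)).
pose br a : {linear L -> V} := HB.pack (beta a) (GRing.isLinear.Build k L V *:%R (beta a) (betar a)).
transitivity (bl b (\sum_i coord (vbasis {:L}) i a *: bas i)); last by rewrite /= -coo_sum.
rewrite linear_sum; apply: eq_bigr => i _; rewrite linearZ.
transitivity (coord (vbasis {:L}) i a *: br (bas i) (\sum_j coord (vbasis {:L}) j b *: bas j));
  last by rewrite /= -coo_sum.
rewrite linear_sum scaler_sumr.
by apply: eq_bigr => j _; rewrite linearZ mxE scalerA.
Qed.
End EnvBilinear.

(** * Modules over the enveloping algebra *)

Section SidedActions.
Variables (k : fieldType) (L : fdAlgebraType k).
Implicit Types (P N : lmodule (env L)) (l r : L).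

(** The two sides of an L^e-module seen as a bimodule. Both take the scalar
    first, so that they can be used as linear maps. *)
Definition actl P l (x : P) : P := lact P (pure l aone) x.
Definition actr P r (x : P) : P := lact P (pure aone r) x.

HB.instance Definition _ P l := GRing.Linear.copy (@actl P l) (lact P (pure l aone)).
HB.instance Definition _ P r := GRing.Linear.copy (@actr P r) (lact P (pure aone r)).

Lemma actlP P c l l' (x : P) : actl (c *: l + l') x = c *: actl l x + actl l' x.
Proof. by rewrite /actl -lactP; congr (lact P _ x); exact: (linearP (pure_l aone)). Qed.
Lemma actrP P c r r' (x : P) : actr (c *: r + r') x = c *: actr r x + actr r' x.
Proof. by rewrite /actr -lactP; congr (lact P _ x); exact: (linearP (pure aone)). Qed.

Lemma actl0 P (x : P) : actl 0 x = 0.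
Proof. by have := actlP (-1) 0 0 x; rewrite scaler0 addr0 scaleN1r addNr. Qed.
Lemma actr0 P (x : P) : actr 0 x = 0.
Proof. by have := actrP (-1) 0 0 x; rewrite scaler0 addr0 scaleN1r addNr. Qed.
Lemma actl1 P (x : P) : actl aone x = x. Proof. exact: lact1E. Qed.
Lemma actr1 P (x : P) : actr aone x = x. Proof. exact: lact1E. Qed.
Lemma actlM P l l' (x : P) : actl (l *a l') x = actl l (actl l' x).
Proof. by rewrite /actl -lactME pureM amul1x. Qed.
Lemma actrM P r r' (x : P) : actr (r *a r') x = actr r' (actr r x).
Proof. by rewrite /actr -lactME pureM amul1x. Qed.
Lemma actlr P l r (x : P) : actl l (actr r x) = lact P (pure l r) x.
Proof. by rewrite /actl /actr -lactME pureM amulx1 amulx1. Qed.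
Lemma actrl P l r (x : P) : actr r (actl l x) = actl l (actr r x).
Proof. by rewrite actlr /actl /actr -lactME pureM !amul1x. Qed.

Lemma actrPr P c r (x y : P) : actr r (c *: x + y) = c *: actr r x + actr r y.
Proof. exact: linearP. Qed.
Lemma actrDr P r (x y : P) : actr r (x + y) = actr r x + actr r y.
Proof. exact: linearD. Qed.
Lemma actlBr P l (x y : P) : actl l (x - y) = actl l x - actl l y.
Proof. exact: linearB. Qed.
Lemma actrBr P r (x y : P) : actr r (x - y) = actr r x - actr r y.
Proof. exact: linearB. Qed.
Lemma actl0r P l : actl l (0 : P) = 0. Proof. exact: linear0. Qed.
Lemma actr0r P r : actr r (0 : P) = 0. Proof. exact: linear0. Qed.
Lemma actl_sumr P l I (s : seq I) (F : I -> P) :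
  actl l (\sum_(i <- s) F i) = \sum_(i <- s) actl l (F i).
Proof. exact: linear_sum. Qed.
Lemma actr_sumr P r I (s : seq I) (F : I -> P) :
  actr r (\sum_(i <- s) F i) = \sum_(i <- s) actr r (F i).
Proof. exact: linear_sum. Qed.

Lemma lhom_actl P N (f : lhom P N) l x : f (actl l x) = actl l (f x).
Proof. exact: lhomE. Qed.
Lemma lhom_actr P N (f : lhom P N) l x : f (actr l x) = actr l (f x).
Proof. exact: lhomE. Qed.

Lemma reg_actl l (x : reg_env L) : actl l x = l *a (x : L).
Proof. by rewrite /actl env_module_pure bract1 id_lfunE reg_blactE. Qed.
Lemma reg_actr r (x : reg_env L) : actr r x = (x : L) *a r.
Proof. by rewrite /actr env_module_pure blact1 id_lfunE reg_bractE. Qed.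

Lemma sided_equivariant P N (f : 'Hom(P, N)) :
  (forall l x, f (actl l x) = actl l (f x)) -> (forall r x, f (actr r x) = actr r (f x)) ->
  equivariant f.
Proof.
move=> fl fr a x; elim/env_ind: a => [c a b Ha Hb||l r].
- by rewrite !lactP -Ha -Hb linearP.
- by rewrite !lact0 linear0.
by rewrite -!actlr fl fr.
Qed.

Section IdempotentPairs.
Variables (J : finType) (p q : J -> L).
Hypothesis pp : forall j, p j *a p j = p j.
Hypothesis qq : forall j, q j *a q j = q j.
Let eps j : env L := pure (p j) (q j).

Lemma pair_idem j : eps j *a eps j = eps j.
Proof. by rewrite /eps pureM pp qq. Qed.

Lemma actl_gen j : actl (p j) (igen eps j) = igen eps j.
Proof. by rewrite -{1}(igen_idem pair_idem j) /actl -lactME pureM pp amulx1 igen_idem // => i; apply: pair_idem. Qed.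
Lemma actr_gen j : actr (q j) (igen eps j) = igen eps j.
Proof. by rewrite -{1}(igen_idem pair_idem j) /actr -lactME pureM qq amul1x igen_idem // => i; apply: pair_idem. Qed.

Lemma pair_ind (S : idem_mod eps -> Prop) :
  (forall c x y, S x -> S y -> S (c *: x + y)) -> S 0 ->
  (forall l r j, S (actl l (actr r (igen eps j)))) -> forall x, S x.
Proof.
move=> Slin S0 Sg x; rewrite [x](idem_mod_sum pair_idem).
have SD u v : S u -> S v -> S (u + v).
  by move=> Su Sv; rewrite -[u]scale1r; apply: Slin.
apply: big_ind => // j _; elim/env_ind: (icoord j x) => [c a b Sa Sb||l r].
- by rewrite lactP; apply: Slin.
- by rewrite lact0.
by rewrite -actlr.
Qed.

(** The carrier of idem_mod is (L p_j) (x) (q_j L) summed over j; this is its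
    universal property for k-bilinear maps, used for maps that respect neither
    side of the bimodule structure or only one of them. *)
Lemma pair_bilin (V : lmodType k) (beta : J -> L -> L -> V) :
  (forall j b, linear ((beta j) ^~ b)) -> (forall j a, linear (beta j a)) ->
  exists f : {linear idem_mod eps -> V}, forall l r j,
    f (actl l (actr r (igen eps j))) = beta j (l *a p j) (q j *a r).
Proof.
move=> bl br; pose f (x : idem_mod eps) := \sum_j env_bilin (beta j) (icoord j x).
have flin : linear f.
  move=> c x y; rewrite /f scaler_sumr -big_split; apply: eq_bigr => j _ /=.
  by rewrite !linearP.
pose g : {linear idem_mod eps -> V} := HB.pack f (GRing.isLinear.Build k _ V *:%R f flin).
exists g => l r j /=.
rewrite /f (bigD1 j) //= big1 => [|i /negPf ij].
  by rewrite actlr icoord_lact icoord_gen eqxx pureM env_bilin_pure ?addr0.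
by rewrite actlr icoord_lact icoord_gen eq_sym ij amulx0 linear0.
Qed.
End IdempotentPairs.
End SidedActions.

(** * Induction on paths and powers of the arrow ideal *)

Section PathAlgebraInduction.
Variables (k : fieldType) (Q : quiver).
Local Notation kQ := (path_algebra k Q).
Local Notation e i := (pbasis k (path0 i)).
Local Notation al a := (pbasis k (path1 a)).

Lemma path_cons x a (s : seq (arrow Q)) (ch : chain x (a :: s)) (ch' : chain (tgt a) s) :
  pbasis k (@QPath Q (x, a :: s) ch) = pbasis k (@QPath Q (tgt a, s) ch') *a al a.
Proof.
rewrite pbasisM; case: (pcompP (@QPath Q (tgt a, s) ch') (path1 a)) => [r e s' a' _|].
  congr pbasis; apply: qpath_inj; rewrite ?s' ?a' //.
  by have /andP[/eqP sa _] := ch; rewrite /pstart /= sa.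
by rewrite /pend /pstart /= eqxx.
Qed.

Lemma path_algebra_ind (S : kQ -> Prop) :
  (forall c x y, S x -> S y -> S (c *: x + y)) -> S 0 ->
  (forall i, S (e i)) -> (forall x a, S x -> S (x *a al a)) -> forall x, S x.
Proof.
move=> Slin S0 Se Sa; apply: pbasis_ind => // -[[x s] ch].
elim: s x ch => [|a s IHs] x ch.
  by have -> : @QPath Q (x, [::]) ch = path0 x by apply: qpath_inj.
have ch' : chain (tgt a) s by move: ch => /= /andP[].
by rewrite (path_cons ch ch'); apply/Sa/IHs.
Qed.

Lemma e_mul (i j : vertex Q) : e i *a e j = if i == j then e i else 0.
Proof. by rewrite pbasisM pcomp_path0r /pstart /= eq_sym; case: eqP => [->|]. Qed.

Lemma e_tgt (a : arrow Q) : e (tgt a) *a al a = al a.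
Proof. by rewrite pbasisM pcomp_path0l /pend /= eqxx. Qed.
Lemma e_src (a : arrow Q) : al a *a e (src a) = al a.
Proof. by rewrite pbasisM pcomp_path0r /pstart /= eqxx. Qed.
Lemma e_sum : \sum_(i : vertex Q) e i = aone :> kQ. Proof. by []. Qed.

Lemma ideal_powD (F : ideal kQ) m n x y :
  ideal_pow F m x -> ideal_pow F n y -> ideal_pow F (m + n) (x *a y).
Proof.
elim: m n x y => [|m IHm] n x y; first by move=> _; apply: idealMl.
pose S z := forall y, ideal_pow F n y -> ideal_pow F (m.+1 + n) (z *a y).
have S0 : S 0 by move=> w _; rewrite amul0x; apply: smem0.
have SD u v : S u -> S v -> S (u + v).
  by move=> Su Sv w Fw; rewrite amulDx; apply: smemD; [apply: Su | apply: Sv].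
have SZ c u : S u -> S (c *: u).
  by move=> Su w Fw; rewrite amulZx; apply/smemZ/Su.
have Sl a u : S u -> S (a *a u).
  by move=> Su w Fw; rewrite -amulA; apply/idealMl/Su.
have Sr a u : S u -> S (u *a a).
  by move=> Su w Fw; rewrite -amulA; apply/Su/idealMl.
move=> Fx Fy; apply: (Fx (@Ideal _ _ (Subspace S0 SD SZ) Sl Sr)) Fy.
move=> _ [u [v [Fu Fv ->]]] w Fw; rewrite -amulA addSn.
by apply: mem_ideal_mul => //; apply: IHm.
Qed.

Lemma ideal_pow_le (F : ideal kQ) m n x : (m <= n)%N -> ideal_pow F n x -> ideal_pow F m x.
Proof.
move=> /subnK <-; elim: (n - m)%N x => [//|d IHd] x; rewrite addSn => Fx.
by apply: IHd; move: x Fx; apply: gen_ideal_min => _ [u [v [_ Fv ->]]]; apply: idealMl.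
Qed.
End PathAlgebraInduction.

(** * The bimodule presentation of a bound quiver algebra *)

Section BoundQuiver.
Variables (k : fieldType) (Q : quiver) (I : ideal (path_algebra k Q)).
Hypothesis admI : admissible I.
Local Notation kQ := (path_algebra k Q).
Local Notation L := (bound_quiver_algebra admI).
Local Notation M := (reg_env L).
Local Notation e i := (pbasis k (path0 i)).
Local Notation al a := (pbasis k (path1 a)).

Definition bqpi : kQ -> L := api (admissible_fc admI).
HB.instance Definition _ := GRing.Linear.on bqpi.

Lemma bqpi1 : bqpi aone = aone. Proof. exact: api1. Qed.
Lemma bqpiM x y : bqpi (x *a y) = bqpi x *a bqpi y. Proof. exact: apiM. Qed.
Lemma bqpi_ex (l : L) : exists x, bqpi x = l. Proof. by have [x ->] := apiP l; exists x. Qed.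
Lemma bqpi_eq0 x : bqpi x = 0 <-> I x. Proof. exact: api_eq0. Qed.

Lemma bqpiP c x y : bqpi (c *: x + y) = c *: bqpi x + bqpi y.
Proof. exact: linearP. Qed.
Lemma bqpiB x y : bqpi (x - y) = bqpi x - bqpi y. Proof. exact: linearB. Qed.
Lemma bqpi0 : bqpi 0 = 0. Proof. exact: linear0. Qed.

Definition vt i : L := bqpi (e i).
Definition ar a : L := bqpi (al a).

Lemma vt_mul i j : vt i *a vt j = if i == j then vt i else 0.
Proof. by rewrite -bqpiM e_mul; case: eqP => // _; rewrite linear0. Qed.
Lemma vt_idem i : vt i *a vt i = vt i. Proof. by rewrite vt_mul eqxx. Qed.
Lemma vt_tgt a : vt (tgt a) *a ar a = ar a. Proof. by rewrite -bqpiM e_tgt. Qed.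
Lemma vt_src a : ar a *a vt (src a) = ar a. Proof. by rewrite -bqpiM e_src. Qed.
Lemma vt_sum : \sum_(i : vertex Q) vt i = aone. Proof. by rewrite -bqpi1 -(e_sum k Q) linear_sum. Qed.

(** proj0 is L (x)_E L and proj1 is L (x)_E kQ_1 (x)_E L, where E is the span of
    the vertices: the summands L e_i (x) e_i L and L e_(tgt a) (x) e_(src a) L are
    generated by the idempotents of L^e below. *)
Definition eps0 i : env L := pure (vt i) (vt i).
Definition eps1 a : env L := pure (vt (tgt a)) (vt (src a)).
Definition proj0 : lmodule (env L) := idem_mod eps0.
Definition proj1 : lmodule (env L) := idem_mod eps1.
(* Unfolding the carriers would hide the module structure from rewriting. *)
Arguments proj0 : simpl never.
Arguments proj1 : simpl never.
Definition g0 i : proj0 := igen eps0 i.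
Definition g1 a : proj1 := igen eps1 a.

Lemma actl_g1 a : actl (vt (tgt a)) (g1 a) = g1 a.
Proof. by apply: (actl_gen (p := fun a => vt (tgt a)) (q := fun a => vt (src a))) => b; rewrite vt_idem. Qed.
Lemma actr_g1 a : actr (vt (src a)) (g1 a) = g1 a.
Proof. by apply: (actr_gen (p := fun a => vt (tgt a)) (q := fun a => vt (src a))) => b; rewrite vt_idem. Qed.
Lemma actl_g1_if i a : actl (vt i) (g1 a) = if i == tgt a then g1 a else 0.
Proof. by rewrite -actl_g1 -actlM vt_mul; case: eqP => [->|_]; rewrite ?actl_g1 ?actl0. Qed.
Lemma actl_g0 i j : actl (vt i) (g0 j) = if i == j then g0 j else 0.
Proof.
have g0E : actl (vt j) (g0 j) = g0 j by apply: (actl_gen (p := vt) (q := vt)) => b; rewrite vt_idem.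
by rewrite -{1}g0E -actlM vt_mul; case: eqP => [->//|_]; rewrite actl0.
Qed.
Lemma actr_g0 i j : actr (vt i) (g0 j) = if i == j then g0 j else 0.
Proof.
have g0E : actr (vt j) (g0 j) = g0 j by apply: (actr_gen (p := vt) (q := vt)) => b; rewrite vt_idem.
by rewrite -{1}g0E -actrM vt_mul eq_sym; case: eqP => _; rewrite ?g0E ?actr0.
Qed.

Section Derivation.
(** The arrows of a path are listed from its source, so that the head of the
    list is the rightmost factor of the product. *)
Fixpoint word (s : seq (arrow Q)) : L := if s is a :: s' then word s' *a ar a else aone.
Fixpoint dword (s : seq (arrow Q)) : proj1 :=
  if s is a :: s' then actl (word s') (g1 a) + actr (ar a) (dword s') else 0.

(** The universal E-derivation: a path goes to the sum, over its decompositions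
    u a v, of u (x) a (x) v. *)
Definition udiff : kQ -> proj1 := lext (fun p => dword (parrows p)).
HB.instance Definition _ := GRing.Linear.on udiff.

Lemma udiffP c x y : udiff (c *: x + y) = c *: udiff x + udiff y.
Proof. exact: linearP. Qed.
Lemma udiffB x y : udiff (x - y) = udiff x - udiff y. Proof. exact: linearB. Qed.
Lemma udiff0 : udiff 0 = 0. Proof. exact: linear0. Qed.

Lemma bqpi_path p : bqpi (pbasis k p) = word (parrows p) *a vt (pstart p).
Proof.
case: p => -[x s] ch; elim: s x ch => [|a s IHs] x ch.
  have -> : @QPath Q (x, [::]) ch = path0 x by apply: qpath_inj.
  by rewrite /= amul1x.
have ch' : chain (tgt a) s by move: ch => /= /andP[].
rewrite (path_cons k ch ch') bqpiM IHs /parrows /pstart /= -!amulA vt_tgt.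
by have /= /andP[/eqP <- _] := ch; rewrite vt_src.
Qed.

Lemma dword_start x s : chain x s -> actr (vt x) (dword s) = dword s.
Proof.
case: s => [|a s] /=; first by rewrite linear0.
move=> /andP[/eqP <- _]; rewrite linearD /= actrl actr_g1; congr (_ + _).
by rewrite -actrM vt_src.
Qed.

Lemma udiff_e i : udiff (e i) = 0.
Proof. exact: lext_basis. Qed.

(** This rule and udiff_e characterize the derivation; everything below is deduced
    from them by induction on paths. *)
Lemma udiff_arrow x a : udiff (x *a al a) = actl (bqpi x) (g1 a) + actr (ar a) (udiff x).
Proof.
elim/pbasis_ind: x => [c x y Hx Hy||p].
- rewrite amul_linl !linearP /= Hx Hy actlP scalerDr addrACA; congr (_ + _).
- by rewrite amul0x !linear0 actl0 addr0.
rewrite pbasisM bqpi_path /udiff lext_basis actlM actl_g1_if.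
case: (pcompP p (path1 a)) => [r en s' a' _|ne]; last first.
  rewrite /= linear0; move: ne; rewrite /pend /= eq_sym => /negPf ne.
  rewrite ne linear0 add0r -[dword _](dword_start (valP p)) -actrM -vt_tgt amulA.
  by rewrite vt_mul ne amul0x actr0.
rewrite -[tgt a]/(pend (path1 a)) en eqxx.
by rewrite /= lext_basis a'.
Qed.

Lemma udiffM x y : udiff (x *a y) = actl (bqpi x) (udiff y) + actr (bqpi y) (udiff x).
Proof.
elim/path_algebra_ind: y => [c y z Hy Hz||i|y a Hy].
- rewrite amul_linr !linearP /= Hy Hz actrP scalerDr addrACA; congr (_ + _).
- by rewrite amulx0 !linear0 actr0 addr0.
- rewrite udiff_e linear0 add0r.
  elim/path_algebra_ind: x => [c x z Hx Hz||j|x a _].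
  + by rewrite amul_linl !linearP /= Hx Hz.
  + by rewrite amul0x !linear0.
  + by rewrite e_mul udiff_e linear0; case: eqP; rewrite ?udiff_e ?linear0.
  have alE : al a *a e i = if i == src a then al a else 0.
    by rewrite -{1}(e_src k a) -amulA e_mul eq_sym; case: eqP => _; rewrite ?e_src ?amulx0.
  have arE : ar a *a vt i = if i == src a then ar a else 0.
    by rewrite -bqpiM alE; case: eqP => //; rewrite linear0.
  rewrite -amulA alE udiff_arrow linearD /= actrl -actrM arE -actr_g1 -actrM vt_mul eq_sym.
  by case: eqP => _; rewrite ?udiff_arrow ?actr_g1 // amulx0 !actr0 !linear0 addr0.
rewrite amulA !udiff_arrow Hy bqpiM actlM !linearD /= actrl bqpiM actrM addrA; congr (_ + _ + _).
Qed.

Lemma udiff_ideal_square x : ideal_mul I I x -> udiff x = 0.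
Proof.
pose S z := I z /\ udiff z = 0.
have S0 : S 0 by split; [apply: smem0 | rewrite linear0].
have SD u v : S u -> S v -> S (u + v).
  by move=> [Iu Du] [Iv Dv]; split; [apply: smemD | rewrite linearD /= Du Dv addr0].
have SZ c u : S u -> S (c *: u).
  by move=> [Iu Du]; split; [apply: smemZ | rewrite linearZ /= Du scaler0].
have Sl a u : S u -> S (a *a u).
  move=> [Iu Du]; split; first exact: idealMl.
  by rewrite udiffM Du ((bqpi_eq0 u).2 Iu) actr0 linear0 addr0.
have Sr a u : S u -> S (u *a a).
  move=> [Iu Du]; split; first exact: Defs.idealMr.
  by rewrite udiffM Du ((bqpi_eq0 u).2 Iu) actl0 linear0 addr0.
move=> Ix; suff [] : S x by [].
apply: (Ix (@Ideal _ _ (Subspace S0 SD SZ) Sl Sr)) => _ [u [v [Iu Iv ->]]].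
split; first exact: idealMl.
by rewrite udiffM ((bqpi_eq0 u).2 Iu) ((bqpi_eq0 v).2 Iv) actl0 actr0 addr0.
Qed.
End Derivation.

Lemma proj0_ind (S : proj0 -> Prop) :
  (forall c x y, S x -> S y -> S (c *: x + y)) -> S 0 ->
  (forall l r i, S (actl l (actr r (g0 i)))) -> forall x, S x.
Proof. by apply: pair_ind => i; rewrite vt_idem. Qed.

Lemma proj1_ind (S : proj1 -> Prop) :
  (forall c x y, S x -> S y -> S (c *: x + y)) -> S 0 ->
  (forall l r a, S (actl l (actr r (g1 a)))) -> forall x, S x.
Proof. by apply: pair_ind => a; rewrite vt_idem. Qed.

Definition d0 : lhom proj0 M := ilift eps0 (N := M) vt.
Definition d1 : lhom proj1 proj0 :=
  ilift eps1 (fun a => actl (ar a) (g0 (src a)) - actr (ar a) (g0 (tgt a))).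

Lemma d0_gen i : d0 (g0 i) = vt i.
Proof. by rewrite /d0 ilift_gen -actlr reg_actl reg_actr !vt_idem. Qed.

Lemma d1_gen a : d1 (g1 a) = actl (ar a) (g0 (src a)) - actr (ar a) (g0 (tgt a)).
Proof.
rewrite /d1 ilift_gen -actlr actrBr actlBr actrl actr_g0 eqxx -actlM vt_tgt.
by rewrite -actrM vt_src -actrl actl_g0 eqxx.
Qed.

Lemma d0_pure l r i : d0 (actl l (actr r (g0 i))) = l *a vt i *a r.
Proof. by rewrite lhom_actl lhom_actr d0_gen reg_actl reg_actr amulA. Qed.

Lemma d0_surj : limg d0 = fullv.
Proof.
apply/limg_fullvP => l; exists (\sum_i actr l (g0 i)).
rewrite lhom_sum -[RHS](amul1x (l : L)) -vt_sum amul_suml; apply: eq_bigr => i _.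
by rewrite -[actr l _]actl1 d0_pure amul1x.
Qed.

(** The telescoping sum behind d1 (D x) = x (x) 1 - 1 (x) x; on I it says that D
    takes values in the kernel of d1. *)
Lemma d1_udiff x : d1 (udiff x) = \sum_i (actl (bqpi x) (g0 i) - actr (bqpi x) (g0 i)).
Proof.
elim/path_algebra_ind: x => [c x y Hx Hy||j|x a Hx].
- rewrite udiffP lhomP Hx Hy scaler_sumr -big_split; apply: eq_bigr => i _.
  by rewrite bqpiP actlP actrP opprD addrACA scalerBr.
- by rewrite udiff0 lhom0 big1 // => i _; rewrite bqpi0 actl0 actr0 subrr.
- rewrite udiff_e lhom0 big1 // => i _.
  by rewrite actl_g0 actr_g0 subrr.
rewrite udiff_arrow lhomD lhom_actl lhom_actr d1_gen Hx bqpiM actr_sumr.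
have El : \sum_i actl (ar a) (g0 i) = actl (ar a) (g0 (src a)).
  rewrite (bigD1 (src a)) //= big1 ?addr0 // => i /negPf ne.
  by rewrite -vt_src actlM actl_g0 eq_sym ne actl0r.
have Er : \sum_i actr (ar a) (g0 i) = actr (ar a) (g0 (tgt a)).
  rewrite (bigD1 (tgt a)) //= big1 ?addr0 // => i /negPf ne.
  by rewrite -vt_tgt actrM actr_g0 eq_sym ne actr0r.
rewrite actlBr -El -Er !actl_sumr -sumrB -big_split; apply: eq_bigr => i _.
by rewrite actrBr actrl actlM actrM /= addrA subrK.
Qed.

Lemma d1_udiff0 x : I x -> d1 (udiff x) = 0.
Proof.
move=> Ix; rewrite d1_udiff ((bqpi_eq0 x).2 Ix) big1 // => i _.
by rewrite actl0 actr0 subrr.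
Qed.

(** For x lifting l, d1 (D x) allows l to be moved across the tensor sign, so every
    u is congruent modulo the image of d1 to 1 (x) d0 u. *)
Lemma d1_exact : limg d1 = lker d0.
Proof.
apply/vspaceP => u; rewrite memv_ker; apply/memv_imgP/eqP => [[z _ ->]|du].
  elim/proj1_ind: z => [c x y Hx Hy||l r a]; first by rewrite !lhomP Hx Hy scaler0 addr0.
    by rewrite !lhom0.
  rewrite (lhom_actl d1) (lhom_actr d1) d1_gen (lhom_actl d0) (lhom_actr d0) lhomB.
  rewrite (lhom_actl d0) (lhom_actr d0) !d0_gen !reg_actl !reg_actr vt_src vt_tgt.
  by rewrite subrr amul0x amulx0.
(* The subtracted term, 1 (x) d0 u, vanishes for u in the kernel of d0. *)
suff [z zE] : exists z, d1 z = u - \sum_i actr (d0 u) (g0 i).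
  exists z; rewrite ?memvf // zE du big1 ?subr0 // => i _.
  exact: actr0.
elim/proj0_ind: u {du} => [c u w [x Hx] [y Hy]||l r i].
- exists (c *: x + y); rewrite !lhomP Hx Hy scalerBr scaler_sumr addrACA -opprD -big_split.
  by congr (_ - _); apply: eq_bigr => i _; rewrite actrP.
- by exists 0; rewrite !lhom0 big1 ?subr0 // => i _; rewrite actr0.
have [x xE] := bqpi_ex (l *a vt i); exists (actr r (udiff x)).
rewrite lhom_actr d1_udiff actr_sumr d0_pure xE.
under eq_bigr do rewrite actrBr.
rewrite sumrB; congr (_ - _); last by apply: eq_bigr => j _; rewrite -actrM.
rewrite (bigD1 i) //= big1 => [|j /negPf ne].
  by rewrite addr0 actlM actl_g0 eqxx actrl.
by rewrite actlM actl_g0 eq_sym ne actl0r actr0r.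
Qed.

(** The compatibility with the vertices on the right is obtained by cutting any
    linear section along them; it makes s send each path class to combinations of
    paths with the same source. *)
Lemma section_exists : exists s : {linear L -> kQ},
  (forall l, bqpi (s l) = l) /\ (forall l i, s (l *a vt i) = s l *a e i).
Proof.
have [b bE] := choice (fun i : 'I_(\dim {:L}) => bqpi_ex (vbasis {:L})`_i).
pose s0 (l : L) : kQ := \sum_i coord (vbasis {:L}) i l *: b i.
have s0lin : linear s0.
  move=> c x y; rewrite /s0 scaler_sumr -big_split; apply: eq_bigr => i _ /=.
  by rewrite linearP scalerDl scalerA.
have s0E l : bqpi (s0 l) = l.
  rewrite linear_sum [RHS](coord_vbasis (memvf l)); apply: eq_bigr => i _.
  by rewrite linearZ /= bE.
have s00 : s0 0 = 0 by rewrite /s0 big1 // => i _; rewrite linear0 scale0r.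
pose s (l : L) : kQ := \sum_j s0 (l *a vt j) *a e j.
have slin : linear s.
  move=> c x y; rewrite /s scaler_sumr -big_split; apply: eq_bigr => j _ /=.
  by rewrite amul_linl s0lin amul_linl.
pose g : {linear L -> kQ} := HB.pack s (GRing.isLinear.Build k L kQ *:%R s slin).
exists g; split=> [l|l i] /=; rewrite /s.
  rewrite linear_sum -[RHS](amulx1 l) -vt_sum amul_sumr; apply: eq_bigr => j _.
  by rewrite -[LHS]/(bqpi (_ *a _)) bqpiM s0E -amulA vt_idem.
rewrite amul_suml (bigD1 i) //= [RHS](bigD1 i) //= !big1 => [|j /negPf ne|j /negPf ne].
- by rewrite -!amulA vt_idem e_mul eqxx.
- by rewrite -amulA e_mul ne amulx0.
- by rewrite -amulA vt_mul eq_sym ne amulx0 s00 amul0x.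
Qed.

(** With s a linear section, t (l (x) y) = D (s l) y is a contracting homotopy
    modulo D(I): for z = l (x) a (x) y one has z - t (d1 z) = D (c) y, where
    c = s(l) a - s(l a) lies in I. *)
Lemma lker_d1_udiff z : d1 z = 0 -> exists2 x, I x & z = udiff x.
Proof.
have [s [sE sv]] := section_exists.
have [||t tE] := @pair_bilin _ _ _ vt vt _
  (fun _ l y => actr y (udiff (s l))).
- by move=> i y c l l'; rewrite !linearP.
- by move=> i l c y y'; rewrite actrP.
have tP c u w : t (c *: u + w) = c *: t u + t w by exact: linearP.
suff : exists2 x, I x & z = udiff x + t (d1 z).
  by move=> [x Ix Ez] dz; exists x; rewrite // {1}Ez dz linear0 addr0.
elim/proj1_ind: z => [c z w [x Ix Hx] [y Iy Hy]||l y a].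
- exists (c *: x + y); first by apply: smemD => //; apply: smemZ.
  by rewrite {1}Hx {1}Hy udiffP lhomP tP scaleDD.
- by exists 0; [apply: smem0 | rewrite !linear0 addr0].
(* D (c y') = D (c) y' as c lies in I, so c y' is the required element of I. *)
have [y' y'E] := bqpi_ex (vt (src a) *a y).
pose c := s (l *a vt (tgt a)) *a al a - s (l *a ar a).
have Ic : I c by apply/bqpi_eq0; rewrite bqpiB bqpiM !sE -amulA vt_tgt subrr.
have Dc : udiff (c *a y') = actr (vt (src a) *a y) (udiff c).
  by rewrite udiffM ((bqpi_eq0 c).2 Ic) actl0 add0r y'E.
exists (c *a y'); first exact: Defs.idealMr.
have -> : d1 (actl l (actr y (g1 a))) =
    actl (l *a ar a) (actr y (g0 (src a))) - actl l (actr (ar a *a y) (g0 (tgt a))).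
  by rewrite lhom_actl lhom_actr d1_gen actrBr actlBr actrl -actlM -actrM.
rewrite [t _]linearB !tE -[l *a ar a *a _]amulA vt_src !amulA vt_tgt.
rewrite Dc udiffB udiff_arrow sE actrBr actrDr -actrM !amulA vt_src addrA subrK addrK.
by rewrite actrM actrl actlM actr_g1 actrl actl_g1.
Qed.

(* B is kQ / I^2, in which I / I^2 is realized. *)
Local Notation B := (aquot (admissible_square_fc admI)).
Local Notation pi2 := (api (admissible_square_fc admI)).

Lemma pi2_mulI c x y : I c -> bqpi x = bqpi y -> pi2 (c *a x) = pi2 (c *a y).
Proof.
move=> Ic /eqP; rewrite -subr_eq0 -linearB => /eqP /bqpi_eq0 Ixy.
apply/eqP; rewrite -subr_eq0 -linearB -amulxB; apply/eqP/api_eq0.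
exact: mem_ideal_mul.
Qed.

Lemma pi2_mulIl c x y : I c -> bqpi x = bqpi y -> pi2 (x *a c) = pi2 (y *a c).
Proof.
move=> Ic /eqP; rewrite -subr_eq0 -linearB => /eqP /bqpi_eq0 Ixy.
apply/eqP; rewrite -subr_eq0 -linearB -amulBx; apply/eqP/api_eq0.
exact: mem_ideal_mul.
Qed.

(** The linear map r (l (x) a (x) y) = (s(l) a - s(l a)) s(y) from proj1 to kQ / I^2
    satisfies r (D x) = s(1) x - s(x mod I) by a telescoping induction. For x in I
    the right-hand side is the class of x, because s(1) - 1 lies in I. *)
Lemma udiff_ker x : I x -> udiff x = 0 -> pi2 x = 0.
Proof.
have [s [sE sv]] := section_exists.
have sP c l l' : s (c *: l + l') = c *: s l + s l' by exact: linearP.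
have pi2P c z w : pi2 (c *: z + w) = c *: pi2 z + pi2 w by exact: linearP.
have pi2D z w : pi2 (z + w) = pi2 z + pi2 w by exact: linearD.
pose delta a l := s l *a al a - s (l *a ar a).
have deltaP a c l l' : delta a (c *: l + l') = c *: delta a l + delta a l'.
  rewrite /delta [in X in X - _]sP 2!amul_linl sP; exact: scaleBD.
have Idelta a l : I (delta a l).
  by apply/bqpi_eq0; rewrite bqpiB bqpiM !sE subrr.
pose beta a l y := pi2 (delta a l *a s y).
have [||r rE] := @pair_bilin _ L _ (fun a => vt (tgt a)) (fun a => vt (src a)) B beta.
- by move=> a y c l l'; rewrite /beta deltaP amul_linl pi2P.
- by move=> a l c y y'; rewrite /beta sP amul_linr pi2P.
have rP c z w : r (c *: z + w) = c *: r z + r w by exact: linearP.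
have rA z w : r (z + w) = r z + r w by exact: linearD.
have r0 : r 0 = 0 by exact: linear0.
(* r is linear for the right action of kQ, since values of delta lie in I and
   two lifts of the same right factor differ by an element of I. *)
have rR z y : r (actr (bqpi y) z) = r z *a pi2 y.
  elim/proj1_ind: z => [c z w Hz Hw||l u a].
  - by rewrite actrPr !rP Hz Hw; exact/esym/amul_linl.
  - by rewrite actr0r r0; exact/esym/amul0x.
  rewrite actrl -actrM !rE /beta -apiM -amulA; apply: pi2_mulI => //.
  by rewrite bqpiM !sE !amulA.
suff rD y : r (udiff y) = pi2 (s aone *a y - s (bqpi y)).
  move=> Ix Dx; have := rD x; rewrite Dx r0 ((bqpi_eq0 x).2 Ix) linear0 subr0.
  by rewrite (@pi2_mulIl x (s aone) aone Ix) ?amul1x ?sE ?bqpi1.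
elim/path_algebra_ind: y => [c y z Hy Hz||i|y a Hy].
- rewrite udiffP rP Hy Hz -pi2P amul_linr bqpiP sP; congr (pi2 _).
  exact/esym/scaleBD.
- by rewrite udiff0 r0 amulx0 bqpi0 linear0 subr0 linear0.
- by rewrite udiff_e r0 -sv amul1x subrr linear0.
rewrite udiff_arrow -[g1 a]actr1 rA rE rR Hy /beta amulx1 -apiM.
have -> : pi2 (delta a (bqpi y *a vt (tgt a)) *a s (vt (src a))) =
    pi2 (delta a (bqpi y *a vt (tgt a)) *a e (src a)).
  by apply: pi2_mulI => //; rewrite sE.
rewrite /delta -amulA vt_tgt sv amulBx -!amulA e_src e_tgt -sv -amulA vt_src.
rewrite -pi2D bqpiM; congr (pi2 _).
by rewrite amulBx amulA addrC addrA subrK.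
Qed.

Local Notation F := (ideal_pow (arrow_ideal k Q)).

(** Spanned by the images of F^a (x) F^b with a + b >= m. The term of index 1 is
    the radical of L^e, and the terms of large index vanish because I contains a
    power of F. *)
Definition env_filt (m : nat) : {vspace env L} :=
  vspan (fun z => exists a b x y, [/\ (m <= a + b)%N, F a x, F b y & z = pure (bqpi x) (bqpi y)]).

Lemma env_filt0 : env_filt 0 = fullv.
Proof.
apply/eqP; rewrite eqEsubv subvf; apply/subvP => z _.
elim/env_ind: z => [c u v Hu Hv||l r]; first by rewrite memvD ?memvZ.
  exact: mem0v.
have [x <-] := bqpi_ex l; have [y <-] := bqpi_ex r.
by apply: mem_vspan; exists 0, 0, x, y; split => //; apply: mem_gen_ideal.
Qed.

Lemma env_filtM m n a b : a \in env_filt m -> b \in env_filt n -> a *a b \in env_filt (m + n).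
Proof.
move=> Ja Jb; pose f (y : env L) : 'End(env L) := linfun (amulr y).
suff sub : (env_filt m <= f b @^-1: env_filt (m + n))%VS.
  by have := subvP sub _ Ja; rewrite -memv_preim lfunE.
apply: vspan_min => _ [i [j [x [y [mij Fx Fy ->]]]]]; rewrite -memv_preim lfunE /= /amulr.
pose h (y : env L) : 'End(env L) := linfun (amul y).
suff sub : (env_filt n <= h (pure (bqpi x) (bqpi y)) @^-1: env_filt (m + n))%VS.
  by have := subvP sub _ Jb; rewrite -memv_preim lfunE.
apply: vspan_min => _ [i' [j' [x' [y' [nij Fx' Fy' ->]]]]]; rewrite -memv_preim lfunE /=.
rewrite pureM -!bqpiM; apply: mem_vspan; exists (i + i')%N, (j' + j)%N, (x *a x'), (y' *a y).
by split=> //; [lia | apply: ideal_powD..].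
Qed.

Lemma env_filt_nil : exists n, env_filt n = 0%VS.
Proof.
have [n _ [FI _]] := admI; exists (n + n)%N; apply/eqP; rewrite -subv0.
apply: vspan_min => _ [a [b [x [y [le Fx Fy ->]]]]]; rewrite memv0; apply/eqP.
have [na|nb] := leqP n a.
  rewrite ((bqpi_eq0 x).2 (FI _ (ideal_pow_le na Fx))).
  exact: (linear0 (pure_l (bqpi y))).
have {}nb : (n <= b)%N by lia.
by rewrite ((bqpi_eq0 y).2 (FI _ (ideal_pow_le nb Fy))) linear0.
Qed.

Definition radm (P : lmodule (env L)) : {vspace P} := act_span P (env_filt 1).

Lemma radm_superfluous (P : lmodule (env L)) (U : {vspace P}) :
  (U <= radm P)%VS -> superfluous U.
Proof.
have [n Jn] := env_filt_nil; apply: (superfluous_filtered (n := n)) => //.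
  exact: env_filt0.
by move=> m a b Ja Jb; rewrite -addn1; apply: env_filtM.
Qed.

Lemma radm_lact (P : lmodule (env L)) a x : x \in radm P -> lact P a x \in radm P.
Proof.
move=> Rx; suff sub : (radm P <= lact P a @^-1: radm P)%VS.
  by have := subvP sub _ Rx; rewrite -memv_preim.
apply: vspan_min => _ [b [y [Jb ->]]]; rewrite -memv_preim -lactME; apply: mem_act_span.
by rewrite -[1%N]add0n; apply: env_filtM => //; rewrite env_filt0 memvf.
Qed.

Lemma radm_actl (P : lmodule (env L)) x (z : P) : F 1 x -> actl (bqpi x) z \in radm P.
Proof.
move=> Fx; apply/mem_act_span/mem_vspan; exists 1%N, 0%N, x, aone; split=> //.
exact: mem_gen_ideal.
Qed.

Lemma radm_actr (P : lmodule (env L)) x (z : P) : F 1 x -> actr (bqpi x) z \in radm P.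
Proof.
move=> Fx; apply/mem_act_span/mem_vspan; exists 0%N, 1%N, aone, x; split=> //.
exact: mem_gen_ideal.
Qed.

Lemma F1_arrow a : F 1 (al a).
Proof.
rewrite -[al a]amulx1; apply: (@mem_ideal_mul _ _ (arrow_ideal k Q) (F 0)); last exact: mem_gen_ideal.
by apply: mem_gen_ideal; exists a.
Qed.

Lemma limg_d1_rad : (limg d1 <= radm proj0)%VS.
Proof.
apply/subvP => _ /memv_imgP[z _ ->]; elim/proj1_ind: z => [c x y Hx Hy||l r a].
- by rewrite lhomP memvD ?memvZ.
- by rewrite lhom0 mem0v.
rewrite lhom_actl lhom_actr d1_gen actlr; apply: radm_lact.
by apply: memvB; [apply: radm_actl | apply: radm_actr]; apply: F1_arrow.
Qed.

(** Marking an arrow in a path of length at least 2 leaves another arrow on one of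
    the sides. The condition F 1 z is carried along to absorb the term D(a) u of
    the Leibniz rule. *)
Lemma udiff_rad x : F 2 x -> udiff x \in radm proj1.
Proof.
pose S z := F 1 z /\ udiff z \in radm proj1.
have S0 : S 0 by split; [apply: smem0 | rewrite udiff0 mem0v].
have SD u v : S u -> S v -> S (u + v).
  move=> [Fu Du] [Fv Dv]; split; first exact: smemD.
  by rewrite -[u]scale1r udiffP scale1r memvD.
have SZ c u : S u -> S (c *: u).
  move=> [Fu Du]; split; first exact: smemZ.
  by rewrite -[c *: u]addr0 udiffP udiff0 addr0 memvZ.
have Sl a u : S u -> S (a *a u).
  move=> [Fu Du]; split; first exact: idealMl.
  by rewrite udiffM; apply: memvD; [apply: radm_lact | apply: radm_actr].
have Sr a u : S u -> S (u *a a).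
  move=> [Fu Du]; split; first exact: Defs.idealMr.
  by rewrite udiffM; apply: memvD; [apply: radm_actl | apply: radm_lact].
move=> F2x; suff [] : S x by [].
apply: (F2x (@Ideal _ _ (Subspace S0 SD SZ) Sl Sr)) => _ [u [v [Fu Fv ->]]].
have F1u : F 1 u by rewrite -[u]amulx1; apply: mem_ideal_mul => //; apply: mem_gen_ideal.
split; first exact: Defs.idealMr.
by rewrite udiffM; apply: memvD; [apply: radm_actl | apply: radm_actr].
Qed.

Lemma lker_d1_rad : (lker d1 <= radm proj1)%VS.
Proof.
apply/subvP => z; rewrite memv_ker => /eqP /lker_d1_udiff[x Ix ->]; apply: udiff_rad.
by have [n _ [_ IF]] := admI; apply: IF.
Qed.

Definition quiver_presentation : min_presentation M :=
  @MinPresentation _ _ M proj0 proj1 d0 d1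
    (idem_projective (pair_idem vt_idem vt_idem))
    (idem_projective (pair_idem (fun a => vt_idem (tgt a)) (fun a => vt_idem (src a))))
    d0_surj d1_exact
    (radm_superfluous (eq_ind _ (fun U => (U <= radm proj0)%VS) limg_d1_rad _ d1_exact))
    (radm_superfluous lker_d1_rad).

Section Conormal.
Local Notation Cn := (conormal_bimodule admI).
Local Notation K := (lker_mod d1).

Let cval (u : Cn) : B := vsval (u : subvs_of (vspan (api_image_sub (admissible_square_fc admI) I))).

Let cvalP u : exists2 x, I x & cval u = pi2 x.
Proof. exact: (@mem_api_image _ _ _ (admissible_square_fc admI) I (cval u)).1 (subvsP _). Qed.

Let cval_ex x : I x -> exists u, cval u = pi2 x.
Proof.
move=> Ix; have U : pi2 x \in vspan (api_image_sub (admissible_square_fc admI) I).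
  by apply/mem_api_image; exists x.
by exists (Subvs U).
Qed.

Let cval_inj u v : cval u = cval v -> u = v.
Proof. exact: subvs_inj. Qed.

Let cval_l a u : cval (blact Cn a u) = pi2 a *a cval u.
Proof.
rewrite /cval [LHS]sub_mapE; first by rewrite aquot_blactE.
by apply: api_image_l; apply: subvsP.
Qed.

Let cval_r a u : cval (bract Cn a u) = cval u *a pi2 a.
Proof.
rewrite /cval [LHS]sub_mapE; first by rewrite aquot_bractE.
by apply: api_image_r; apply: subvsP.
Qed.

Let udiff_pi2 x y : pi2 x = pi2 y -> udiff x = udiff y.
Proof.
move=> /eqP; rewrite -subr_eq0 -linearB => /eqP /(api_eq0 (admissible_square_fc admI)) Ixy.
by apply/eqP; rewrite -subr_eq0 -udiffB udiff_ideal_square.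
Qed.

(** The isomorphism from I / I^2 to the second syzygy is induced by D: udiff_ker
    gives injectivity and lker_d1_udiff surjectivity. *)
Lemma conormal_iso : exists c : 'Hom(Cn, K),
  [/\ injective c, limg c = fullv,
      forall a u, c (blact Cn a u) = actl (bqpi a) (c u) &
      forall a u, c (bract Cn a u) = actr (bqpi a) (c u)].
Proof.
have ex u : exists z : K, forall x, I x -> cval u = pi2 x -> lker_incl d1 z = udiff x.
  have [x Ix ux] := cvalP u; have [z zx] := lker_modK (d1_udiff0 Ix).
  by exists z => y Iy uy; rewrite zx; apply: udiff_pi2; rewrite -ux.
have [c cE] := choice ex.
have clin : linear c.
  move=> s u v; have [[x Ix ux] [y Iy vy]] := (cvalP u, cvalP v).
  apply: lker_incl_inj; rewrite lhomP (cE u x) // (cE v y) // -udiffP; apply: cE.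
    by apply: smemD => //; apply: smemZ.
  have -> : pi2 (s *: x + y) = s *: pi2 x + pi2 y by exact: linearP.
  by rewrite -ux -vy; exact: linearP.
have [f fE] := linear_lfun clin; exists f; split.
- move=> u v; rewrite !fE => cuv; have [[x Ix ux] [y Iy vy]] := (cvalP u, cvalP v).
  apply: cval_inj; rewrite ux vy; apply/eqP; rewrite -subr_eq0 -linearB; apply/eqP.
  apply: udiff_ker.
    by rewrite -scaleN1r addrC; apply: smemD => //; apply: smemZ.
  by rewrite udiffB -(cE u x) // -(cE v y) // cuv subrr.
- apply/limg_fullvP => z; have [x Ix zx] := lker_d1_udiff (lker_modP z).
  have [u ux] := cval_ex Ix; exists u; rewrite fE; apply: lker_incl_inj.
  by rewrite (cE u x).
- move=> a u; rewrite !fE; have [x Ix ux] := cvalP u; apply: lker_incl_inj.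
  rewrite lhom_actl (cE u x) // (cE _ (a *a x)); last by rewrite cval_l ux apiM.
    by rewrite udiffM ((bqpi_eq0 x).2 Ix) actr0 addr0.
  exact: idealMl.
move=> a u; rewrite !fE; have [x Ix ux] := cvalP u; apply: lker_incl_inj.
rewrite lhom_actr (cE u x) // (cE _ (x *a a)); last by rewrite cval_r ux apiM.
  by rewrite udiffM ((bqpi_eq0 x).2 Ix) actl0 add0r.
exact: Defs.idealMr.
Qed.

Lemma hdim_syzygy2 : hdim K M = \dim (homB Cn (bqa_bimodule admI)).
Proof.
have [c [cinj cs cl cr]] := conormal_iso.
have [|T TE] := @linear_lfun _ (lhom K M) 'Hom(Cn, bqa_bimodule admI)
   (fun h => ((h : lhom K M) : 'Hom(K, M)) \o c)%VF.
  move=> s u v; apply/lfunP => z; rewrite add_lfunE scale_lfunE !comp_lfunE.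
  exact: (lhom_linE s u v (c z)).
have <- : limg T = homB Cn (bqa_bimodule admI).
  apply/vspaceP => h; apply/memv_imgP/idP => [[g _ ->]|/homBP[hl hr]].
    apply/homBP; rewrite TE; split=> a u; rewrite 2!comp_lfunE.
      by rewrite cl aquot_blactE -(reg_actl (L := L) (bqpi a)); exact: (lhom_actl g (bqpi a) (c u)).
    by rewrite cr aquot_bractE -(reg_actr (L := L) (bqpi a)); exact: (lhom_actr g (bqpi a) (c u)).
  have cK z : c ((c^-1)%VF z) = z by apply: limg_lfunVK; rewrite cs memvf.
  pose g : 'Hom(K, M) := ((h : 'Hom(Cn, M)) \o c^-1)%VF.
  have geq : equivariant g.
    apply: sided_equivariant => l z; have [a <-] := bqpi_ex l; rewrite /g !comp_lfunE.
      rewrite reg_actl -(aquot_blactE a (h _)) -hl; congr (h _); apply: cinj.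
      by rewrite cl !cK.
    rewrite reg_actr -(aquot_bractE a (h _)) -hr; congr (h _); apply: cinj.
    by rewrite cr !cK.
  exists (mk_lhom g); rewrite ?memvf // TE mk_lhomE //; apply/lfunP => u.
  by rewrite /g !comp_lfunE; congr (h _); apply: cinj; rewrite cK.
apply/esym/limg_dim_eq/eqP; rewrite -subv0; apply/subvP => g /memv_capP[_].
rewrite memv_ker memv0 => /eqP Tg; apply/eqP/lhom_inj => z.
have [u <-] := (limg_fullvP c).1 cs z.
by rewrite -comp_lfunE -TE Tg !zero_lfunE.
Qed.
End Conormal.
End BoundQuiver.

Theorem theorem4p5 (k : fieldType) (Q : quiver) (I : ideal (path_algebra k Q))
    (admI : admissible I) :
  excess (bound_quiver_algebra admI) =
    (\dim (homB (conormal_bimodule admI) (bqa_bimodule admI)))%:Z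
    - (\dim {: HH (bound_quiver_algebra admI) 2})%:Z.
Proof.
set L := bound_quiver_algebra admI; pose M := reg_env L.
pose q := quiver_presentation admI; pose R := free_resolution M; pose p := min_presentation_of M.
have tauE : \dim {: HHtau1 L} = hdim M (tau M) by exact: dim_hom_dual.
have := dim_hom_tau p; rewrite -[tau_of p]/(tau M) -tauE => e1.
have [] := min_presentation_hdim M p q; rewrite -/(mp_P0 q) => e2 e3.
have e4 : (\dim {: HH L 1} + hdim (pr_mod R 0) M = hdim (lker_mod (pr_aug R)) M + hdim M M)%N.
  exact: dim_ext1.
have e5 : (\dim {: HH L 2} + hdim (pr_mod R 1) M =
    hdim (lker_mod (pr_diff R 0)) M + hdim (lker_mod (pr_aug R)) M)%N by exact: dim_ext2.
have := @long_schanuel _ _ _ _ _ _ M M _ _ _ _ (@mp_proj0 _ _ _ q) (@mp_proj1 _ _ _ q)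
  (mp_surj q) (mp_exact q) (@pr_proj _ _ _ R 0) (@pr_proj _ _ _ R 1) (pr_surj R) (pr_exact0 R).
have -> : hdim (lker_mod (mp_d1 q)) M = \dim (homB (conormal_bimodule admI) (bqa_bimodule admI)).
  exact: hdim_syzygy2.
(* The modules are abstracted away: the conclusion is linear in the dimensions. *)
have arith (t h1 h2 p0 p1 q0 q1 r0 r1 o1 o2 m b : nat) :
    (t + p0 = p1 + m)%N -> p0 = q0 -> p1 = q1 -> (h1 + r0 = o1 + m)%N ->
    (h2 + r1 = o2 + o1)%N -> (b + q0 + r1 = o2 + r0 + q1)%N ->
    t%:Z - h1%:Z = b%:Z - h2%:Z by lia.
exact: (arith _ _ _ _ _ _ _ _ _ _ _ _ _ e1 e2 e3 e4 e5).
Qed.
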